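(* Let $\sigma$ be a measurable function on $\mathfrak X\times\Omega\times[0,\tau]$ such that $T_\sigma:L^2(\mathfrak X)\to L^2(\mathfrak X)$ is nuclear, and let $\sigma^*$ be the symbol of the adjoint $T_\sigma^*$. Then for all $(y,\omega_1,s_1)\in\mathfrak X\times\Omega\times[0,\tau]$, $$\sigma^*(y,\omega_1,s_1)=q^{-(\frac12-is_1)h_{\omega_1}(y)}\sum_{x\in\mathfrak X}q^{(\frac12-is_1)h_{\omega_1}(x)}\int_\Omega\int_0^\tau\overline{\sigma(x,\omega,s)}\,q^{(\frac12+is)h_\omega(x)}\,q^{(\frac12-is)h_\omega(y)}\,d\nu(\omega)\,d\mu(s).$$
   Context: Let $q\ge 2$ be an integer and let $\mathfrak X$ be (the vertex set of) the homogeneous tree of degree $q+1$: the connected graph without loops (cycles) in which every vertex has exactly $q+1$ neighbours. $d(x,y)$ is the number of edges between $x$ and $y$; a reference vertex $o$ is fixed and $|x|=d(o,x)$. $\mathfrak X$ carries the counting measure and $L^2(\mathfrak X)$ is taken with respect to it. $\Omega$ is the set of infinite geodesic rays $\omega=(\omega_0,\omega_1,\dots)$ with $\omega_0=o$. The height function is $h_\omega(x)=\lim_{m\to\infty}(m-d(x,\omega_m))=2|c(x,\omega)|-|x|$, where $c(x,\omega)$ is the last vertex on the geodesic path $[o,x]$ that lies on $\omega$. $\nu$ is the probability measure on $\Omega$ (with the $\sigma$-algebra generated by the sets $E(x)=\{\omega:\omega\text{ passes through }x\}$) with $\nu(E(x))=\frac{q}{(q+1)q^{|x|}}$ for $x\neq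 o$. Put $\tau=\pi/\log q$ and $d\mu(s)=c_P|c(s)|^{-2}ds$ on $[0,\tau]$, with $c_P=\frac{q\log q}{4\pi(q+1)}$ and $c(z)=\frac{q^{1/2}}{q+1}\,\frac{q^{1/2+iz}-q^{-1/2-iz}}{q^{iz}-q^{-iz}}$. The Fourier-Helgason transform of a finitely supported $f:\mathfrak X\to\mathbb C$ is $\mathcal Hf(\omega,s)=\sum_{y\in\mathfrak X}f(y)q^{(\frac12+is)h_\omega(y)}$, $\omega\in\Omega$, $s\in[0,\tau]$. For a measurable function $\sigma$ (the symbol) and finitely supported $f$, the pseudo-differential operator $T_\sigma$ is defined formally by $T_\sigma f(x)=\int_\Omega\int_0^\tau q^{(\frac12-is)h_\omega(x)}\sigma(x,\omega,s)\mathcal Hf(\omega,s)\,d\nu(\omega)\,d\mu(s)$, $x\in\mathfrak X$. $T_\sigma^*$ is the adjoint of $T_\sigma$ on the Hilbert space $L^2(\mathfrak X)$, and its symbol $\sigma^*$ is the function with $T_\sigma^*=T_{\sigma^*}$. A bounded linear operator $T:X\to Y$ of complex Banach spaces is nuclear if there are sequences $\{x_n'\}$ in the dual $X'$ and $\{y_n\}$ in $Y$ with $\sum_n\|x_n'\|_{X'}\|y_n\|_Y<\infty$ and $Tx=\sum_n x_n'(x)y_n$ for all $x\in X$.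
   Formalization: c_P is taken as q log q/(2π(q+1)), since the stated value is off by a factor 2; for each y the series is shown to converge unconditionally to σ* in L²(ν×μ), and the formula holds for almost every (ω₁,s₁) at which the series over x converges, instead of at all points. *)

(* Defs.v *)
From HB Require Import structures.
From mathcomp Require Import all_boot all_order all_algebra finmap.
From mathcomp Require Import all_classical all_reals all_analysis.
From mathcomp Require Import complex.
From mathcomp Require Import ring lra.
From mathcomp Require summability.

Set Implicit Arguments.
Unset Strict Implicit.
Unset Printing Implicit Defensive.
Import Order.TTheory GRing.Theory Num.Theory.
Import numFieldNormedType.Exports.

Local Open Scope classical_set_scope.
Local Open Scope ring_scope.
Local Open Scope complex_scope.


(* [1 < q] is part of the structure because geodesic rays must exist: measurable
   types are pointed in the library, hence so must be the boundary *)
Record homTree (q : nat) := HomTree {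
  vertex :> choiceType;
  adj : rel vertex;
  homTree_q : (1 < q)%N;
  adj_sym : symmetric adj;
  adj_irr : irreflexive adj;
  adj_connected : forall x y, exists p, path adj x p /\ last x p = y;
  adj_acyclic : forall c : seq vertex, (2 < size c)%N -> uniq c -> ~~ cycle adj c;
  adj_degree : forall x, exists s : seq vertex,
    [/\ uniq s, size s = q.+1 & forall y, adj x y = (y \in s)] }.

Section Tree.
Context (q : nat) (X : homTree q).
Implicit Types (x y o : X) (n : nat).

Definition walk n x y : Prop :=
  exists p, [/\ path (@adj q X) x p, last x p = y & size p = n].

Lemma walk_ex x y : exists n, `[< walk n x y >].
Proof. by have [p [pp lp]] := adj_connected x y; exists (size p); apply/asboolP; exists p. Qed.

Definition dist x y : nat := ex_minn (walk_ex x y).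

Lemma distP x y : walk (dist x y) x y.
Proof. by rewrite /dist; case: ex_minnP => n /asboolP. Qed.

Lemma dist_le n x y : walk n x y -> (dist x y <= n)%N.
Proof. by rewrite /dist; case: ex_minnP => m _ mP w; apply/mP/asboolP. Qed.

Lemma dist0 x : dist x x = 0%N.
Proof. by apply/eqP; rewrite -leqn0; apply: dist_le; exists [::]. Qed.

Lemma walk_cat m n x y z : walk m x y -> walk n y z -> walk (m + n) x z.
Proof.
move=> [p [pp lp sp]] [r [pr lr sr]]; exists (p ++ r).
by rewrite cat_path last_cat lp pp pr lr size_cat sp sr.
Qed.

Lemma dist_triangle x y z : (dist x z <= dist x y + dist y z)%N.
Proof. exact/dist_le/(walk_cat (distP _ _) (distP _ _)). Qed.

Lemma dist_adj x y : adj x y -> (dist x y <= 1)%N.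
Proof. by move=> xy; apply: dist_le; exists [:: y]; rewrite /= xy. Qed.

Lemma dist_eq0 x y : dist x y = 0%N -> x = y.
Proof. by move=> d0; have := distP x y; rewrite d0 => -[p [_ <- /size0nil ->]]. Qed.

Lemma walk_sym n x y : walk n x y -> walk n y x.
Proof.
move=> [p [pp lp sp]]; exists (rev (belast x p)); split.
- by rewrite -lp rev_path; under eq_path do rewrite adj_sym.
- case: p lp {pp sp} => [|a p] //= lp; by rewrite rev_cons last_rcons.
- by rewrite size_rev size_belast.
Qed.

Lemma dist_sym x y : dist x y = dist y x.
Proof. by apply/eqP; rewrite eqn_leq !dist_le//; apply/walk_sym/distP. Qed.

Lemma geodesic_avoid o a x : a != x -> (dist a o <= dist x o)%N ->
  exists p, [/\ path (@adj q X) a p, last a p = o & x \notin a :: p].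
Proof.
move=> ax le_ax; have [p [pp lp sp]] := distP a o; exists p; split=> //.
rewrite inE eq_sym negb_or ax /=; apply/negP => xp.
case/splitPr: xp pp lp sp => p1 p2; rewrite cat_path last_cat /= size_cat /=.
move=> /and3P[_ _ p2P] lp sp.
have : (dist x o <= size p2)%N by apply: dist_le; exists p2.
by move=> /(leq_trans le_ax); rewrite -sp addnS ltnNge leq_addl.
Qed.

Lemma uniq_parent o x a b : adj x a -> adj x b ->
  (dist a o <= dist x o)%N -> (dist b o <= dist x o)%N -> a = b.
Proof.
move=> xa xb la lb; apply: contrapT => /eqP ab.
have nx c : adj x c -> c != x.
  by move=> xc; apply/eqP => cx; move: xc; rewrite cx adj_irr.
have [p [pp lp xp]] := geodesic_avoid (nx _ xa) la.
have [r [pr lr xr]] := geodesic_avoid (nx _ xb) lb.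
pose t := p ++ rev (belast b r).
have pt : path (@adj q X) a t.
  rewrite cat_path pp lp -lr rev_path.
  by under eq_path do rewrite adj_sym.
have lt : last a t = b.
  rewrite last_cat lp -lr; case: (r) => [|c s] //=.
  by rewrite rev_cons last_rcons.
have xt : x \notin a :: t.
  rewrite -cat_cons mem_cat negb_or xp mem_rev.
  by apply: contra xr; exact: mem_belast.
case/shortenP: pt lt => t' pt' ut' sub lt'.
have xt' : x \notin a :: t'.
  by apply: contra xt; rewrite !inE => /orP[->//|/sub ->]; rewrite orbT.
have := @adj_acyclic q X (x :: a :: t').
rewrite /= -/(uniq (a :: t')) xt' ut' xa rcons_path pt' lt' adj_sym xb /=.
case: (t') lt' ab => [/= -> |? ? _ _]; first by rewrite eqxx.
by move=> /(_ isT isT).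
Qed.

Lemma dist_adj_geo o x : exists y, adj x y /\ dist y o = (dist x o).+1.
Proof.
have q1 := homTree_q X; have [s [us ss sP]] := adj_degree x.
have [a [sa da]] : exists a, a \in s /\ (dist x o < dist a o)%N.
  case: s us ss sP => [//|a [|b s]] //= us ss sP; first by move: q1; rewrite -ltnS -ss.
  have [|la] := ltnP (dist x o) (dist a o); first by exists a; rewrite inE eqxx.
  have [|lb] := ltnP (dist x o) (dist b o); first by exists b; rewrite !inE eqxx orbT.
  move: us; rewrite (@uniq_parent o x a b) ?inE ?eqxx//.
  - by rewrite sP inE eqxx.
  - by rewrite sP !inE eqxx orbT.
exists a; split; first by rewrite sP.
apply/eqP; rewrite eqn_leq da andbT.
rewrite (leq_trans (dist_triangle a x o))// -add1n leq_add2r dist_adj//.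
by rewrite adj_sym sP.
Qed.


Record ray o := Ray {
  rayf :> nat -> X;
  ray0 : rayf 0 = o;
  ray_geodesic : forall m n, (m <= n)%N -> dist (rayf m) (rayf n) = (n - m)%N }.

Definition child o x : X := sval (cid (dist_adj_geo o x)).
Definition some_rayf o n : X := iter n (child o) o.

Lemma some_rayf_dist o n : dist (some_rayf o n) o = n.
Proof.
elim: n => [|n ih]; first exact: dist0.
by rewrite /= /child; case: cid => y /= [_ ->]; rewrite ih.
Qed.

Lemma some_ray_geodesic o m n : (m <= n)%N ->
  dist (some_rayf o m) (some_rayf o n) = (n - m)%N.
Proof.
move=> mn; apply/eqP; rewrite eqn_leq; apply/andP; split.
  rewrite -{1}(subnKC mn); elim: (n - m)%N => [|k ih]; first by rewrite addn0 dist0.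
  rewrite addnS (leq_trans (dist_triangle _ (some_rayf o (m + k)) _))//.
  rewrite -[leqRHS]addn1 leq_add// dist_adj//= /child.
  by case: cid => y [].
have := dist_triangle (some_rayf o n) (some_rayf o m) o.
by rewrite !some_rayf_dist leq_subLR addnC dist_sym.
Qed.

Definition some_ray o : ray o := Ray (erefl : some_rayf o 0 = o) (@some_ray_geodesic o).

HB.instance Definition _ o := gen_eqMixin (ray o).
HB.instance Definition _ o := gen_choiceMixin (ray o).
HB.instance Definition _ o := isPointed.Build (ray o) (some_ray o).

Definition cylinder o x : set (ray o) := [set w | exists n, w n = x].

Definition Omega o := g_sigma_algebraType (range (@cylinder o)).

End Tree.

Arguments dist {q X}.
Arguments cylinder {q X}.
Arguments Omega {q X}.


Notation normc := ComplexField.Normc.normc.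

Section L2.
Context (R : realType) (T : choiceType).
Local Notation C := R[i].
Implicit Types (f g : T -> C).

Definition sqsum f : \bar R := (\esum_(x in [set: T]) (normc (f x) ^+ 2)%:E)%E.

Definition sqsummable : {pred T -> C} := fun f => `[< (sqsum f < +oo)%E >].

Record L2 := MkL2 { L2val :> T -> C; L2P : L2val \in sqsummable }.

HB.instance Definition _ := [isSub for L2val].
HB.instance Definition _ := [Choice of L2 by <:].

Lemma normc_ge0 (z : C) : 0 <= normc z.
Proof. by case: z => a b; exact: sqrtr_ge0. Qed.

Lemma normc_triangle (y z : C) : normc (y + z) <= normc y + normc z.
Proof. by rewrite -lecR rmorphD /=; exact: (ler_normD y z). Qed.

Lemma sqsum_ge0 f : (0 <= sqsum f)%E.
Proof. by apply: esum_ge0 => x _; rewrite lee_fin sqr_ge0. Qed.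

Lemma esum_scale (a : T -> R) (k : R) : 0 <= k -> (forall x, 0 <= a x) ->
  (\esum_(x in [set: T]) (k * a x)%:E = k%:E * \esum_(x in [set: T]) (a x)%:E)%E.
Proof.
move=> k0 a0; have [->|kn0] := eqVneq k 0.
  by rewrite mul0e esum1// => x _; rewrite mul0r.
have le c (b : T -> R) : 0 < c -> (forall x, 0 <= b x) ->
    (\esum_(x in [set: T]) (c * b x)%:E <= c%:E * \esum_(x in [set: T]) (b x)%:E)%E.
  move=> c0 b0; apply: ge_ereal_sup => _ [F [finF _] <-].
  rewrite (eq_fsbigr (fun x => c%:E * (b x)%:E)%E); last by move=> x _; rewrite EFinM.
  rewrite -ge0_mule_fsumr; last by move=> x; rewrite lee_fin.
  rewrite lee_pmul2l ?lte_fin//; apply: ereal_sup_ubound; exists F => //.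
apply/eqP; rewrite eq_le; apply/andP; split; first by apply: le; rewrite ?lt_def ?kn0.
have k1 : 0 < k by rewrite lt_def kn0.
rewrite -[X in (_ <= X)%E]mul1e -(divff kn0) EFinM -muleA lee_pmul2l ?lte_fin//.
rewrite -[X in (X <= _)%E](_ : \esum_(x in [set: T]) (k^-1 * (k * a x))%:E = _)%E.
  by apply: le; rewrite ?invr_gt0// => x; rewrite mulr_ge0.
by apply: eq_esum => x _; rewrite mulKf.
Qed.

Lemma sqsumZ (k : C) f : (sqsum (k *: f)%R = (normc k ^+ 2)%:E * sqsum f)%E.
Proof.
rewrite /sqsum -esum_scale ?sqr_ge0//; last by move=> x; exact: sqr_ge0.
by apply: eq_esum => x _; rewrite ComplexField.Normc.normcM exprMn.
Qed.

Lemma sqsumD (t : R) f g : 0 < t ->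
  (sqsum (f + g)%R <= (1 + t)%:E * sqsum f + (1 + t^-1)%:E * sqsum g)%E.
Proof.
move=> t0; have t1 : 0 < t^-1 by rewrite invr_gt0.
have t2 : 0 <= 1 + t by rewrite addr_ge0 // ltW.
have t3 : 0 <= 1 + t^-1 by rewrite addr_ge0 // ltW.
have n2 (h : T -> C) x : 0 <= normc (h x) ^+ 2 by exact: sqr_ge0.
rewrite /sqsum -(esum_scale t2 (n2 f)) -(esum_scale t3 (n2 g)).
rewrite -esumD; try by move=> x _; rewrite lee_fin mulr_ge0.
apply: le_esum => x _; rewrite -EFinD lee_fin.
apply: (@le_trans _ _ ((normc (f x) + normc (g x)) ^+ 2)).
  by rewrite ler_pXn2r ?nnegrE ?addr_ge0 ?normc_ge0 ?normc_triangle.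
rewrite -subr_ge0.
set a := normc (f x); set b := normc (g x).
suff -> : (1 + t) * a ^+ 2 + (1 + t^-1) * b ^+ 2 - (a + b) ^+ 2 =
  t^-1 * (t * a - b) ^+ 2 by rewrite mulr_ge0 ?sqr_ge0 ?ltW.
by field; rewrite gt_eqF.
Qed.

Lemma sqsummable_submod : submod_closed sqsummable.
Proof.
split=> [|k f g /asboolP fP /asboolP gP]; apply/asboolP.
  by rewrite /sqsum esum1 ?ltry// => x _; rewrite -[normc _]/(normc (0 : C)) ComplexField.Normc.normc0 expr0n.
apply: le_lt_trans (sqsumD _ _ ltr01) _.
by rewrite sqsumZ lte_add_pinfty// lte_mul_pinfty ?mule_ge0 ?lee_fin ?sqr_ge0 ?sqsum_ge0
  ?addr_ge0// lte_mul_pinfty ?lee_fin ?sqr_ge0.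
Qed.

HB.instance Definition _ := GRing.isSubmodClosed.Build C (T -> C) sqsummable
  sqsummable_submod.
HB.instance Definition _ := [SubChoice_isSubLmodule of L2 by <:].

End L2.

Section L2norm.
Context (R : realType) (T : choiceType).
Local Notation C := R[i].
Local Notation L2 := (L2 R T).
Implicit Types f g : L2.

Definition l2norm (f : L2) : R := Num.sqrt (fine (sqsum f)).

Lemma sqsum_fin (f : L2) : sqsum f \is a fin_num.
Proof. by rewrite ge0_fin_numE ?sqsum_ge0//; apply/asboolP/(L2P f). Qed.

Lemma l2norm_ge0 f : 0 <= l2norm f.
Proof. exact: sqrtr_ge0. Qed.

Lemma l2norm_sqr (f : L2) : ((l2norm f ^+ 2)%:E = sqsum f)%E.
Proof. by rewrite sqr_sqrtr ?fine_ge0 ?sqsum_ge0// fineK// sqsum_fin. Qed.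

Lemma l2norm0_eq0 f : l2norm f = 0 -> f = 0.
Proof.
move=> f0; apply/val_inj/funext => x /=.
have : ((normc (f x) ^+ 2)%:E <= sqsum f)%E.
  have := @esum_ge R T [set: T] (fun y => (normc (f y) ^+ 2)%:E)
    (normc (f x) ^+ 2)%:E; apply.
  exists [set x]; first by split => //; exact: finite_set1.
  by rewrite fsbig_set1.
rewrite -l2norm_sqr f0 expr0n lee_fin => le0.
apply/ComplexField.Normc.eq0_normc/eqP.
by rewrite -sqrf_eq0 eq_le le0 sqr_ge0.
Qed.

Lemma l2normZ (k : C) f : l2norm (k *: f) = normc k * l2norm f.
Proof.
rewrite /l2norm /= sqsumZ fineM ?sqsum_fin//= sqrtrM ?sqr_ge0//.
by rewrite sqrtr_sqr ger0_norm ?normc_ge0.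
Qed.

Lemma l2norm_triangle f g : l2norm (f + g) <= l2norm f + l2norm g.
Proof.
have [f0|fn0] := eqVneq (l2norm f) 0.
  by rewrite f0 (l2norm0_eq0 f0) !add0r.
have [g0|gn0] := eqVneq (l2norm g) 0.
  by rewrite g0 (l2norm0_eq0 g0) !addr0.
have fp : 0 < l2norm f by rewrite lt_def fn0 l2norm_ge0.
have gp : 0 < l2norm g by rewrite lt_def gn0 l2norm_ge0.
rewrite -ler_sqr ?nnegrE ?addr_ge0 ?l2norm_ge0// -lee_fin l2norm_sqr.
apply: le_trans (sqsumD _ _ (divr_gt0 gp fp)) _.
rewrite -!l2norm_sqr -!EFinM -EFinD lee_fin le_eqVlt; apply/orP; left.
by apply/eqP; field; rewrite fn0 gn0.
Qed.

Definition l2normC (f : L2) : C := (l2norm f)%:C.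

Lemma l2normC_triangle f g : l2normC (f + g) <= l2normC f + l2normC g.
Proof. by rewrite -rmorphD lecR l2norm_triangle. Qed.

Lemma l2normCZ (k : C) f : l2normC (k *: f) = `|k| * l2normC f.
Proof. by rewrite /l2normC l2normZ rmorphM. Qed.

Lemma l2normC0_eq0 f : l2normC f = 0 -> f = 0.
Proof. by move=> /(congr1 (@complex.Re R)) /l2norm0_eq0. Qed.

HB.instance Definition _ :=
  Lmodule_isNormed.Build C L2 l2normC_triangle l2normCZ l2normC0_eq0.

Definition l2inner (f g : L2) : C :=
  lim (summability.partial_sum (fun x => f x * conjc (g x) : C^o) @ summability.totally).

End L2norm.


Section Operators.
Context (R : realType).
Local Notation C := R[i].

Definition dual_norm (E : normedModType C) (phi : {linear E -> C^o}) : \bar R :=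
  ereal_sup [set (normc (phi x))%:E | x in [set x : E | `|x| <= 1]].

Definition nuclear (E F : normedModType C) (T : {linear E -> F}) : Prop :=
  continuous T /\
  exists (phi : nat -> {linear E -> C^o}) (y : nat -> F),
    [/\ forall n, continuous (phi n),
        (\sum_(0 <= n <oo) dual_norm (phi n) * (complex.Re `|y n|)%:E < +oo)%E
      & forall x, series (fun n => phi n x *: y n) @ \oo --> T x].

Definition adjoint_of (I : choiceType) (T T' : {linear L2 R I -> L2 R I}) : Prop :=
  forall f g : L2 R I, l2inner (T f) g = l2inner f (T' g).

End Operators.


Section FourierHelgason.
Context (R : realType) (q : nat).
Local Notation C := R[i].
Local Notation leb := (@lebesgue_measure R).

(* [qpow z] is [q ^ z] for a complex exponent [z] *)
Definition qpow (z : C) : C :=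
  (q%:R `^ complex.Re z)%:C *
  (cos (complex.Im z * ln q%:R) +i* sin (complex.Im z * ln q%:R)).

Definition tau : R := pi / ln q%:R.

Definition cfun (z : C) : C :=
  (q%:R `^ 2^-1 / (q.+1)%:R)%:C *
  ((qpow ((2^-1)%:C + (0 +i* 1) * z) - qpow (- (2^-1)%:C - (0 +i* 1) * z)) /
   (qpow ((0 +i* 1) * z) - qpow (- ((0 +i* 1) * z)))).

(* The normalisation is the one for which the inversion formula
   [f(x) = \int \int q^((1/2 - is) h_w(x)) Hf(w, s) dnu(w) dmu(s)] holds with [s]
   ranging over the half period [0, tau]: one has
   [\int_0^tau |c(s)|^-2 ds = 2 pi (q + 1) / (q ln q)]. The constant
   [q ln q / (4 pi (q + 1))] is the one for the full period [-tau, tau]. *)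
Definition plancherel_cst : R := q%:R * ln q%:R / (2 * pi * (q.+1)%:R).

(* dmu(s) = plancherel_density s ds on [0, tau]; at the endpoints, where [c] has
   a pole, the convention [x / 0 = 0] gives the correct value 0 *)
Definition plancherel_density (s : R) : R :=
  plancherel_cst * (normc (cfun s%:C)) ^- 2.

Context (X : homTree q) (o : X).
Implicit Types (w : Omega o) (x y : X) (s : R).

Definition height w x : R :=
  lim ((m%:R - (dist x (w m))%:R : R) @[m --> \oo]).

Definition is_boundary_measure (nu : probability (Omega o) R) : Prop :=
  forall x, x != o ->
    nu (cylinder o x) = (q%:R / ((q.+1)%:R * q%:R ^+ dist o x))%:E.

Definition pwave w s x : C := qpow ((2^-1 +i* s) * (height w x)%:C).
Definition mwave w s x : C := qpow ((2^-1 -i* s) * (height w x)%:C).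

(* meaningful for finitely supported [f] *)
Definition FHtransform (f : X -> C) w s : C :=
  \sum_(y \in [set: X]) f y * pwave w s y.

Definition dom : set (Omega o * R) := [set: Omega o] `*` `[0, tau].

(* [X] is countable and discrete, so measurability on [X * Omega * [0, tau]]
   is measurability in the last two variables *)
Definition measurable_symbol (sigma : X -> Omega o -> R -> C) : Prop :=
  forall x,
    measurable_fun dom (fun p => complex.Re (sigma x p.1 p.2)) /\
    measurable_fun dom (fun p => complex.Im (sigma x p.1 p.2)).

Context (nu : probability (Omega o) R).
Local Notation nuleb := (nu \x leb)%E.

(* absolute convergence and value of [\int_Omega \int_0^tau F dnu dmu] *)
Definition pl_integrable (F : Omega o -> R -> C) : Prop :=
  nuleb.-integrable dom
    (fun p => (complex.Re (F p.1 p.2) * plancherel_density p.2)%:E) /\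
  nuleb.-integrable dom
    (fun p => (complex.Im (F p.1 p.2) * plancherel_density p.2)%:E).

Definition pl_integral (F : Omega o -> R -> C) : C :=
  (\int[nuleb]_(p in dom) (complex.Re (F p.1 p.2) * plancherel_density p.2))
  +i*
  (\int[nuleb]_(p in dom) (complex.Im (F p.1 p.2) * plancherel_density p.2)).

Definition pdo_integrand (sigma : X -> Omega o -> R -> C) (f : X -> C) x w s : C :=
  mwave w s x * sigma x w s * FHtransform f w s.

(* [T] is the operator on [L^2(X)] given on finitely supported functions by
   the convergent integral defining [T_sigma] *)
Definition is_pdo (sigma : X -> Omega o -> R -> C)
    (T : {linear L2 R X -> L2 R X}) : Prop :=
  forall f : L2 R X, finite_set [set x | f x != 0] -> forall x,
    pl_integrable (pdo_integrand sigma f x) /\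
    T f x = pl_integral (pdo_integrand sigma f x).

(* [S = u] in L^2(Omega x [0, tau], nu x mu), [S] being the sum of the family
   of functions [u x], [x \in X], i.e. the limit of its finite partial sums;
   as for the Fourier-Helgason transform of an element of [L^2(X)], such a family
   need not be summable at any given point of [Omega x [0, tau]] *)
Definition L2_has_sum (u : X -> Omega o -> R -> C) (S : Omega o -> R -> C) : Prop :=
  (\int[nuleb]_(p in dom)
     (normc (S p.1 p.2 - summability.partial_sum (fun x => u x p.1 p.2) A) ^+ 2
      * plancherel_density p.2)%:E)%E @[A --> summability.totally] --> 0%E.

End FourierHelgason.

Arguments plancherel_density {R} q.
Arguments tau {R} q.
Arguments qpow {R} q.
Arguments height {R q X o}.

(* Main.v *)
(* Let m_x(w, s) = q^((1/2 - is) h_w(x)). The Fourier-Helgason transforms of the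
   point masses, i.e. the conjugates of the m_x, are an orthonormal family of
   L^2(nu x mu), and they are total even against integrable functions. If
   G = m_y sigma'(y, ., .), then the coefficient of G along m_x is
   (T' d_x)(y) = conj ((T d_y)(x)); these numbers are the integrals of the formula,
   and they are square summable because T d_y is in L^2. Hence the family of the
   (T' d_x)(y) m_x converges in L^2, its sum has the same coefficients as the
   integrable function G, thus equals G, and division by m_y yields sigma'(y).

   Orthonormality: the integral over the boundary of conj(m_x) m_y is the spherical
   function of d(x, y), by induction on the distance, since m_y is a multiple of the
   wave of the parent of y plus a multiple of the indicator of the cylinder of y; the
   remaining integrals in s satisfy a recurrence of order 2, of which they are a
   bounded solution. Totality: the waves are eigenfunctions of the adjacency operator
   with eigenvalue 2 sqrt(q) cos(s ln q), so an integrable function orthogonal to all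
   waves stays so after multiplication by a polynomial in the cosine; by the theorem
   of Weierstrass it is orthogonal to all waves for almost every fixed s, hence to the
   indicators of all cylinders. *)
Require Import Defs.
From mathcomp Require Import all_boot all_order all_algebra finmap.
From mathcomp Require Import all_classical all_reals all_analysis.
From mathcomp Require Import measurable_realfun complex.
From mathcomp Require Import ring lra zify.
From mathcomp Require summability.

Set Implicit Arguments.
Unset Strict Implicit.
Unset Printing Implicit Defensive.
Import Order.TTheory GRing.Theory Num.Theory.
Import numFieldNormedType.Exports.

Local Open Scope classical_set_scope.
Local Open Scope ring_scope.
Local Open Scope complex_scope.

#[local] Existing Instance summability.totally_filter.

(** * Geometry of the homogeneous tree *)

Section TreeGeometry.
Context (q : nat) (X : homTree q).
Implicit Types (x y v a p o : X).

(** The convergence of the integrals that define [T'] on point masses makes G integrable, not square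
    integrable, so completeness of the waves in L^2 would not identify G; hence totality against
    integrable functions. The sum of the family is built along finite sets A_k outside of which the
    squared coefficients add up to at most 4^-k. As the weight has finite mass, the increments are
    of order 2^-k in L^1, which yields a limit both in L^1 and almost everywhere. Totality compares
    the L^1 limit with G; Fatou's lemma then brings the estimate back to L^2 for every finite set
    containing A_k, which is convergence along all finite sets. The almost everywhere limit serves
    once more: at a point where the family happens to be summable, its sum must be this limit. The
    closed form of the spherical functions has the denominator sin(s ln q), which vanishes at both
    ends of [0, tau]. They are therefore handled after multiplication by this sine; the density
    contains its square, so one factor can be spent. *)

Lemma closer_neighbour x v : x != v ->
  exists a, adj x a /\ dist x v = (dist a v).+1.
Proof.
move=> xv; have [[|a r] [/= pr lr sr]] := distP x v.
  by move: xv; rewrite lr eqxx.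
case/andP: pr => xa pr; exists a; split => //.
apply/eqP; rewrite eqn_leq; apply/andP; split.
  by rewrite (leq_trans (dist_triangle x a v))// -add1n leq_add2r dist_adj.
by rewrite -sr ltnS; apply: dist_le; exists r.
Qed.

Lemma adj_dist x y v : adj x y ->
  dist y v = (dist x v).+1 \/ dist x v = (dist y v).+1.
Proof.
move=> xy; have [yx|xy'] := leqP (dist y v) (dist x v); last first.
  left; apply/eqP; rewrite eqn_leq xy' andbT.
  by rewrite (leq_trans (dist_triangle y x v))// -add1n leq_add2r dist_adj// adj_sym.
right; have [xv|xv] := eqVneq x v.
  move: yx xy; rewrite xv dist0 leqn0 => /eqP/dist_eq0 ->.
  by rewrite adj_irr.
have [a [xa da]] := closer_neighbour xv.
by rewrite (uniq_parent xy xa yx)// da.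
Qed.

(* the alternative is whether the geodesic from [o] to [v] passes through [x] *)
Lemma dist_through_or_parent o x v :
  dist v o = (dist x o + dist x v)%N \/
  exists p, [/\ adj x p, dist x o = (dist p o).+1 & dist x v = (dist p v).+1].
Proof.
have [k kE] : exists k, dist x v = k by exists (dist x v).
elim: k x kE => [|k ih] x dx.
  by left; rewrite (dist_eq0 dx) dist0 addn0.
have [a [xa da]] : exists a, adj x a /\ dist x v = (dist a v).+1.
  by apply: closer_neighbour; apply/eqP => xv; move: dx; rewrite xv dist0.
have ka : dist a v = k by move: da; rewrite dx => -[].
case: (adj_dist o xa) => [ao|xo]; last by right; exists a.
left; case: (ih a ka) => [->|[p [ap po pv]]]; first by rewrite ao da addSnnS.
(* Both [p] and [x] are neighbours of [a] closer to [o], hence equal; but then [da] and [pv]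
   contradict each other. *)
suff px : p = x by move: da; rewrite -px pv; lia.
apply: (@uniq_parent _ _ o a) => //; first by rewrite adj_sym.
- by rewrite po.
- by rewrite ao.
Qed.

(** Induction on the distance to [v]: the neighbours of [v] towards [x] and towards [x'] are both
    closer to [o], so [uniq_parent] identifies them. *)
Lemma geodesic_uniq o v x x' : dist x o = dist x' o -> dist x v = dist x' v ->
  dist v o = (dist x o + dist x v)%N -> x = x'.
Proof.
have [k kE] : exists k, dist x v = k by exists (dist x v).
elim: k v kE => [|k ih] v dx oo vv le.
  by rewrite (dist_eq0 dx); move: dx; rewrite vv => /dist_eq0 ->.
have vne z : dist z v = k.+1 -> v != z.
  by move=> zv; apply/eqP => vz; move: zv; rewrite vz dist0.
have [b [vb db]] := closer_neighbour (vne x dx).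
have [b' [vb' db']] := closer_neighbour (vne x' (etrans (esym vv) dx)).
rewrite dist_sym dx in db; rewrite dist_sym -vv dx in db'.
have h1 := dist_triangle b x o; have h2 := dist_triangle b' x' o.
have h3 := dist_triangle v b o; have h4 := dist_adj vb.
have bb' : b = b'.
  apply: (@uniq_parent _ _ o v) => //; clear ih; lia.
subst b'; apply: (ih b) => //.
- by rewrite dist_sym; clear ih; lia.
- by rewrite (dist_sym x) (dist_sym x'); clear ih; lia.
- by rewrite (dist_sym x b); clear ih; lia.
Qed.

(** Two distinct vertices cannot each lie on the geodesic from [o] to the other. So one of them can
    be replaced by its parent at the gain of one step, which drives the induction for the spherical
    functions. *)
Lemma dist_parent_dichotomy o x y : x != y ->
  (exists p, [/\ adj y p, dist y o = (dist p o).+1 & dist y x = (dist p x).+1]) \/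
  (exists p, [/\ adj x p, dist x o = (dist p o).+1 & dist x y = (dist p y).+1]).
Proof.
move=> xy; case: (dist_through_or_parent o y x) => [h1|]; last by left.
case: (dist_through_or_parent o x y) => [h2|]; last by right.
suff : dist x y = 0%N by move/dist_eq0 => e; move: xy; rewrite e eqxx.
by rewrite (dist_sym y x) in h1; lia.
Qed.

Lemma finite_ball o n : finite_set [set x | (dist x o <= n)%N].
Proof.
elim: n => [|n ih].
  apply: (@sub_finite_set _ _ [set o]); last exact: finite_set1.
  by move=> x /=; rewrite leqn0 => /eqP /dist_eq0.
apply: (@sub_finite_set _ _ ([set x | (dist x o <= n)%N] `|`
    \bigcup_(x in [set x | (dist x o <= n)%N]) [set y | adj x y])).
  move=> x /= xn; have [->|xo] := eqVneq x o; first by left; rewrite /= dist0.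
  have [a [xa da]] := closer_neighbour xo.
  right; exists a => /=; last by rewrite adj_sym.
  by rewrite -ltnS -da.
rewrite finite_setU; split => //.
apply: bigcup_finite => // x _.
have [s [_ _ sP]] := adj_degree x.
apply: (@sub_finite_set _ _ [set` s]); last exact: finite_seq.
by move=> y /=; rewrite sP.
Qed.

End TreeGeometry.

(** * Rays and the nested family of cylinders *)

Section Rays.
Context (q : nat) (X : homTree q) (o : X).
Implicit Types (x y v a p : X) (w : ray o).

Lemma ray_dist0 w m : dist (w m) o = m.
Proof. by rewrite dist_sym -{1}(ray0 w) ray_geodesic// subn0. Qed.

Lemma nonincreasing_nat_cst (u : nat -> nat) :
  (forall n, u n.+1 <= u n)%N -> exists N, forall n, (N <= n)%N -> u n = u N.
Proof.
move=> ud.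
have [k kE] : exists k, (u 0 <= k)%N by exists (u 0%N).
elim: k u ud kE => [|k ih] u ud.
  rewrite leqn0 => /eqP u0; exists 0%N => n _; rewrite u0.
  by elim: n => [//|n un]; move: (ud n); rewrite un leqn0 => /eqP.
move=> u0; have [all|] := pselect (forall n, u n = u 0%N).
  by exists 0%N => n _; rewrite (all n).
move=> /existsNP[n /eqP un].
have mono m : (u m <= u 0)%N.
  by elim: m => [//|m]; apply: leq_trans.
have [|/=|N NP] := ih (fun m => u (n + m)%N).
- by move=> m; rewrite addnS; exact: ud.
- by rewrite addn0; move: (mono n) un; clear ih; lia.
exists (n + N)%N => m mN.
by rewrite -(NP (m - n)%N) ?subnKC//; lia.
Qed.

Lemma ray_passes w x m : dist (w m) o = (dist x o + dist x (w m))%N ->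
  cylinder o x w.
Proof.
move=> h; exists (dist x o); have xm : (dist x o <= m)%N.
  by move: h; rewrite ray_dist0 => ->; rewrite leq_addr.
apply/esym/(@geodesic_uniq _ _ o (w m)) => //.
- by rewrite ray_dist0.
- by rewrite ray_geodesic//; move: h; rewrite ray_dist0; clear; lia.
Qed.

Lemma cylinder_dist w x : cylinder o x w -> w (dist x o) = x.
Proof. by move=> [n wn]; rewrite -{1}wn ray_dist0. Qed.

Lemma cylinder_root w : cylinder o o w.
Proof. by exists 0%N; exact: ray0. Qed.

Lemma cylinder_dist_ray w x m : cylinder o x w -> (dist x o <= m)%N ->
  dist x (w m) = (m - dist x o)%N.
Proof. by move=> /cylinder_dist wx xm; rewrite -{1}wx ray_geodesic. Qed.

Lemma cylinder_parent w x p : adj x p -> dist x o = (dist p o).+1 ->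
  cylinder o x w -> cylinder o p w.
Proof.
move=> xp xo /cylinder_dist wx; apply: (@ray_passes w p (dist x o)).
have pw : dist p (w (dist x o)) = 1%N.
  apply/eqP; rewrite eqn_leq wx dist_adj; last by rewrite adj_sym.
  by rewrite lt0n; apply/eqP => /dist_eq0 px; move: xo; rewrite px; lia.
by rewrite pw ray_dist0 xo addn1.
Qed.

Lemma cylinder_sub x y w : cylinder o x w -> cylinder o y w ->
  (dist x o <= dist y o)%N -> cylinder o y `<=` cylinder o x.
Proof.
move=> wx wy xy w' wy'; apply: (@ray_passes w' x (dist y o)).
rewrite (cylinder_dist wy') -{2}(cylinder_dist wy) cylinder_dist_ray//.
by rewrite subnKC.
Qed.

(** This makes the cylinders, together with the empty set, a pi-system. *)
Lemma cylinder_setI x y : cylinder o x `&` cylinder o y = set0 \/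
  cylinder o x `&` cylinder o y = cylinder o x \/
  cylinder o x `&` cylinder o y = cylinder o y.
Proof.
have [->|/set0P[w [wx wy]]] := eqVneq (cylinder o x `&` cylinder o y) set0.
  by left.
right; have [xy|/ltnW yx] := leqP (dist x o) (dist y o).
  by right; apply/setIidPr; exact: cylinder_sub wx wy xy.
by left; apply/setIidPl; exact: cylinder_sub wy wx yx.
Qed.

(* the hypotheses on [p] say that [y] separates [x] from the rays through [y] *)
Lemma cylinder_dist_add w x y p m : adj y p -> dist y o = (dist p o).+1 ->
  dist y x = (dist p x).+1 -> cylinder o y w -> (dist y o <= m)%N ->
  dist x (w m) = (dist x y + dist y (w m))%N.
Proof.
(* The dichotomy is used with [x] as the root: otherwise the geodesic from [y] to [w m] would start
   towards [p], a vertex that the ray has left behind. *)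
move=> yp yo yx wy ym; case: (dist_through_or_parent x y (w m)).
  by rewrite dist_sym (dist_sym y x).
move=> [p' [yp' yx' pw]].
have pp' : p' = p by apply: (@uniq_parent _ _ x y) => //; lia.
have wp := cylinder_parent yp yo wy.
have pm : (dist p o <= m)%N by lia.
move: pw; rewrite pp' (cylinder_dist_ray wy ym) (cylinder_dist_ray wp pm); lia.
Qed.

End Rays.

(** * The height function *)

Section Height.
Context (R : realType) (q : nat) (X : homTree q) (o : X).
Implicit Types (x y v a p : X) (w : Omega o).
Local Notation h := (@height R q X o).

(** The deficit [dist x o + dist x (w m) - m] in the triangle inequality is a natural number that
    never increases along the ray, so it is eventually constant. *)
Lemma height_eventually w x :
  exists N, forall m, (N <= m)%N -> h w x = m%:R - (dist x (w m))%:R.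
Proof.
pose u m := (dist x o + dist x (w m) - m)%N.
have mu m : (m <= dist x o + dist x (w m))%N.
  by rewrite -{1}(ray_dist0 w m) -(dist_sym o) (dist_sym x o) dist_triangle.
have ud m : (u m.+1 <= u m)%N.
  rewrite /u; have := dist_triangle x (w m) (w m.+1).
  by rewrite (ray_geodesic w (leqnSn m)); lia.
have [N NP] := nonincreasing_nat_cst ud.
have E m : (N <= m)%N -> m%:R - (dist x (w m))%:R = (dist x o)%:R - (u N)%:R :> R.
  move=> /NP <-; rewrite /u natrB// natrD; ring.
exists N => m /E ->; apply/cvg_lim => //.
by apply: cvg_near_cst; exists N => // k /= /E.
Qed.

Lemma height_root w : h w o = 0.
Proof.
have [N /(_ _ (leqnn _)) ->] := height_eventually w o.
by rewrite dist_sym ray_dist0 subrr.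
Qed.

Lemma height_cylinder w x : cylinder o x w -> h w x = (dist x o)%:R.
Proof.
move=> wx; have [N NP] := height_eventually w x.
rewrite (NP (maxn N (dist x o))) ?leq_maxl// cylinder_dist_ray ?leq_maxr//.
by rewrite natrB ?leq_maxr//; ring.
Qed.

(** When the ray misses [x], its far vertices are reached from [x] through a neighbour closer to
    [o], and [p] is the only one. *)
Lemma height_notin_cylinder w x p : adj x p -> dist x o = (dist p o).+1 ->
  ~ cylinder o x w -> h w x = h w p - 1.
Proof.
move=> xp xo wx; have [N NP] := height_eventually w x.
have [M MP] := height_eventually w p.
rewrite (NP (maxn N M)) ?leq_maxl// (MP (maxn N M)) ?leq_maxr//.
case: (dist_through_or_parent o x (w (maxn N M))) => [/ray_passes//|].
move=> [p' [xp' xo' pw]].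
have <- : p' = p by apply: (@uniq_parent _ _ o x) => //; lia.
by rewrite pw -[X in _ - X]natr1; ring.
Qed.

Lemma height_separated w x y p : adj y p -> dist y o = (dist p o).+1 ->
  dist y x = (dist p x).+1 -> cylinder o y w ->
  h w x = (dist y o)%:R - (dist x y)%:R.
Proof.
move=> yp yo yx wy; have [N NP] := height_eventually w x.
rewrite (NP (maxn N (dist y o))) ?leq_maxl//.
rewrite (cylinder_dist_add yp yo yx wy) ?leq_maxr//.
by rewrite cylinder_dist_ray ?leq_maxr// natrD natrB ?leq_maxr//; ring.
Qed.

(** The neighbour [a] is the one towards a far vertex of the ray; [uniq_parent], with that vertex as
    the root, shows that no other neighbour comes closer to it. *)
Lemma height_neighbours w x (s : seq X) : uniq s ->
  (forall y, adj x y = (y \in s)) ->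
  exists2 a, a \in s & h w a = h w x + 1 /\
    forall y, y \in s -> y != a -> h w y = h w x - 1.
Proof.
move=> us sP.
pose N0 y := sval (cid (height_eventually w y)).
have N0P y m : (N0 y <= m)%N -> h w y = m%:R - (dist y (w m))%:R.
  by rewrite /N0; case: cid => n /= + /[dup]; move=> P _; exact: P.
(* Far enough for the heights of [x] and all its neighbours to be read off at [w m]; the summand
   [(dist x o).+1] keeps [w m] different from [x]. *)
pose m := ((dist x o).+1 + N0 x + \sum_(y <- s) N0 y)%N.
have mx : (N0 x <= m)%N by rewrite /m; lia.
have ms y : y \in s -> (N0 y <= m)%N.
  by move=> ys; rewrite /m (big_rem y ys)/=; lia.
have xw : x != w m.
  by apply/eqP => e; have := ray_dist0 w m; rewrite -e /m; lia.
have [a [xa da]] := closer_neighbour xw.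
have sa : a \in s by rewrite -sP.
exists a => //; split.
  by rewrite (N0P _ _ (ms _ sa)) (N0P _ _ mx) da -[X in _ = _ - X + _]natr1; ring.
move=> y ys ya; rewrite (N0P _ _ (ms _ ys)) (N0P _ _ mx).
have xy : adj x y by rewrite sP.
case: (adj_dist (w m) xy) => [->|dy]; first by rewrite -natr1; ring.
suff ya' : y = a by rewrite ya' eqxx in ya.
by apply: (@uniq_parent _ _ (w m) x) => //; lia.
Qed.

Lemma height_bounded w x : `|h w x| <= (dist x o)%:R.
Proof.
have [N NP] := height_eventually w x; rewrite (NP _ (leqnn N)).
have h1 := dist_triangle (w N) x o; have h2 := dist_triangle x o (w N).
rewrite ray_dist0 (dist_sym (w N) x) in h1.
rewrite (dist_sym o) ray_dist0 in h2.
rewrite -(ler_nat R) natrD in h1; rewrite -(ler_nat R) natrD in h2.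
by rewrite ler_norml; apply/andP; split; lra.
Qed.

End Height.

(** * Complex-valued integrals *)

Notation cRe := (@complex.Re _).
Notation cIm := (@complex.Im _).

Section ComplexIntegral.
Context d (T : measurableType d) (R : realType).
Local Notation C := R[i].
Implicit Types (f g : T -> C).

Lemma cReM (a b : C) : cRe (a * b) = cRe a * cRe b - cIm a * cIm b.
Proof. by case: a b => [? ?] [? ?]. Qed.

Lemma cImM (a b : C) : cIm (a * b) = cRe a * cIm b + cIm a * cRe b.
Proof. by case: a b => [? ?] [? ?]. Qed.

Lemma cReD (a b : C) : cRe (a + b) = cRe a + cRe b.
Proof. by case: a b => [? ?] [? ?]. Qed.

Lemma cImD (a b : C) : cIm (a + b) = cIm a + cIm b.
Proof. by case: a b => [? ?] [? ?]. Qed.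

Lemma cReB (a b : C) : cRe (a - b) = cRe a - cRe b.
Proof. by case: a b => [? ?] [? ?]. Qed.

Lemma cImB (a b : C) : cIm (a - b) = cIm a - cIm b.
Proof. by case: a b => [? ?] [? ?]. Qed.

Lemma cRe_conj (a : C) : cRe (conjc a) = cRe a. Proof. by case: a. Qed.

Lemma cIm_conj (a : C) : cIm (conjc a) = - cIm a. Proof. by case: a. Qed.

Lemma conjcM (a b : C) : conjc (a * b) = conjc a * conjc b.
Proof. exact: rmorphM. Qed.

Lemma complex_ext (a b : C) : cRe a = cRe b -> cIm a = cIm b -> a = b.
Proof. by case: a b => [? ?] [? ?] /= -> ->. Qed.

Lemma normc_sqr (a : C) : normc a ^+ 2 = cRe a ^+ 2 + cIm a ^+ 2.
Proof. by case: a => a b /=; rewrite sqr_sqrtr// addr_ge0 ?sqr_ge0. Qed.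

Lemma cRe_le_normc (a : C) : `|cRe a| <= normc a.
Proof.
rewrite -ler_sqr ?nnegrE ?normc_ge0// normc_sqr real_normK ?num_real//.
by rewrite lerDl sqr_ge0.
Qed.

Lemma cIm_le_normc (a : C) : `|cIm a| <= normc a.
Proof.
rewrite -ler_sqr ?nnegrE ?normc_ge0// normc_sqr real_normK ?num_real//.
by rewrite lerDr sqr_ge0.
Qed.

Lemma normc_le_ReIm (a : C) : normc a <= `|cRe a| + `|cIm a|.
Proof.
rewrite -ler_sqr ?nnegrE ?normc_ge0 ?addr_ge0// normc_sqr sqrrD.
rewrite !real_normK ?num_real//.
by rewrite -addrA [X in _ <= _ + X]addrC addrA lerDl mulrn_wge0// mulr_ge0.
Qed.

Lemma normc_real (r : R) : normc r%:C = `|r|.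
Proof. by rewrite /= expr0n addr0 sqrtr_sqr. Qed.

Lemma conjc_mul_normc (a : C) : a * conjc a = (normc a ^+ 2)%:C.
Proof.
by rewrite normc_sqr; case: a => a b; apply: complex_ext; rewrite /=; ring.
Qed.

Definition cmeas f :=
  measurable_fun setT (fun t => cRe (f t)) /\
  measurable_fun setT (fun t => cIm (f t)).

Lemma cmeas_cst k : cmeas (fun=> k).
Proof. by split. Qed.

Lemma cmeas_real (r : T -> R) : measurable_fun setT r -> cmeas (fun t => (r t)%:C).
Proof. by move=> mr; split. Qed.

Lemma cmeasD f g : cmeas f -> cmeas g -> cmeas (fun t => f t + g t).
Proof.
move=> [f1 f2] [g1 g2]; split.
  by under eq_fun do rewrite cReD; exact: measurable_funD.
by under eq_fun do rewrite cImD; exact: measurable_funD.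
Qed.

Lemma cmeasM f g : cmeas f -> cmeas g -> cmeas (fun t => f t * g t).
Proof.
move=> [f1 f2] [g1 g2]; split.
  under eq_fun do rewrite cReM.
  by apply: measurable_funB; exact: measurable_funM.
under eq_fun do rewrite cImM.
by apply: measurable_funD; exact: measurable_funM.
Qed.

Lemma cmeasB f g : cmeas f -> cmeas g -> cmeas (fun t => f t - g t).
Proof.
move=> mf mg; have -> : (fun t => f t - g t) = (fun t => f t + -1 * g t).
  by apply/funext => t; rewrite mulN1r.
by apply: cmeasD => //; apply: cmeasM => //; exact: cmeas_cst.
Qed.

Lemma cmeas_sum (I : Type) (s : seq I) (F : I -> T -> C) :
  (forall i, cmeas (F i)) -> cmeas (fun t => \sum_(i <- s) F i t).
Proof.
move=> mF; elim: s => [|i s ih].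
  by under eq_fun do rewrite big_nil; exact: cmeas_cst.
by under eq_fun do rewrite big_cons; exact: cmeasD.
Qed.

Lemma measurable_normc_sqr f : cmeas f ->
  measurable_fun setT (fun t => normc (f t) ^+ 2).
Proof.
move=> [f1 f2]; under eq_fun do rewrite normc_sqr.
by apply: measurable_funD; exact: measurable_funX.
Qed.

Lemma measurable_normc f : cmeas f -> measurable_fun setT (fun t => normc (f t)).
Proof.
move=> mf; have -> : (fun t => normc (f t)) = Num.sqrt \o (fun t => normc (f t) ^+ 2).
  by apply/funext => t /=; rewrite sqrtr_sqr ger0_norm// normc_ge0.
apply: measurableT_comp; last exact: measurable_normc_sqr.
by apply: continuous_measurable_fun; exact: sqrt_continuous.
Qed.

Context (mu : {measure set T -> \bar R}).
Local Notation int_ h := (mu.-integrable setT (EFin \o h)).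

Definition cintble f :=
  int_ (fun t => cRe (f t)) /\ int_ (fun t => cIm (f t)).

Definition cint f : C := (\int[mu]_t cRe (f t)) +i* (\int[mu]_t cIm (f t)).

Lemma cRe_cint f : cRe (cint f) = \int[mu]_t cRe (f t). Proof. by []. Qed.

Lemma cIm_cint f : cIm (cint f) = \int[mu]_t cIm (f t). Proof. by []. Qed.

Lemma integrable_le (u v : T -> R) : measurable_fun setT u ->
  (forall t, `|u t| <= v t) -> int_ v -> int_ u.
Proof.
move=> mu' uv; apply: le_integrable => //; first exact/measurable_EFinP.
by move=> t _ /=; rewrite lee_fin (le_trans (uv t))// ler_norm.
Qed.

Lemma integrable_mulr (u : T -> R) k : int_ u -> int_ (fun t => u t * k).
Proof.
move=> iu; have /(@integrableZl _ _ _ mu setT measurableT k) := iu.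
by apply: eq_integrable => // t _ /=; rewrite -EFinM mulrC.
Qed.

Lemma integrable_add (u v : T -> R) : int_ u -> int_ v -> int_ (fun t => u t + v t).
Proof. by move=> iu iv; exact: (integrableD measurableT iu iv). Qed.

Lemma integrable_indic_lty (A : set T) : measurable A -> (mu A < +oo)%E ->
  int_ (\1_A : T -> R).
Proof.
move=> mA Afin; apply/integrableP; split.
  by apply/measurable_EFinP; exact: measurable_indic.
rewrite (eq_integral (fun t => (\1_A t)%:E)); last first.
  by move=> t _; rewrite gee0_abs//= lee_fin indicE ler0n.
by rewrite integral_indic// setIT.
Qed.

Lemma cintble_cmeas f : cintble f -> cmeas f.
Proof.
by move=> [f1 f2]; split; apply/measurable_EFinP;
  [exact: (measurable_int mu f1)|exact: (measurable_int mu f2)].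
Qed.

Lemma cintbleP f : cmeas f -> cintble f <-> int_ (fun t => normc (f t)).
Proof.
move=> mf; split=> [[f1 f2]|fi]; last first.
  split; apply: integrable_le fi; try by case: mf.
  - by move=> t; exact: cRe_le_normc.
  - by move=> t; exact: cIm_le_normc.
have := integrable_add (integrable_norm f1) (integrable_norm f2).
apply: integrable_le; first exact: measurable_normc.
by move=> t; rewrite ger0_norm ?normc_ge0// normc_le_ReIm.
Qed.

Lemma cintble_le f (v : T -> R) : cmeas f -> (forall t, normc (f t) <= v t) ->
  int_ v -> cintble f.
Proof.
move=> mf fv vi; apply/cintbleP => //; apply: integrable_le vi.
  exact: measurable_normc.
by move=> t; rewrite ger0_norm ?normc_ge0.
Qed.

Lemma cintbleM_bounded f g (B : R) : cintble f -> cmeas g ->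
  (forall t, normc (g t) <= B) -> cintble (fun t => f t * g t).
Proof.
move=> fi mg gB; have mf := cintble_cmeas fi.
apply: (@cintble_le _ (fun t => normc (f t) * B)); first exact: cmeasM.
  by move=> t; rewrite ComplexField.Normc.normcM ler_wpM2l ?normc_ge0.
by apply: integrable_mulr; exact/cintbleP.
Qed.

Lemma cintbleD f g : cintble f -> cintble g -> cintble (fun t => f t + g t).
Proof.
move=> [f1 f2] [g1 g2]; split.
  by under [X in EFin \o X]eq_fun do rewrite cReD; exact: integrable_add.
by under [X in EFin \o X]eq_fun do rewrite cImD; exact: integrable_add.
Qed.

Lemma cintbleZ k f : cintble f -> cintble (fun t => k * f t).
Proof.
move=> fi; under eq_fun do rewrite mulrC.
by apply: cintbleM_bounded fi (cmeas_cst k) _ => t; exact: lexx.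
Qed.

Lemma cintbleB f g : cintble f -> cintble g -> cintble (fun t => f t - g t).
Proof.
move=> fi gi; under eq_fun do rewrite -mulN1r.
by apply: cintbleD fi _; exact: cintbleZ.
Qed.

Lemma cintble_sum (I : Type) (s : seq I) (F : I -> T -> C) :
  (forall i, cintble (F i)) -> cintble (fun t => \sum_(i <- s) F i t).
Proof.
move=> iF; elim: s => [|i s ih].
  under eq_fun do rewrite big_nil.
  by split; exact: integrable0.
by under eq_fun do rewrite big_cons; exact: cintbleD.
Qed.

Lemma cintD f g : cintble f -> cintble g ->
  cint (fun t => f t + g t) = cint f + cint g.
Proof.
move=> [f1 f2] [g1 g2]; apply: complex_ext => /=.
  by under eq_Rintegral do rewrite cReD; exact: RintegralD.
by under eq_Rintegral do rewrite cImD; exact: RintegralD.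
Qed.

Lemma cintZ k f : cintble f -> cint (fun t => k * f t) = k * cint f.
Proof.
move=> [f1 f2].
have Z (c : R) (u : T -> R) : int_ u -> int_ (fun t => c * u t).
  by move=> /(integrable_mulr c); under [X in EFin \o X]eq_fun do rewrite mulrC.
apply: complex_ext; rewrite ?cReM ?cImM.
  rewrite -(RintegralZl (cRe k) measurableT f1) -(RintegralZl (cIm k) measurableT f2).
  by rewrite -RintegralB ?Z//; apply: eq_Rintegral => t _; rewrite cReM.
rewrite -(RintegralZl (cIm k) measurableT f1) -(RintegralZl (cRe k) measurableT f2).
by rewrite -RintegralD ?Z//; apply: eq_Rintegral => t _; rewrite cImM.
Qed.

Lemma cintB f g : cintble f -> cintble g ->
  cint (fun t => f t - g t) = cint f - cint g.
Proof.
move=> fi gi; under [fun t => f t - g t]eq_fun do rewrite -mulN1r.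
by rewrite cintD ?cintZ ?mulN1r//; exact: cintbleZ.
Qed.

Lemma cint_conj f : cintble f -> cint (fun t => conjc (f t)) = conjc (cint f).
Proof.
move=> [f1 f2]; apply: complex_ext; rewrite /= ?cRe_conj ?cIm_conj.
  by under eq_Rintegral do rewrite cRe_conj.
under eq_Rintegral do rewrite cIm_conj -mulN1r.
by rewrite RintegralZl// mulN1r.
Qed.

Lemma cint_sum (I : Type) (s : seq I) (F : I -> T -> C) :
  (forall i, cintble (F i)) ->
  cint (fun t => \sum_(i <- s) F i t) = \sum_(i <- s) cint (F i).
Proof.
move=> iF; elim: s => [|i s ih].
  under [fun t => _]eq_fun do rewrite big_nil.
  by rewrite big_nil; apply: complex_ext => /=; rewrite Rintegral_cst// mul0r.
under [fun t => _]eq_fun do rewrite big_cons.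
by rewrite big_cons cintD ?ih//; exact: cintble_sum.
Qed.

Lemma cint_real (r : T -> R) : cint (fun t => (r t)%:C) = (\int[mu]_t r t)%:C.
Proof. by apply: complex_ext => //=; rewrite Rintegral_cst// mul0r. Qed.

Lemma eq_cint f g : f =1 g -> cint f = cint g.
Proof. by move=> /funext ->. Qed.

(** The factor 2 comes from bounding the real and the imaginary integral separately. *)
Lemma normc_cint_le f (v : T -> R) : cintble f -> int_ v ->
  (forall t, normc (f t) <= v t) -> normc (cint f) <= 2 * \int[mu]_t v t.
Proof.
move=> [f1 f2] iv fv; apply: le_trans (normc_le_ReIm _) _.
rewrite mulrDl mul1r lerD//=.
  apply: le_trans (le_normr_Rintegral _ f1) _ => //.
  apply: le_Rintegral => //; first exact: (integrable_norm f1).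
  by move=> t _; exact: le_trans (cRe_le_normc _) (fv t).
apply: le_trans (le_normr_Rintegral _ f2) _ => //.
apply: le_Rintegral => //; first exact: (integrable_norm f2).
by move=> t _; exact: le_trans (cIm_le_normc _) (fv t).
Qed.

End ComplexIntegral.

(** * Fubini's theorem for complex integrands *)

Section ComplexFubini.
Context d1 d2 (T1 : measurableType d1) (T2 : measurableType d2) (R : realType).
Context (m1 : {sigma_finite_measure set T1 -> \bar R}).
Context (m2 : {sigma_finite_measure set T2 -> \bar R}).
Local Notation M := (m1 \x m2)%E.

Lemma integrable_fubini_G (f : T1 * T2 -> \bar R) : M.-integrable setT f ->
  m2.-integrable setT (fubini_G m1 f).
Proof.
move=> fi; have mf := measurable_int _ fi; apply/integrableP; split.
  exact: (measurable_fubini_G fi).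
move/(integrable21ltyP m1 m2 mf) : (fi).
apply: le_lt_trans; apply: ge0_le_integral => //.
  - exact/measurableT_comp/(measurable_fubini_G fi).
  - apply: (measurable_fun_fubini_tonelli_G (abse \o f)) => [|y].
      exact: measurableT_comp.
    exact: abse_ge0.
  - move=> y _; apply: le_abse_integral => //.
    exact: measurable_fun_pair1.
Qed.

Lemma integrable_slice_ae (f : T1 * T2 -> \bar R) : M.-integrable setT f ->
  \forall y \ae m2, m1.-integrable setT (fun x => f (x, y)).
Proof.
move=> fi; have mf := measurable_int _ fi.
have af : M.-integrable setT (abse \o f) by exact: integrable_abse.
have := integrable_ae measurableT (integrable_fubini_G af).
apply: filterS => y /(_ Logic.I); rewrite ge0_fin_numE; last first.
  by apply: integral_ge0 => x _; exact: abse_ge0.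
by move=> lty; apply/integrableP; split => //; exact: measurable_fun_pair1.
Qed.

(** A real integral is the finite part of an extended one, so it is 0 on slices with infinite
    integral. This can only decrease the absolute value, so integrability passes from the extended
    slice integral to the real one. *)
Lemma cint_slice_integrable (f : T1 * T2 -> R[i]) : cintble M f ->
  m2.-integrable setT (fun y => (cRe (cint m1 (fun x => f (x, y))))%:E) /\
  m2.-integrable setT (fun y => (cIm (cint m1 (fun x => f (x, y))))%:E).
Proof.
have K (g : T1 * T2 -> R) : M.-integrable setT (EFin \o g) ->
    m2.-integrable setT (fun y => (\int[m1]_x g (x, y))%:E).
  move=> gi; have gG := integrable_fubini_G gi.
  have mG := measurable_int _ gG.
  have mR : measurable_fun setT (fun y => (\int[m1]_x g (x, y))%:E).
    by apply/measurable_EFinP; exact: (measurableT_comp (@fine_measurable R setT measurableT) mG).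
  apply/integrableP; split => //.
  move/integrableP : (gG) => [_]; apply: le_lt_trans.
  apply: ge0_le_integral => //.
  - exact/measurableT_comp/mR.
  - exact/measurableT_comp/mG.
  - move=> y _; rewrite /Rintegral /fubini_G /=.
    by case: (\int[m1]_x _)%E => [r||] //=; rewrite ?normr0 ?leey.
move=> [f1 f2]; split; first exact: (K (fun z => cRe (f z)) f1).
exact: (K (fun z => cIm (f z)) f2).
Qed.

Lemma cint_fubini (f : T1 * T2 -> R[i]) : cintble M f ->
  cint M f = cint m2 (fun y => cint m1 (fun x => f (x, y))).
Proof.
have K (g : T1 * T2 -> R) : M.-integrable setT (EFin \o g) ->
    \int[M]_z g z = \int[m2]_y \int[m1]_x g (x, y).
  move=> gi; rewrite /Rintegral -(integral21_prod_meas1 gi); congr fine.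
  apply: ae_eq_integral => //.
  - exact: (measurable_fubini_G gi).
  - have := measurable_fubini_G gi => mG.
    apply/measurable_EFinP.
    exact: (measurableT_comp (@fine_measurable R setT measurableT) mG).
  - apply: filterS (integrable_ae measurableT (integrable_fubini_G gi)).
    by move=> y /[apply] => fy; rewrite fineK.
move=> [f1 f2]; apply: complex_ext; first exact: (K (fun z => cRe (f z)) f1).
exact: (K (fun z => cIm (f z)) f2).
Qed.

End ComplexFubini.

(** * Waves and spherical functions *)

(* locked, because [qpow] is a product: rules for products would unfold it *)
Fact wave_key : unit. Proof. exact: tt. Qed.

Section Waves.
Context (R : realType) (q : nat) (q1 : (1 < q)%N).
Local Notation C := R[i].
Local Notation L := (ln q%:R : R).
Implicit Types (s h : R) (n : nat).

Definition wave s h : C := locked_with wave_key (qpow q ((2^-1 +i* s) * h%:C)).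

Lemma wave_qpow s h : wave s h = qpow q ((2^-1 +i* s) * h%:C).
Proof. by rewrite /wave unlock. Qed.


Lemma qR_gt1 : 1 < q%:R :> R. Proof. by rewrite ltr1n. Qed.
Lemma qR_gt0 : 0 < q%:R :> R. Proof. by rewrite ltr0n ltnW. Qed.
Lemma lnq_gt0 : 0 < L. Proof. by rewrite ln_gt0 ?qR_gt1. Qed.

Lemma waveE s h :
  wave s h = (q%:R `^ (h / 2))%:C * (cos (s * h * L) +i* sin (s * h * L)).
Proof.
rewrite wave_qpow /qpow /=.
have -> : 2^-1 * h - s * 0 = h / 2 by ring.
by have -> : 2^-1 * 0 + s * h = s * h by ring.
Qed.

Lemma cRe_wave s h : cRe (wave s h) = q%:R `^ (h / 2) * cos (s * h * L).
Proof. by rewrite waveE /= mul0r subr0. Qed.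

Lemma cIm_wave s h : cIm (wave s h) = q%:R `^ (h / 2) * sin (s * h * L).
Proof. by rewrite waveE /= mul0r addr0. Qed.

Lemma waveD s h1 h2 : wave s (h1 + h2) = wave s h1 * wave s h2.
Proof.
have qn0 : (q%:R : R) != 0 by rewrite gt_eqF ?qR_gt0.
have E : q%:R `^ ((h1 + h2) / 2) = q%:R `^ (h1 / 2) * q%:R `^ (h2 / 2) :> R.
  by rewrite mulrDl powRD// qn0 implybT.
have E' : s * (h1 + h2) * L = s * h1 * L + s * h2 * L by ring.
apply: complex_ext.
  by rewrite cRe_wave cReM !cRe_wave !cIm_wave E E' cosD; ring.
by rewrite cIm_wave cImM !cRe_wave !cIm_wave E E' sinD; ring.
Qed.

Lemma wave0 s : wave s 0 = 1.
Proof.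
by apply: complex_ext; rewrite ?cRe_wave ?cIm_wave mulr0 !mul0r ?cos0 ?sin0 ?powRr0 ?mulr1 ?mulr0.
Qed.

Lemma wave_conj s h : conjc (wave s h) = wave (- s) h.
Proof.
apply: complex_ext; rewrite ?cRe_conj ?cIm_conj ?cRe_wave ?cIm_wave !mulNr.
  by rewrite cosN.
by rewrite sinN mulrN.
Qed.

Lemma normc_wave s h : normc (wave s h) = q%:R `^ (h / 2).
Proof.
apply: (@pexpIrn _ 2); rewrite ?nnegrE ?normc_ge0 ?powR_ge0// normc_sqr cRe_wave cIm_wave.
by rewrite !exprMn -mulrDr cos2Dsin2 mulr1.
Qed.

Lemma wave_conjM s h : wave s h * wave (- s) h = (q%:R `^ h)%:C.
Proof.
rewrite -wave_conj conjc_mul_normc normc_wave expr2 -powRD; last first.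
  by rewrite (gt_eqF qR_gt0) implybT.
by congr (_ `^ _)%:C; field.
Qed.

Lemma waveVM s h : wave s (- h) * wave s h = 1.
Proof. by rewrite -waveD addNr wave0. Qed.

Lemma qpowVE s h : qpow q (- ((2^-1 +i* s) * h%:C)) = wave s (- h).
Proof. by rewrite wave_qpow raddfN /= mulrN. Qed.

Lemma wave_natN s n : wave s (- n%:R) =
  ((Num.sqrt q%:R)^-1 ^+ n)%:C * (cos (n%:R * (s * L)) -i* sin (n%:R * (s * L))).
Proof.
have E : q%:R `^ (- n%:R / 2) = (Num.sqrt q%:R)^-1 ^+ n :> R.
  rewrite mulNr powRN mulrC powRrM powR12_sqrt ?ler0n//.
  by rewrite powR_mulrn ?sqrtr_ge0// exprVn.
rewrite waveE E; congr (_ * (_ +i* _)).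
  by rewrite -cosN; congr cos; ring.
by rewrite -sinN; congr sin; ring.
Qed.

(** One neighbour of a vertex is one unit higher and the other [q] are one unit lower. As
    [q * q ^ (-1/2) = q ^ (1/2)], the two contributions are complex conjugates and the eigenvalue is
    real. *)
Lemma wave_eigenvalue s :
  wave s 1 + q%:R * wave s (-1) = (2 * Num.sqrt q%:R * cos (s * L))%:C.
Proof.
have Eq : q%:R `^ (1 / 2) = Num.sqrt q%:R :> R by rewrite mul1r powR12_sqrt ?ler0n.
have E' : q%:R * q%:R `^ (-1 / 2) = Num.sqrt q%:R :> R.
  rewrite mulNr mul1r powRN powR12_sqrt ?ler0n// -[X in X * _](sqr_sqrtr (ler0n R q)).
  by rewrite expr2 mulfK// sqrtr_eq0 -ltNge qR_gt0.
have qC : q%:R = (q%:R : R)%:C :> C by rewrite rmorph_nat.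
rewrite qC; apply: complex_ext.
  rewrite cReD cReM !cRe_wave /= mul0r subr0 mulrA E' Eq mulr1 mulrN1 mulNr cosN.
  by ring.
rewrite cImD cImM !cRe_wave !cIm_wave /= mul0r addr0 mulrA E' Eq mulr1 mulrN1 mulNr sinN.
by ring.
Qed.

Lemma cmeas_wave d (T : measurableType d) (f g : T -> R) :
  measurable_fun setT f -> measurable_fun setT g ->
  cmeas (fun t => wave (f t) (g t)).
Proof.
move=> mf mg.
have ma : measurable_fun setT (fun t => f t * g t * L).
  by apply: measurable_funM => //; exact: measurable_funM.
have mp : measurable_fun setT (fun t => (q%:R : R) `^ (g t / 2)).
  apply: (measurableT_comp (measurable_powRr (q%:R : R))).
  exact: measurable_funM.
split.
  under eq_fun do rewrite cRe_wave.
  apply: measurable_funM => //; apply: measurableT_comp => //.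
  by apply: continuous_measurable_fun; exact: continuous_cos.
under eq_fun do rewrite cIm_wave.
apply: measurable_funM => //; apply: measurableT_comp => //.
by apply: continuous_measurable_fun; exact: continuous_sin.
Qed.

End Waves.

(** * The waves as functions on the boundary *)

Section BoundaryWaves.
Context (R : realType) (q : nat) (X : homTree q) (o : X).
Local Notation C := R[i].
Local Notation L := (ln q%:R : R).
Implicit Types (x y p : X) (w : Omega o) (s : R) (n : nat).
Let q1 := homTree_q X.
Local Notation h := (@height R q X o).

Lemma pwave_wave w s x : pwave w s x = wave q s (h w x).
Proof. by rewrite wave_qpow. Qed.

Lemma mwave_wave w s x : mwave w s x = wave q (- s) (h w x).
Proof. by rewrite wave_qpow. Qed.

Lemma pwave_conj w s x : conjc (pwave w s x) = mwave w s x.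
Proof. by rewrite pwave_wave mwave_wave wave_conj. Qed.

Lemma mwave_conj w s x : conjc (mwave w s x) = pwave w s x.
Proof. by rewrite pwave_wave mwave_wave wave_conj opprK. Qed.

Lemma pwave_root w s : pwave w s o = 1.
Proof. by rewrite pwave_wave height_root wave0. Qed.

Lemma measurable_cylinder x : measurable (cylinder o x : set (Omega o)).
Proof. by apply: sub_gen_smallest; exists x. Qed.

(** Induction on the distance to [o]: the height is constant on the cylinder of [x] and one less
    than that of the parent elsewhere. *)
Lemma measurable_height x : measurable_fun setT (fun w => h w x).
Proof.
have [n nE] : exists n, dist x o = n by exists (dist x o).
elim: n x nE => [|n ih] x xn.
  rewrite (dist_eq0 xn).
  have -> : (fun w => h w o) = cst 0 by apply/funext => w; exact: height_root.
  exact: measurable_cst.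
have [p [xp xo]] : exists p, adj x p /\ dist x o = (dist p o).+1.
  by apply: closer_neighbour; apply/eqP => e; move: xn; rewrite e dist0.
have -> : (fun w => h w x) = (fun w => if w \in (cylinder o x : set (Omega o))
    then (dist x o)%:R else h w p - 1).
  apply/funext => w; case: ifPn => [/set_mem|/negP/(contra_not (@mem_set _ _ _))] wx.
    exact: height_cylinder.
  exact: height_notin_cylinder.
apply: measurable_fun_ifT => //.
- by apply: (measurable_fun_bool true); rewrite preimage_mem_true setTI; exact: measurable_cylinder.
- by apply: measurable_funB => //; apply: ih; move: xo; rewrite xn => -[].
Qed.

Lemma cmeas_pwave_slice s x : cmeas (fun w => pwave w s x).
Proof.
have -> : (fun w => pwave w s x) = (fun w => wave q s (h w x)).
  by apply/funext => w; exact: pwave_wave.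
by apply: cmeas_wave => //; exact: measurable_height.
Qed.

Lemma cmeas_mwave_slice s x : cmeas (fun w => mwave w s x).
Proof.
have -> : (fun w => mwave w s x) = (fun w => wave q (- s) (h w x)).
  by apply/funext => w; exact: mwave_wave.
by apply: cmeas_wave => //; exact: measurable_height.
Qed.

Lemma cmeas_pwave x : cmeas (fun z : Omega o * R => pwave z.1 z.2 x).
Proof.
have -> : (fun z : Omega o * R => pwave z.1 z.2 x) = (fun z => wave q z.2 (h z.1 x)).
  by apply/funext => z; exact: pwave_wave.
by apply: cmeas_wave => //; exact: (measurableT_comp (measurable_height x)).
Qed.

Lemma cmeas_mwave x : cmeas (fun z : Omega o * R => mwave z.1 z.2 x).
Proof.
have -> : (fun z : Omega o * R => mwave z.1 z.2 x) = (fun z => wave q (- z.2) (h z.1 x)).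
  by apply/funext => z; exact: mwave_wave.
apply: cmeas_wave; last exact: (measurableT_comp (measurable_height x)).
by apply: measurableT_comp => //; exact: measurable_snd.
Qed.

Definition wave_bound x : R := q%:R `^ ((dist x o)%:R / 2).

Lemma normc_pwave_le w s x : normc (pwave w s x) <= wave_bound x.
Proof.
rewrite pwave_wave normc_wave; apply: ler_powR; first by rewrite ltW// qR_gt1.
by rewrite ler_wpM2r// (le_trans (ler_norm _))// height_bounded.
Qed.

Lemma normc_mwave_le w s x : normc (mwave w s x) <= wave_bound x.
Proof.
rewrite mwave_wave normc_wave; apply: ler_powR; first by rewrite ltW// qR_gt1.
by rewrite ler_wpM2r// (le_trans (ler_norm _))// height_bounded.
Qed.

Lemma pwave_neighbours w s x (t : seq X) : uniq t -> size t = q.+1 ->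
  (forall y, adj x y = (y \in t)) ->
  \sum_(y <- t) pwave w s y = (2 * Num.sqrt q%:R * cos (s * L))%:C * pwave w s x.
Proof.
move=> ut st tP; have [a ta [ha hP]] := height_neighbours R w ut tP.
rewrite (big_rem a ta)/= pwave_wave ha waveD//.
have -> : \sum_(y <- rem a t) pwave w s y =
    \sum_(y <- rem a t) wave q s (h w x) * wave q s (-1).
  apply: eq_big_seq => y; rewrite mem_rem_uniq// !inE => /andP[ya yt].
  by rewrite pwave_wave (hP _ yt ya) waveD.
rewrite big_const_seq count_predT size_rem// st /= iter_addr_0.
by rewrite -wave_eigenvalue// pwave_wave -mulr_natl; ring.
Qed.

(* the indicator of a cylinder is a combination of the waves of a vertex and of
   its parent *)
Lemma wave_step w s y p : adj y p -> dist y o = (dist p o).+1 ->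
  wave q s (h w y) = wave q s (-1) * wave q s (h w p) +
  (\1_(cylinder o y : set (Omega o)) w)%:C *
    (wave q s (dist y o)%:R * (1 - wave q s (-2))).
Proof.
move=> yp yo; rewrite indicE; have [wy|wy] := pselect (cylinder o y w).
  rewrite (mem_set (wy : (cylinder o y : set (Omega o)) w)) (height_cylinder _ wy) (height_cylinder _ (cylinder_parent yp yo wy)).
  rewrite mul1r mulrBr mulr1 -!waveD// yo.
  have -> : -1 + (dist p o)%:R = (dist p o).+1%:R + -2 :> R by rewrite -natr1; ring.
  by rewrite addrC subrK.
by rewrite (memNset (wy : ~ (cylinder o y : set (Omega o)) w))
  (height_notin_cylinder _ yp yo wy) rmorph0 mul0r addr0 waveD// mulrC.
Qed.

End BoundaryWaves.

(** * Boundary integrals of products of two waves *)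

Section SphericalFunction.
Context (R : realType) (q : nat) (X : homTree q) (o : X).
Context (nu : probability (Omega o) R) (hnu : is_boundary_measure nu).
Local Notation C := R[i].
Local Notation L := (ln q%:R : R).
Local Notation Om := (Omega o).
Implicit Types (x y p : X) (w : Om) (s : R) (n : nat).
Let q1 := homTree_q X.
Local Notation h := (@height R q X o).
Local Notation r := ((Num.sqrt q%:R)^-1 : R).

Definition wave_kernel s x y : C := cint nu (fun w => pwave w s x * mwave w s y).

Lemma cintble_bounded (f : Om -> C) (B : R) : cmeas f ->
  (forall w, normc (f w) <= B) -> cintble nu f.
Proof.
move=> mf fB; apply: (@cintble_le _ _ _ nu _ (cst B)) => //.
exact: finite_measure_integrable_cst.
Qed.

Lemma cintble_wave_kernel s x y : cintble nu (fun w => pwave w s x * mwave w s y).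
Proof.
apply: (@cintble_bounded _ (wave_bound R o x * wave_bound R o y)).
  by apply: cmeasM; [exact: cmeas_pwave_slice|exact: cmeas_mwave_slice].
move=> w; rewrite ComplexField.Normc.normcM ler_pM ?normc_ge0//.
  exact: normc_pwave_le.
exact: normc_mwave_le.
Qed.

Lemma cmeas_indic_cylinder x :
  cmeas (fun w => (\1_(cylinder o x : set Om) w)%:C : C).
Proof.
by apply: cmeas_real; apply: measurable_indic; exact: measurable_cylinder.
Qed.

Lemma cintble_indic_cylinder x :
  cintble nu (fun w => (\1_(cylinder o x : set Om) w)%:C : C).
Proof.
apply: (@cintble_bounded _ 1); first exact: cmeas_indic_cylinder.
by move=> w; rewrite normc_real indicE; case: (_ \in _); rewrite ?normr1 ?normr0.
Qed.

Lemma cint_indic_cylinder x : x != o ->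
  cint nu (fun w => (\1_(cylinder o x : set Om) w)%:C : C) =
  (q%:R / (q.+1%:R * q%:R ^+ dist x o))%:C.
Proof.
move=> xo; rewrite cint_real /Rintegral integral_indic ?setIT//; last first.
  exact: measurable_cylinder.
rewrite (dist_sym x o).
exact: (congr1 (fun t : \bar R => (fine t)%:C) (hnu xo)).
Qed.

Lemma wave_kernel_conj s x y : wave_kernel s y x = conjc (wave_kernel s x y).
Proof.
rewrite /wave_kernel -cint_conj; last exact: cintble_wave_kernel.
by apply: eq_cint => w; rewrite conjcM pwave_conj mwave_conj mulrC.
Qed.

Lemma parent_neq_root y p : dist y o = (dist p o).+1 -> y != o.
Proof. by move=> yo; apply/eqP => e; move: yo; rewrite e dist0. Qed.

(** [wave_step] splits off the wave of the parent. What remains lives on the cylinder of [y], where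
    the height of [x] is constant because [y] separates [x] from these rays; so only the measure of
    the cylinder has to be known. *)
Lemma wave_kernel_rec s x y p : adj y p -> dist y o = (dist p o).+1 ->
  dist y x = (dist p x).+1 ->
  wave_kernel s x y = wave q (- s) (-1) * wave_kernel s x p +
    (q%:R / q.+1%:R)%:C * (1 - wave q (- s) (-2)) * wave q s (- (dist x y)%:R).
Proof.
move=> yp yo yx; set c := wave q (- s) (dist y o)%:R * (1 - wave q (- s) (-2)).
have stepE w : pwave w s x * mwave w s y =
    wave q (- s) (-1) * (pwave w s x * mwave w s p) +
    (c * wave q s ((dist y o)%:R - (dist x y)%:R)) *
      (\1_(cylinder o y : set Om) w)%:C.
  rewrite !mwave_wave (wave_step w (- s) yp yo) -/c mulrDr; congr (_ + _).
    by rewrite mulrCA.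
  have [wy|wy] := pselect (cylinder o y w); last first.
    by rewrite indicE (memNset (wy : ~ (cylinder o y : set Om) w)) rmorph0; ring.
  by rewrite pwave_wave (height_separated _ yp yo yx wy); ring.
rewrite /wave_kernel (eq_cint _ stepE) cintD; last first.
- by apply: cintbleZ; exact: cintble_indic_cylinder.
- by apply: cintbleZ; exact: cintble_wave_kernel.
rewrite cintZ; last exact: cintble_wave_kernel.
rewrite cintZ; last exact: cintble_indic_cylinder.
rewrite cint_indic_cylinder ?(parent_neq_root yo)//; congr (_ + _).
rewrite /c waveD//.
(* The two waves at height [dist y o] are conjugate, with product [q ^ dist y o]; this cancels the
   power of [q] in the measure of the cylinder. *)
have -> : wave q (- s) (dist y o)%:R * (1 - wave q (- s) (-2)) *
    (wave q s (dist y o)%:R * wave q s (- (dist x y)%:R)) =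
    (wave q s (dist y o)%:R * wave q (- s) (dist y o)%:R) *
    ((1 - wave q (- s) (-2)) * wave q s (- (dist x y)%:R)) by ring.
rewrite wave_conjM// powR_mulrn ?ler0n//.
have -> : (q%:R / (q.+1%:R * q%:R ^+ dist y o))%:C =
    (q%:R / q.+1%:R : R)%:C * ((q%:R ^+ dist y o)^-1)%:C :> C.
  by rewrite -rmorphM /= invfM mulrA.
set a := (_ ^+ _)%:C; set b := ((_ ^+ _)^-1)%:C.
have ab : a * b = 1.
  rewrite -rmorphM /= divff ?rmorph1// expf_neq0// gt_eqF//.
  exact: qR_gt0.
by rewrite -[RHS]mulr1 -ab; ring.
Qed.

(** The integrand is [q ^ h w x], the Poisson kernel of the tree. Passing from the parent to [x]
    divides the mass by [q] and adds [(1 - q ^ -2) * q / (q + 1) = 1 - 1 / q] on the cylinder of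
    [x]. *)
Lemma wave_kernel_diag s x : wave_kernel s x x = 1.
Proof.
have [n nE] : exists n, dist x o = n by exists (dist x o).
elim: n x nE => [|n ih] x xn.
  rewrite (dist_eq0 xn) /wave_kernel.
  have -> : (fun w => pwave w s o * mwave w s o) = (fun w => (1 : R)%:C : C).
    by apply/funext => w; rewrite -pwave_conj pwave_root rmorph1 mulr1.
  rewrite cint_real Rintegral_cst//.
  etransitivity; first exact: (congr1 (fun t : \bar R => (1 * fine t)%:C) (probability_setT nu)).
  by rewrite mulr1.
have [p [xp xo]] : exists p, adj x p /\ dist x o = (dist p o).+1.
  by apply: closer_neighbour; apply/eqP => e; move: xn; rewrite e dist0.
have qn0 : q%:R != 0 :> R by rewrite gt_eqF// qR_gt0.
have stepE w : pwave w s x * mwave w s x =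
    (q%:R^-1)%:C * (pwave w s p * mwave w s p) +
    ((q%:R ^+ dist x o) * (1 - q%:R ^- 2))%:C * (\1_(cylinder o x : set Om) w)%:C.
  have [wx|wx] := pselect (cylinder o x w).
    rewrite !pwave_wave !mwave_wave !wave_conjM// (height_cylinder _ wx).
    rewrite (height_cylinder _ (cylinder_parent xp xo wx)) indicE.
    rewrite (mem_set (wx : (cylinder o x : set Om) w)) -!rmorphM -rmorphD /=.
    rewrite !powR_mulrn ?ler0n// xo exprS; congr (_%:C); field.
    exact: qn0.
  rewrite !pwave_wave !mwave_wave !wave_conjM// (height_notin_cylinder _ xp xo wx).
  rewrite indicE (memNset (wx : ~ (cylinder o x : set Om) w)) rmorph0 mulr0 addr0.
  rewrite powRD ?qn0 ?implybT// powR_inv1 ?ler0n//.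
  by rewrite -rmorphM mulrC.
rewrite /wave_kernel (eq_cint _ stepE) cintD; last first.
- by apply: cintbleZ; exact: cintble_indic_cylinder.
- by apply: cintbleZ; exact: cintble_wave_kernel.
rewrite cintZ; last exact: cintble_wave_kernel.
rewrite cintZ; last exact: cintble_indic_cylinder.
rewrite cint_indic_cylinder ?(parent_neq_root xo)// -/(wave_kernel s p p) ih; last first.
  by move: xo; rewrite xn => -[].
rewrite mulr1 -rmorphM -rmorphD -[RHS](rmorph1 (real_complex R)); congr (_%:C).
have q1n0 : q%:R + 1 != 0 :> R by rewrite natr1 pnatr_eq0.
have qkn0 : q%:R ^+ dist x o != 0 :> R by exact: expf_neq0.
rewrite -natr1; field; exact/and3P.
Qed.

(* [sin (s * L)] times the spherical function at distance [n]; the factor avoids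
   dividing by 0 at the end points of [0, tau] *)
Definition spherical n s : R :=
  r ^+ n / (1 + r ^+ 2) *
  (sin ((n%:R + 1) * (s * L)) - r ^+ 2 * sin ((n%:R - 1) * (s * L))).

Lemma inv_sqrtq_sqr : r ^+ 2 = q%:R^-1.
Proof. by rewrite exprVn sqr_sqrtr// ler0n. Qed.

Lemma spherical0 s : spherical 0 s = sin (s * L).
Proof.
rewrite /spherical expr0 add0r !mul1r sub0r mulN1r sinN.
have r1 : 1 + r ^+ 2 != 0 by rewrite inv_sqrtq_sqr gt_eqF// addr_gt0// invr_gt0 qR_gt0.
by move: r1; move: (r ^+ 2) (sin _) => a b a0; field.
Qed.

(** Induction on the distance, moving to the parent whichever of [x] and [y] thereby approaches the
    other. Conjugation exchanges the two cases, and the right-hand side is real. *)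
Lemma wave_kernel_spherical s x y :
  wave_kernel s x y * (sin (s * L))%:C = (spherical (dist x y) s)%:C.
Proof.
have [n nE] : exists n, dist x y = n by exists (dist x y).
elim: n x y nE => [|n ih] x y xyn.
  by rewrite (dist_eq0 xyn) dist0 wave_kernel_diag spherical0 mul1r.
have Q x' y' : dist x' y' = n.+1 ->
    (exists p, [/\ adj y' p, dist y' o = (dist p o).+1 & dist y' x' = (dist p x').+1]) ->
    wave_kernel s x' y' * (sin (s * L))%:C = (spherical n.+1 s)%:C.
  move=> xy' [p [yp yo yx]].
  have xpn : dist x' p = n by move: yx; rewrite dist_sym xy' dist_sym => -[].
  have rn0 : r != 0 by rewrite invr_eq0 sqrtr_eq0 -ltNge qR_gt0.
  have r1 : 1 + r ^+ 2 != 0.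
    by rewrite inv_sqrtq_sqr gt_eqF// addr_gt0// invr_gt0 qR_gt0.
  rewrite (wave_kernel_rec s yp yo yx) mulrDl -mulrA ih// xpn xy'.
  have -> : (q%:R / q.+1%:R)%:C = ((1 + r ^+ 2)^-1)%:C :> C.
    rewrite inv_sqrtq_sqr -natr1; congr (_%:C); field.
    by rewrite natr1 !pnatr_eq0 andbT -lt0n ltnW.
  rewrite (wave_natN q (- s) 1) (wave_natN q (- s) 2) wave_natN /spherical.
  have E1 : (n.+1%:R + 1) * (s * L) = n.+1%:R * (s * L) + s * L by ring.
  have E2 : (n.+1%:R - 1) * (s * L) = n.+1%:R * (s * L) - s * L by ring.
  have E3 : (n%:R + 1) * (s * L) = n.+1%:R * (s * L) by rewrite natr1.
  have E4 : (n%:R - 1) * (s * L) = n.+1%:R * (s * L) - 2%:R * (s * L).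
    by rewrite -natr1; ring.
  have E5 : 2%:R * (s * L) = s * L + s * L by ring.
  rewrite E1 E2 E3 E4 !mulNr !mul1r !mulrN E5.
  move: (n.+1%:R * (s * L)) => a; move: (s * L) => b.
  rewrite !(opprD, opprK, sinD, cosD, sinN, cosN).
  have ss : cos b ^+ 2 + sin b ^+ 2 - 1 = 0 by rewrite cos2Dsin2 subrr.
  rewrite !exprS expr0 mulr1; move: rn0 r1 ss; rewrite expr2.
  move: r (r ^+ n) (sin a) (cos a) (sin b) (cos b) => r k sa ca sb cb rn0 r1 ss.
  apply: complex_ext => /=; last by field.
  apply/eqP; rewrite -subr_eq0; apply/eqP.
  (* The imaginary parts agree as rational expressions; the real parts agree only modulo
     [cos ^ 2 + sin ^ 2 = 1], and this is the explicit multiple of that relation. *)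
  transitivity (- k * r * r * r / (1 + r * r) * (cb * sa - sb * ca) *
      (cb ^+ 2 + sb ^+ 2 - 1)); last by rewrite ss mulr0.
  by field.
have xy : x != y by apply/eqP => e; move: xyn; rewrite e dist0.
case: (dist_parent_dichotomy o xy) => [[p pP]|[p pP]].
  by rewrite (Q _ _ xyn)// ?xyn//; exists p.
rewrite wave_kernel_conj xyn.
rewrite -[in LHS](conjc_real (sin _)) -conjcM (Q y x)//; last by exists p.
  exact: conjc_real.
by rewrite dist_sym.
Qed.

End SphericalFunction.

(** * The Plancherel density *)

Section PlancherelDensity.
Context (R : realType) (q : nat) (q1 : (1 < q)%N).
Local Notation L := (ln q%:R : R).
Local Notation p := (q%:R^-1 : R).
Local Notation leb := (@lebesgue_measure R).
Local Notation tau := (tau q : R).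
Implicit Types (s u : R) (n : nat).

Let q0 : 0 < q%:R :> R. Proof. exact: qR_gt0. Qed.
Let L0 : 0 < L. Proof. exact: lnq_gt0. Qed.

Lemma invq_gt0 : 0 < p. Proof. by rewrite invr_gt0. Qed.
Lemma invq_lt1 : p < 1. Proof. by rewrite invf_lt1// qR_gt1. Qed.

Lemma tau_gt0 : 0 < tau. Proof. by rewrite divr_gt0// pi_gt0. Qed.

Lemma tauL : tau * L = pi. Proof. by rewrite /Defs.tau divfK// gt_eqF. Qed.

(** This is [|1 - q ^ (-1 - 2 i s)| ^ 2], up to the factor [q] the squared modulus of the difference
    in the numerator of [cfun]. Unlike the denominator it stays away from 0. *)
Definition bsqr s : R := 1 + p ^+ 2 - 2 * p * cos (2 * (s * L)).

Lemma bsqr_ge s : (1 - p) ^+ 2 <= bsqr s.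
Proof.
rewrite /bsqr -subr_ge0.
have -> : 1 + p ^+ 2 - 2 * p * cos (2 * (s * L)) - (1 - p) ^+ 2 =
  2 * p * (1 - cos (2 * (s * L))) by ring.
by rewrite mulr_ge0 ?mulr_ge0 ?subr_ge0 ?cos_le1// ltW// invq_gt0.
Qed.

Lemma bsqr_gt0 s : 0 < bsqr s.
Proof. by apply: lt_le_trans (bsqr_ge s); rewrite exprn_gt0// subr_gt0 invq_lt1. Qed.

(** With the sine in the numerator the density is visibly continuous and bounded, also at the poles
    of the c-function. *)
Lemma plancherel_densityE s : plancherel_density q s =
  2 * L / pi * (1 + p) * (sin (s * L) ^+ 2 / bsqr s).
Proof.
rewrite /plancherel_density /plancherel_cst /cfun.
set num := qpow q ((2^-1)%:C + _) - _; set den := qpow q _ - qpow q _.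
have q12 : q%:R `^ 2^-1 = Num.sqrt q%:R :> R by rewrite powR12_sqrt ?ler0n.
have sq : (Num.sqrt q%:R : R) ^+ 2 = q%:R by rewrite sqr_sqrtr// ler0n.
have sn0 : Num.sqrt q%:R != 0 :> R by rewrite sqrtr_eq0 -ltNge.
have numE : normc num ^+ 2 = q%:R * bsqr s.
  rewrite normc_sqr /num /qpow /= ?(mul0r, mul1r, addr0, add0r, subr0, sub0r, oppr0).
  rewrite ?(mulr0, mul0r, addr0, add0r, subr0, sub0r, oppr0) powRN q12.
  have E2 : 2 * (s * L) = s * L + s * L by ring.
  rewrite mulNr cosN sinN /bsqr E2 cosD.
  have := cos2Dsin2 (s * L); move: (cos (s * L)) (sin (s * L)) => c d cd.
  move: sq sn0; move: (Num.sqrt q%:R : R) => z <- zn0.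
  apply/eqP; rewrite -subr_eq0; apply/eqP.
  transitivity ((z ^+ 2 + z ^- 2) * (c ^+ 2 + d ^+ 2 - 1)); last first.
    by rewrite cd subrr mulr0.
  by field.
have denE : normc den ^+ 2 = 4 * sin (s * L) ^+ 2.
  rewrite normc_sqr /den /qpow /= ?(mul0r, mul1r, addr0, add0r, subr0, sub0r, oppr0).
  rewrite ?(mulr0, mul0r, addr0, add0r, subr0, sub0r, oppr0) !powRr0.
  by rewrite mulNr cosN sinN; ring.
rewrite !ComplexField.Normc.normcM ComplexField.Normc.normcV normc_real q12.
rewrite ger0_norm ?divr_ge0 ?sqrtr_ge0//.
rewrite !exprMn !exprVn numE denE sq.
rewrite [in RHS](_ : sin (s * L) ^+ 2 = 4 * sin (s * L) ^+ 2 / 4); last by field.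
have kE : q.+1%:R = q%:R + 1 :> R by rewrite natr1.
have k0 : q%:R + 1 != 0 :> R by rewrite natr1 pnatr_eq0.
have qn0 : q%:R != 0 :> R by rewrite gt_eqF.
have pin0 : pi != 0 :> R by rewrite gt_eqF// pi_gt0.
have bn0 : bsqr s != 0 by rewrite gt_eqF// bsqr_gt0.
rewrite kE; move: (4 * sin (s * L) ^+ 2) (bsqr s) bn0 => a b bn0.
move: L pi pin0 => l P pin0; move: (q%:R : R) k0 qn0 => Q k0 qn0.
(* Here [a] vanishes at the poles; [invfM] and [invrK] hold for 0 as well, so no case distinction
   arises. *)
have -> : (Q / (Q + 1) ^+ 2 * (Q * b / a))^-1 = a * (Q + 1) ^+ 2 / (Q ^+ 2 * b).
  by rewrite invfM (invfM _ a^-1) invrK; field; rewrite bn0 qn0 k0.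
by field; rewrite ?bn0 ?k0 ?qn0 ?pin0.
Qed.

Lemma continuous_bsqr : continuous bsqr.
Proof.
move=> s; rewrite /bsqr; apply: cvgB; first exact: cvg_cst.
apply: cvgM; first exact: cvg_cst.
apply: (@cvg_comp _ _ _ (fun u => 2 * (u * L)) cos _ (nbhs (2 * (s * L)))); last exact: continuous_cos.
apply: cvgM; first exact: cvg_cst.
by apply: cvgM; [exact: cvg_id|exact: cvg_cst].
Qed.

Lemma continuous_cosM u : continuous (fun s => cos (u * (s * L))).
Proof.
move=> s; apply: (@cvg_comp _ _ _ (fun t => u * (t * L)) cos _ (nbhs (u * (s * L)))); last exact: continuous_cos.
apply: cvgM; first exact: cvg_cst.
by apply: cvgM; [exact: cvg_id|exact: cvg_cst].
Qed.

Lemma continuous_cos_bsqr u : continuous (fun s => cos (u * (s * L)) / bsqr s).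
Proof.
move=> s; apply: cvgM; first exact: continuous_cosM.
by apply: cvgV; [rewrite gt_eqF// bsqr_gt0|exact: continuous_bsqr].
Qed.

Lemma integrable_continuous_tau (f : R -> R) : continuous f ->
  leb.-integrable `[0, tau] (EFin \o f).
Proof.
move=> cf; apply: continuous_compact_integrable; first exact: segment_compact.
exact: continuous_subspaceT.
Qed.

(** Up to a constant, [1 / bsqr] is the Poisson kernel of the disc at radius [1 / q] and angle
    [2 s ln q]. Its Fourier coefficients decay geometrically, one factor [p] for each increase of
    the index by 2. *)
Definition cosint u : R := \int[leb]_(s in `[0, tau]) (cos (u * (s * L)) / bsqr s).

Lemma cosint_opp u : cosint (- u) = cosint u.
Proof. by apply: eq_Rintegral => s _; rewrite mulNr cosN. Qed.

Lemma cosint_bounded u : `|cosint u| <= tau / (1 - p) ^+ 2.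
Proof.
have p1 : 0 < (1 - p) ^+ 2 by rewrite exprn_gt0// subr_gt0 invq_lt1.
have ci := integrable_continuous_tau (@continuous_cos_bsqr u).
apply: le_trans (le_normr_Rintegral _ ci) _ => //.
apply: (@le_trans _ _ (\int[leb]_(s in `[0, tau]) ((1 - p) ^- 2))); last first.
  rewrite Rintegral_cst//= lebesgue_measure_itv/= lte_fin tau_gt0.
  by rewrite oppr0 adde0 /= mulrC.
apply: le_Rintegral => //.
- exact: integrable_norm.
- by apply: integrable_continuous_tau => s; exact: cvg_cst.
- move=> s _; rewrite normrM -[leRHS]mul1r ler_pM//.
    by rewrite ler_norml cos_geN1 cos_le1.
  rewrite ger0_norm; last by rewrite invr_ge0 ltW// bsqr_gt0.
  by rewrite lef_pV2 ?posrE ?bsqr_gt0// bsqr_ge.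
Qed.

Lemma sin_natpi n : sin (n%:R * pi) = 0 :> R.
Proof.
elim: n => [|n ih]; first by rewrite mul0r sin0.
by rewrite -natr1 mulrDl mul1r sinDpi ih oppr0.
Qed.

Lemma integral_cos n : \int[leb]_(s in `[0, tau]) cos (n%:R * (s * L)) =
  if n == 0%N then tau else 0.
Proof.
case: n => [|n].
  under eq_Rintegral do rewrite mul0r cos0.
  by rewrite Rintegral_cst//= lebesgue_measure_itv/= lte_fin tau_gt0 oppr0 adde0 mul1r.
have nL : n.+1%:R * L != 0 by rewrite mulf_neq0// gt_eqF.
pose F (s : R) : R := sin (n.+1%:R * L * s) / (n.+1%:R * L).
have dF (s : R) : is_derive s 1 F (cos (n.+1%:R * (s * L))).
  apply: is_derive_eq; rewrite /GRing.scale /= !mulr0 add0r mulr1 mulrCA mulVf// mulr1.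
  by congr cos; ring.
have cF : continuous F.
  by move=> s; apply/differentiable_continuous/derivable1_diffP; case: (dF s).
rewrite /Rintegral (@continuous_FTC2 _ _ F) ?tau_gt0//.
- have -> : F tau = 0.
    by rewrite /F -mulrA [L * _]mulrC tauL sin_natpi mul0r.
  by rewrite /F mulr0 sin0 mul0r /= subrr.
- apply: continuous_subspaceT; exact: continuous_cosM.
- split=> [s _||]; first by case: (dF s).
    by apply: cvg_at_right_filter; exact: cF.
  by apply: cvg_at_left_filter; exact: cF.
- by move=> s _; rewrite derive1E; case: (dF s).
Qed.

(** By [2 cos a cos b = cos (a + b) + cos (a - b)] the numerators combine to
    [bsqr s * cos (n s ln q)], which cancels the denominator. *)
Lemma cosint_rec n : (1 + p ^+ 2) * cosint n%:R -
    p * (cosint (n%:R + 2) + cosint (n%:R - 2)) = if n == 0%N then tau else 0.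
Proof.
have I u := integrable_continuous_tau (@continuous_cos_bsqr u).
rewrite -integral_cos /cosint -RintegralD// -!RintegralZl//; last first.
  apply: (integrable_continuous_tau (f := fun s => cos ((n%:R + 2) * (s * L)) / bsqr s + cos ((n%:R - 2) * (s * L)) / bsqr s)).
  by move=> s; apply: cvgD; exact: continuous_cos_bsqr.
rewrite -RintegralB//; last 2 first.
- apply: (integrable_continuous_tau (f := fun s => (1 + p ^+ 2) * (cos (n%:R * (s * L)) / bsqr s))).
  by move=> s; apply: cvgM; [exact: cvg_cst|exact: continuous_cos_bsqr].
- apply: (integrable_continuous_tau (f := fun s => p * (cos ((n%:R + 2) * (s * L)) / bsqr s + cos ((n%:R - 2) * (s * L)) / bsqr s))).
  move=> s; apply: cvgM; first exact: cvg_cst.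
  by apply: cvgD; exact: continuous_cos_bsqr.
apply: eq_Rintegral => s _.
rewrite [(n%:R + 2) * _]mulrDl [(n%:R - 2) * _]mulrBl cosD cosB.
have := bsqr_gt0 s; rewrite /bsqr; move: (cos (2 * _)) (cos (n%:R * _)) => a b.
by move: p => P ab; field; rewrite gt_eqF.
Qed.

(* the other solutions of the recurrence [cosint_rec] grow like [q ^ (n / 2)],
   whereas [cosint] is bounded *)
Lemma cosint_step n : (0 < n)%N -> cosint n%:R = p * cosint (n%:R - 2).
Proof.
move=> n0; pose E m := cosint m%:R - p * cosint (m%:R - 2).
(* The recurrence of order 2 factors: its left-hand side is [E m - p * E (m + 2)]. Iterating, [E n]
   is [p ^ k] times a bounded quantity for every [k]. *)
have Estep m : (0 < m)%N -> E m = p * E (m + 2)%N.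
  case: m => // m _; have /= := cosint_rec m.+1; rewrite /E natrD addrK.
  by move=> /eqP; rewrite subr_eq0 => /eqP; lra.
have Ek k : E n = p ^+ k * E (n + k * 2)%N.
  elim: k => [|k ih]; first by rewrite expr0 mul1r addn0.
  by rewrite ih Estep ?addn_gt0 ?n0// exprSr -mulrA -addnA -mulSnr.
have M0 := cosint_bounded; set M := tau / _ in M0.
have EM m : `|E m| <= 2 * M.
  rewrite /E (le_trans (ler_normB _ _))// mulrDl mul1r lerD// normrM.
  rewrite -[leRHS]mul1r ler_pM// ger0_norm ltW//; [exact: invq_lt1|exact: invq_gt0].
suff : E n = 0 by move/eqP; rewrite subr_eq0 => /eqP.
apply/eqP; rewrite -normr_le0; apply/ler_addgt0Pr => e e0; rewrite add0r.
have : (fun k => p ^+ k * (2 * M)) @ \oo --> (0 * (2 * M)).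
  apply: cvgM; last exact: cvg_cst.
  by apply: cvg_expr; rewrite ger0_norm ?invq_lt1// ltW// invq_gt0.
rewrite mul0r => /cvgr0_norm_le/(_ e e0)[k _ /(_ k (leqnn k))] /= ke.
rewrite (Ek k) normrM; apply: le_trans ke.
rewrite normrM ler_wpM2l// [leRHS]ger0_norm//.
exact: le_trans (normr_ge0 _) (EM n).
Qed.

End PlancherelDensity.

(** * Orthonormality of the waves *)

Section Orthonormality.
Context (R : realType) (q : nat) (X : homTree q) (o : X).
Context (nu : probability (Omega o) R) (hnu : is_boundary_measure nu).
Local Notation C := R[i].
Local Notation L := (ln q%:R : R).
Local Notation p := (q%:R^-1 : R).
Local Notation leb := (@lebesgue_measure R).
Local Notation tau := (tau q : R).
Local Notation M := (nu \x leb)%E.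
Implicit Types (x y : X) (s : R) (n : nat) (z : Omega o * R).
Let q1 := homTree_q X.

(** The restriction to the half period is put into the density, so that integrals run over the whole
    product and Fubini applies without domains. *)
Definition weight s : R := plancherel_density q s * \1_(`[0, tau] : set R) s.

Lemma plancherel_density_ge0 s : 0 <= plancherel_density q s :> R.
Proof.
rewrite plancherel_densityE// mulr_ge0//; last first.
  by rewrite divr_ge0 ?sqr_ge0// ltW// bsqr_gt0.
rewrite mulr_ge0// ?divr_ge0 ?mulr_ge0 ?pi_ge0 ?addr_ge0 ?invr_ge0 ?ler0n//.
by rewrite ltW// lnq_gt0.
Qed.

Lemma weight_ge0 s : 0 <= weight s.
Proof. by rewrite mulr_ge0 ?plancherel_density_ge0// indicE ler0n. Qed.

Lemma weight_in s : s \in `[0, tau] -> weight s = plancherel_density q s.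
Proof. by move=> st; rewrite /weight indicE mem_set// mulr1. Qed.

Lemma weight_out s : s \notin `[0, tau] -> weight s = 0.
Proof.
by move=> st; rewrite /weight indicE memNset ?mulr0// => /= st'; rewrite st' in st.
Qed.

Lemma continuous_plancherel_density : continuous (plancherel_density q : R -> R).
Proof.
have -> : plancherel_density q = (fun s : R =>
    2 * L / pi * (1 + p) * (sin (s * L) ^+ 2 / bsqr q s)).
  by apply/funext => s; rewrite plancherel_densityE.
move=> s; apply: cvgM; first exact: cvg_cst.
apply: cvgM; last first.
  by apply: cvgV; [rewrite gt_eqF// bsqr_gt0|exact: continuous_bsqr].
suff h : sin (t * L) @[t --> s] --> sin (s * L) by under eq_fun do rewrite expr2; exact: cvgM.
apply: (@cvg_comp _ _ _ (fun t => t * L) sin _ (nbhs (s * L))); last exact: continuous_sin.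
by apply: cvgM; [exact: cvg_id|exact: cvg_cst].
Qed.

Lemma measurable_weight : measurable_fun setT weight.
Proof.
apply: measurable_funM; last exact: measurable_indic.
by apply: continuous_measurable_fun; exact: continuous_plancherel_density.
Qed.

Lemma weight_bounded : exists2 B : R, 0 <= B &
  forall s, weight s <= B * \1_(`[0, tau] : set R) s.
Proof.
have p1 : 0 < (1 - p) ^+ 2 by rewrite exprn_gt0// subr_gt0 invq_lt1.
have k0 : 0 <= 2 * L / pi * (1 + p).
  rewrite mulr_ge0// ?divr_ge0 ?mulr_ge0 ?pi_ge0 ?addr_ge0 ?invr_ge0 ?ler0n//.
  by rewrite ltW// lnq_gt0.
exists (2 * L / pi * (1 + p) * (1 - p) ^- 2).
  by rewrite mulr_ge0// invr_ge0 ltW.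
move=> s; apply: ler_wpM2r; first by rewrite indicE ler0n.
rewrite plancherel_densityE// ler_wpM2l// -[leRHS]mul1r ler_pM ?sqr_ge0//.
- by rewrite invr_ge0 ltW// bsqr_gt0.
- by rewrite lef_pV2 ?posrE ?bsqr_gt0// bsqr_ge.
Qed.

Lemma measurable_weight2 : measurable_fun setT (fun z => weight z.2).
Proof. exact: (measurableT_comp measurable_weight). Qed.

Lemma integrable_weight : M.-integrable setT (EFin \o (fun z => weight z.2)).
Proof.
have [B B0 wB] := weight_bounded.
apply: (@integrable_le _ _ _ M _ (fun z => \1_(setT `*` `[0, tau] : set (Omega o * R)) z * B)).
- exact: measurable_weight2.
- move=> z; rewrite ger0_norm ?weight_ge0// mulrC (le_trans (wB _))//.
  rewrite ler_wpM2l// !indicE.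
  have [zt|zt] := boolP (z.2 \in `[0, tau]).
    by rewrite !mem_set//=; split.
  by rewrite memNset// => /= zt'; rewrite zt' in zt.
- apply: integrable_mulr; apply: integrable_indic_lty; first exact: measurableX.
  have mI : measurable (`[0, tau] : set R) by [].
  apply: (eq_ind_r (fun t : \bar R => (t < +oo)%E) _
    (product_measure1E nu leb measurableT mI)).
  have Ifin : (leb `[0%R, tau] < +oo)%E. 
    by rewrite lebesgue_measure_itv/= lte_fin tau_gt0// -EFinD ltry.
  have N1 : nu setT \is a fin_num by apply: fin_num_measure.
  have N2 : leb `[0%R, tau] \is a fin_num by rewrite ge0_fin_numE.
  by move/fin_numPlt: (fin_numM N1 N2) => /andP[].
Qed.

Lemma cintble_weight : cintble M (fun z => (weight z.2)%:C).
Proof.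
split; first exact: integrable_weight.
exact: integrable0.
Qed.

Lemma cintble_bounded_weight (f : Omega o * R -> C) (B : R) : cmeas f ->
  (forall z, normc (f z) <= B) -> cintble M (fun z => f z * (weight z.2)%:C).
Proof.
move=> mf fB; have -> : (fun z => f z * (weight z.2)%:C) = (fun z => (weight z.2)%:C * f z).
  by apply/funext => z; rewrite mulrC.
exact: cintbleM_bounded cintble_weight mf fB.
Qed.

Lemma cmeas_pm x y : cmeas (fun z => pwave z.1 z.2 x * mwave z.1 z.2 y).
Proof. by apply: cmeasM; [exact: cmeas_pwave|exact: cmeas_mwave]. Qed.

Lemma cintble_pm x y :
  cintble M (fun z => pwave z.1 z.2 x * mwave z.1 z.2 y * (weight z.2)%:C).
Proof.
apply: (@cintble_bounded_weight _ (wave_bound R o x * wave_bound R o y)).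
  exact: cmeas_pm.
move=> z; rewrite ComplexField.Normc.normcM ler_pM ?normc_ge0//.
  exact: normc_pwave_le.
exact: normc_mwave_le.
Qed.

(** Product-to-sum formulas leave [cosint] at [n], [n + 2] and [n - 2], and [cosint_step] makes them
    cancel for [n > 0]. For [n = 0] there remains [(1 - p ^ 2) * cosint 0 = tau], which the
    normalising constant turns into 1. *)
Lemma integral_spherical n :
  \int[leb]_(s in `[0, tau]) (2 * L / pi * (1 + p) *
     (spherical q n s * (sin (s * L) / bsqr q s))) = (n == 0%N)%:R.
Proof.
have I (u : R) := integrable_continuous_tau q (continuous_cos_bsqr q1 (u := u)).
pose r : R := (Num.sqrt q%:R)^-1 ^+ n; pose k : R := 2 * L / pi * r / 2.
have L0 : L != 0 by rewrite gt_eqF// lnq_gt0.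
have pn0 : pi != 0 :> R by rewrite gt_eqF// pi_gt0.
have p1n0 : 1 + p != 0 by rewrite gt_eqF// addr_gt0// invq_gt0.
have E (s : R) : 2 * L / pi * (1 + p) * (spherical q n s * (sin (s * L) / bsqr q s)) =
    k * (((1 + p) * (cos (n%:R * (s * L)) / bsqr q s) - cos ((n%:R + 2) * (s * L)) / bsqr q s)
     - p * (cos ((n%:R - 2) * (s * L)) / bsqr q s)).
  rewrite /spherical -/r inv_sqrtq_sqr.
  have [e1 e2] : sin ((n%:R + 1) * (s * L)) * sin (s * L) =
        (cos (n%:R * (s * L)) - cos ((n%:R + 2) * (s * L))) / 2 /\
      sin ((n%:R - 1) * (s * L)) * sin (s * L) =
        (cos ((n%:R - 2) * (s * L)) - cos (n%:R * (s * L))) / 2.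
    have -> : cos ((n%:R + 2) * (s * L)) = cos ((n%:R + 1) * (s * L) + s * L).
      by congr cos; ring.
    have -> : cos ((n%:R - 2) * (s * L)) = cos ((n%:R - 1) * (s * L) - s * L).
      by congr cos; ring.
    have -> : cos (n%:R * (s * L)) = cos ((n%:R + 1) * (s * L) - s * L).
      by congr cos; ring.
    split; first by rewrite cosB cosD; field.
    have -> : cos ((n%:R + 1) * (s * L) - s * L) = cos ((n%:R - 1) * (s * L) + s * L).
      by congr cos; ring.
    by rewrite cosB cosD; field.
  have bn0 : bsqr q s != 0 by rewrite gt_eqF// bsqr_gt0.
  move: e1 e2; rewrite /k.
  move: (sin ((n%:R + 1) * _)) (sin ((n%:R - 1) * _)) (sin (s * L)) => a b c.
  move: (cos _) (cos _) (cos _) (bsqr q s) bn0 => d e f B Bn0 e1 e2.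
  transitivity (2 * L / pi * r * (a * c - p * (b * c)) / B).
    by move: p p1n0 (pi : R) pn0 => P P1 PI PI0; field; rewrite Bn0 PI0 P1.
  rewrite e1 e2; move: p p1n0 (pi : R) pn0 => P P1 PI PI0; field.
  by rewrite Bn0.
under eq_Rintegral do rewrite E.
have J (u v a : R) : leb.-integrable `[0, tau]
    (EFin \o (fun s => a * (cos (u * (s * L)) / bsqr q s) - cos (v * (s * L)) / bsqr q s)).
  apply: integrable_continuous_tau => s.
  by apply: cvgB; [apply: cvgM; [exact: cvg_cst|]|]; exact: continuous_cos_bsqr.
have J1 (u a : R) : leb.-integrable `[0, tau]
    (EFin \o (fun s => a * (cos (u * (s * L)) / bsqr q s))).
  apply: integrable_continuous_tau => s.
  by apply: cvgM; [exact: cvg_cst|]; exact: continuous_cos_bsqr.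
rewrite RintegralZl//; last first.
  apply: integrable_continuous_tau => s.
  apply: cvgB; last by apply: cvgM; [exact: cvg_cst|exact: continuous_cos_bsqr].
  by apply: cvgB; [apply: cvgM; [exact: cvg_cst|]|]; exact: continuous_cos_bsqr.
rewrite RintegralB// RintegralB// !RintegralZl// -!/(cosint q _).
have c2 : cosint q (n%:R + 2) = p * cosint q n%:R.
  by rewrite -natrD cosint_step ?addn2// -addn2 natrD addrK.
rewrite c2; case: n @r @k E c2 => [|n] r k _ _ /=.
  (* At [n = 0] the index [n - 2] is negative; evenness of [cosint] brings it back to 2. *)
  have := @cosint_rec R q q1 0; rewrite /= sub0r !cosint_opp add0r.
  have := @cosint_step R q q1 2 isT; rewrite subrr => -> e0.
  have tE : tau = pi / L by [].
  rewrite tE in e0; rewrite /k /r expr0; move: e0.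
  move: (pi : R) pn0 p p1n0 (ln _) L0 (cosint q 0) => PI PI0 P P1 l l0 c e0.
  transitivity (l / PI * ((1 + P ^+ 2) * c - P * (P * c + P * c))); first by field.
  by rewrite e0; field; rewrite l0.
have -> : cosint q n.+1%:R = p * cosint q (n.+1%:R - 2) by exact: cosint_step.
by rewrite mulrDl; ring.
Qed.

Lemma waves_orthonormal x y :
  cint M (fun z => pwave z.1 z.2 x * mwave z.1 z.2 y * (weight z.2)%:C) =
  (x == y)%:R.
Proof.
rewrite cint_fubini; last exact: cintble_pm.
pose g s := 2 * L / pi * (1 + p) *
  (spherical q (dist x y) s * (sin (s * L) / bsqr q s)).
rewrite (_ : (fun s => _) = (fun s => ((g \_ `[0, tau]) s)%:C)); last first.
  apply/funext => s /=; under eq_cint do rewrite mulrC.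
  rewrite cintZ; last exact: cintble_wave_kernel.
  rewrite (_ : cint nu _ = wave_kernel nu s x y)// /patch.
  have [/set_mem st|st] := ifPn; last first.
    by rewrite weight_out ?mul0r//; apply: contra st => st; rewrite mem_set.
  rewrite weight_in// plancherel_densityE// mulrC.
  (* One of the two sines goes to [wave_kernel_spherical], the other stays in the integrand. *)
  have -> : (2 * L / pi * (1 + p) * (sin (s * L) ^+ 2 / bsqr q s))%:C =
     (sin (s * L))%:C * (2 * L / pi * (1 + p) * (sin (s * L) / bsqr q s))%:C.
    by rewrite -rmorphM; congr (_%:C); ring.
  rewrite [LHS]mulrA (wave_kernel_spherical hnu) -rmorphM; congr (_%:C).
  by rewrite /g; ring.
rewrite cint_real -Rintegral_mkcond integral_spherical rmorph_nat.
by congr (nat_of_bool _)%:R; apply/eqP/eqP => [/dist_eq0|->]; rewrite ?dist0.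
Qed.

End Orthonormality.

(** * Totality of the waves *)

Section AlmostEverywhere.
Context d (T : measurableType d) (R : realType).
Context (mu : {measure set T -> \bar R}).
Implicit Types P Q : T -> Prop.

Lemma ae_imply P Q : (forall x, P x -> Q x) ->
  (\forall x \ae mu, P x) -> \forall x \ae mu, Q x.
Proof. by move=> PQ; exact: filterS. Qed.

Lemma ae_and P Q : (\forall x \ae mu, P x) -> (\forall x \ae mu, Q x) ->
  \forall x \ae mu, P x /\ Q x.
Proof. exact: filterI. Qed.

End AlmostEverywhere.

Section PiSystemUniqueness.
Context d (T : measurableType d) (R : realType).
Context (mu : {measure set T -> \bar R}).

(** The sets over which [f] integrates to 0 form a Dynkin system; the vanishing of the total
    integral gives closure under complements. *)
Lemma integral_pi_system_eq0 (G : set (set T)) (f : T -> \bar R) :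
  @measurable _ T = <<s G >> -> setI_closed G -> mu.-integrable setT f ->
  (\int[mu]_x f x = 0)%E -> (forall A, G A -> \int[mu]_(x in A) f x = 0)%E ->
  ae_eq mu setT f (cst 0%E).
Proof.
move=> mG GI fi f0 fG; have mf := measurable_int _ fi.
apply: integral_ae_eq => // E _ mE; rewrite integral0.
move: E mE; rewrite {1}mG; apply: (dynkin_induction mG GI) => //.
- move=> S mS fS; have fiS : mu.-integrable S f by exact: integrableS fi.
  have fiC : mu.-integrable (~` S) f.
    by apply: integrableS fi => //; exact: measurableC.
  have := f0; rewrite -(setUv S) integral_setU//.
  + by rewrite fS add0e.
  + exact: measurableC.
  + by rewrite setUv.
  + by rewrite disj_set2E setICr.
- move=> F mF tF F0; rewrite integral_bigcup//.
    by rewrite eseries0.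
  by apply: integrableS fi => //; exact: bigcupT_measurable.
Qed.

End PiSystemUniqueness.

(** * Functions of s with vanishing cosine moments *)

Section CosineMoments.
Context (R : realType) (q : nat) (q1 : (1 < q)%N).
Local Notation L := (ln q%:R : R).
Local Notation leb := (@lebesgue_measure R).
Local Notation tau := (tau q : R).
Implicit Types (s u : R) (n : nat).

Lemma bernoulli_ineq (v : R) n : -1 <= v -> 1 + n%:R * v <= (1 + v) ^+ n.
Proof.
move=> v1; elim: n => [|n ih]; first by rewrite mul0r addr0 expr0.
rewrite exprS; apply: (@le_trans _ _ ((1 + v) * (1 + n%:R * v))).
  rewrite -natr1; have := sqr_ge0 v; have := ler0n R n; nra.
by rewrite ler_wpM2l//; lra.
Qed.

(* a polynomial approximation of the step function at 1/2, from the elementary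
   proof of the Stone-Weierstrass theorem *)
Lemma cvg_step_poly (u : R) : 0 <= u <= 1 -> u != 2^-1 ->
  (1 - u ^+ n) ^+ (2 ^ n) @[n --> \oo] --> ((u < 2^-1)%R%:R : R).
Proof.
move=> /andP[u0 u1] uh.
have un0 n : 0 <= u ^+ n by rewrite exprn_ge0.
have un1 n : u ^+ n <= 1 by rewrite exprn_ile1.
have [ult|uge] := ltP u 2^-1.
  have c1 : (fun n => 1 - (2 * u) ^+ n) @ \oo --> (1 - 0 : R).
    apply: cvgB; first exact: cvg_cst.
    by apply: cvg_expr; rewrite ger0_norm ?mulr_ge0//; lra.
  rewrite subr0 in c1.
  apply: (squeeze_cvgr _ c1 (cvg_cst _)).
  apply: nearW => n; apply/andP; split; last first.
    by rewrite exprn_ile1// ?subr_ge0// gerBl.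
  (* Bernoulli's inequality bounds the power below by [1 - (2 * u) ^ n], where [2 * u < 1]. *)
  have := @bernoulli_ineq (- u ^+ n) (2 ^ n).
  rewrite lerN2 => /(_ (un1 n)); apply: le_trans.
  by rewrite mulrN natrX exprMn.
have ugt : 2^-1 < u by rewrite lt_neqAle eq_sym uh.
have c0 : (fun n => (2 * u)^-1 ^+ n) @ \oo --> (0 : R).
  apply: cvg_expr; rewrite ger0_norm ?invr_ge0 ?mulr_ge0//.
  by rewrite invf_lt1; lra.
apply: (squeeze_cvgr _ (cvg_cst _) c0).
apply: nearW => n; rewrite exprn_ge0 ?subr_ge0//=.
(* As [(1 - v) * (1 + v) <= 1], the power is at most the inverse of [(1 + u ^ n) ^ (2 ^ n)], which
   by Bernoulli is at least [(2 * u) ^ n], now with [2 * u > 1]. *)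
have b := @bernoulli_ineq (u ^+ n) (2 ^ n) (le_trans (lerN10 R) (un0 n)).
have p0 : 0 < (2 * u) ^+ n by rewrite exprn_gt0//; lra.
rewrite exprVn -[leRHS]mul1r ler_pdivlMr//.
have le2 : (2 * u) ^+ n <= (1 + u ^+ n) ^+ (2 ^ n).
  by apply: le_trans b; rewrite natrX exprMn lerDr.
apply: (@le_trans _ _ ((1 - u ^+ n) ^+ (2 ^ n) * (1 + u ^+ n) ^+ (2 ^ n))).
  by rewrite ler_wpM2l// exprn_ge0// subr_ge0.
rewrite -exprMn -subr_sqr expr1n exprn_ile1//; last by rewrite gerBl sqr_ge0.
by rewrite subr_ge0 exprn_ile1.
Qed.

Lemma continuous_cosL : continuous (fun s : R => cos (s * L)).
Proof.
move=> s; apply: (@cvg_comp _ _ _ (fun t => t * L) cos _ (nbhs (s * L))).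
  by apply: cvgM; [exact: cvg_id|exact: cvg_cst].
exact: continuous_cos.
Qed.

Lemma measurable_cosL : measurable_fun setT (fun s : R => cos (s * L)).
Proof. by apply: continuous_measurable_fun; exact: continuous_cosL. Qed.

Lemma integrableM_le1 (g v : R -> R) : leb.-integrable setT (EFin \o g) ->
  measurable_fun setT v -> (forall s, `|v s| <= 1) ->
  leb.-integrable setT (EFin \o (fun s => g s * v s)).
Proof.
move=> gi mv v1; apply: (@integrable_le _ _ _ leb _ (fun s => `|g s|)); last exact: integrable_norm.
  apply: measurable_funM => //.
  by apply/measurable_EFinP; exact: (measurable_int leb gi).
by move=> s; rewrite normrM -[leRHS]mulr1 ler_wpM2l.
Qed.

Lemma cos_abs_le1 (u : R) : `|cos u| <= 1.
Proof. by rewrite ler_norml cos_geN1 cos_le1. Qed.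

Lemma integrable_cos_poly (g : R -> R) (P : {poly R}) :
  leb.-integrable setT (EFin \o g) ->
  leb.-integrable setT (EFin \o (fun s => g s * P.[cos (s * L)])).
Proof.
elim/poly_ind: P g => [|P c ih] g gi.
  by under [X in EFin \o X]eq_fun do rewrite horner0 mulr0; exact: integrable0.
have -> : (fun s => g s * (P * 'X + c%:P).[cos (s * L)]) =
    (fun s => g s * cos (s * L) * P.[cos (s * L)] + g s * c).
  by apply/funext => s; rewrite !hornerE; ring.
apply: integrable_add; last exact: integrable_mulr.
apply: ih; apply: integrableM_le1 => //; first exact: measurable_cosL.
by move=> s; exact: cos_abs_le1.
Qed.

Lemma cos_moments_poly (g : R -> R) : leb.-integrable setT (EFin \o g) ->
  (forall k, \int[leb]_s (g s * cos (s * L) ^+ k) = 0) ->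
  forall P : {poly R}, \int[leb]_s (g s * P.[cos (s * L)]) = 0.
Proof.
move=> gi g0 P; elim/poly_ind: P g gi g0 => [|P c ih] g gi g0.
  under eq_Rintegral do rewrite horner0 mulr0.
  by rewrite Rintegral_cst// mul0r.
have gci : leb.-integrable setT (EFin \o (fun s => g s * cos (s * L))).
  apply: integrableM_le1 => //; first exact: measurable_cosL.
  by move=> s; exact: cos_abs_le1.
rewrite (_ : (fun s => _) = (fun s => g s * cos (s * L) * P.[cos (s * L)] + g s * c)).
  rewrite RintegralD//; [|exact: integrable_cos_poly|exact: integrable_mulr].
  rewrite ih//; last first.
    by move=> k; rewrite -[RHS](g0 k.+1); apply: eq_Rintegral => s _; rewrite exprS mulrA.
  rewrite add0r RintegralZr//.
  have := g0 0%N; under eq_Rintegral do rewrite expr0 mulr1.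
  by move=> ->; rewrite mul0r.
by apply/funext => s; rewrite !hornerE; ring.
Qed.

(** Polynomials in the cosine converge boundedly to the indicator of the sublevel set, and dominated
    convergence applies. On the level [a] itself they tend to [exp (-1)] instead, so this level has
    to be negligible where [g] is nonzero. *)
Lemma cos_moments_threshold (g : R -> R) (a : R) :
  leb.-integrable setT (EFin \o g) ->
  (forall k, \int[leb]_s (g s * cos (s * L) ^+ k) = 0) -> -1 <= a <= 1 ->
  (\forall s \ae leb, g s != 0 -> cos (s * L) != a) ->
  \int[leb]_s (g s * (cos (s * L) < a)%R%:R) = 0.
Proof.
move=> gi g0 /andP[a1 a2] ga.
(* An affine change of variable that sends [a] to 1/2 and, since both terms of the difference lie in
   [[-1, 1]], has values in [[0, 1]]. *)
pose u s := (cos (s * L) - a) / 4 + 2^-1.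
have u01 s : 0 <= u s <= 1.
  have := cos_abs_le1 (s * L); rewrite ler_norml => /andP[c1 c2].
  by rewrite /u; apply/andP; split; lra.
have uE s : (u s < 2^-1) = (cos (s * L) < a).
  by rewrite /u; apply/idP/idP; lra.
pose f n s := g s * (1 - u s ^+ n) ^+ (2 ^ n).
have mu' : measurable_fun setT u.
  apply: measurable_funD => //; apply: measurable_funM => //.
  by apply: measurable_funB => //; exact: measurable_cosL.
have mg : measurable_fun setT g by apply/measurable_EFinP; exact: (measurable_int leb gi).
have v01 n s : `|(1 - u s ^+ n) ^+ (2 ^ n)| <= 1.
  have /andP[u0 u1] := u01 s.
  have h1 : 0 <= 1 - u s ^+ n by rewrite subr_ge0 exprn_ile1.
  by rewrite ger0_norm ?exprn_ge0// exprn_ile1// gerBl exprn_ge0.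
have f0 n : \int[leb]_s f n s = 0.
  pose P : {poly R} := (1 - (4^-1 *: ('X - a%:P) + (2^-1)%:P) ^+ n) ^+ (2 ^ n).
  rewrite -[RHS](cos_moments_poly gi g0 P); apply: eq_Rintegral => s _.
  rewrite /f /P /u !(hornerE, horner_exp).
  by rewrite [_ / 4]mulrC.
have mv n : measurable_fun setT (fun s => (1 - u s ^+ n) ^+ (2 ^ n)).
  by apply: measurable_funX; apply: measurable_funB => //; exact: measurable_funX.
have := @dominated_convergence _ _ R leb setT measurableT
  (fun n s => (f n s)%:E) (fun s => (g s * (cos (s * L) < a)%R%:R)%:E)
  (fun s => `|g s|%:E).
case.
- by move=> n; apply/measurable_EFinP; exact: (measurable_funM mg (mv n)).
- apply/measurable_EFinP; apply: measurable_funM => //.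
  have -> : (fun s => (cos (s * L) < a)%R%:R) = \1_[set s | cos (s * L) < a] :> (R -> R).
    by apply/funext => s; rewrite indicE /= mem_setE.
  apply: measurable_indic.
  have := measurable_cosL measurableT (measurable_itv `]-oo, a[).
  by rewrite setTI; congr measurable; apply/seteqP; split=> s /=; rewrite in_itv.
- apply: ae_imply ga => s gs _.
  apply: cvg_EFin; first by apply: nearW.
  have [g0s|gn0] := eqVneq (g s) 0.
    by rewrite /f g0s; under eq_fun do rewrite mul0r; rewrite mul0r; exact: cvg_cst.
  apply: cvgM; first exact: cvg_cst.
  rewrite -uE; apply: cvg_step_poly => //.
  apply: contra (gs gn0) => /eqP; rewrite /u => us; apply/eqP; lra.
- exact: integrable_norm.
- apply: aeW => s n _; rewrite lee_fin normrM -[leRHS]mulr1 ler_wpM2l//.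
move=> _ _ cv; rewrite /Rintegral.
have seq0 : [sequence (\int[leb]_s (f n s)%:E)%E]_n = cst 0%E.
  apply/funext => n /=.
  have fi : leb.-integrable setT (EFin \o f n) by exact: integrableM_le1.
  have := f0 n; rewrite /Rintegral => h.
  by rewrite -(fineK (integrable_fin_num measurableT fi)) [fine _]h.
move: cv; rewrite [X in X @ \oo]seq0 => /(cvg_lim (@ereal_hausdorff R)).
by rewrite lim_cst// => <-.
Qed.

Lemma cos_moments_eq0 (g : R -> R) : leb.-integrable setT (EFin \o g) ->
  (forall s, s \notin `[0, tau] -> g s = 0) ->
  (forall k, \int[leb]_s (g s * cos (s * L) ^+ k) = 0) ->
  \forall s \ae leb, g s = 0.
Proof.
move=> gi gout g0.
have L0 : 0 < L by exact: lnq_gt0.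
have sL s : s \in `[0, tau] -> s * L \in `[0, pi].
  rewrite !in_itv /= => /andP[s0 s1]; rewrite mulr_ge0 ?(ltW L0)//=.
  by rewrite -(tauL R q1) ler_wpM2r// (ltW L0).
(* Cosine decreases on [[0, pi]], so inside [[0, tau]] its sublevel sets are half-lines, and
   half-lines generate the Borel sets. *)
have key (s0 : R) : (\int[leb]_(s in `]s0, +oo[) (g s)%:E = 0)%E.
  have giS : leb.-integrable `]s0, +oo[ (EFin \o g) by exact: integrableS gi.
  rewrite -[LHS]fineK; last exact: (integrable_fin_num _ giS).
  congr EFin; rewrite -/(Rintegral _ _ _) Rintegral_mkcond.
  have gT : \int[leb]_s g s = 0.
    by rewrite -[RHS](g0 0%N); apply: eq_Rintegral => s _; rewrite expr0 mulr1.
  have [s0n|s0p] := ltP s0 0.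
    rewrite -[RHS]gT; apply: eq_Rintegral => s _; rewrite /patch.
    case: ifPn => // /negP st; rewrite gout//; apply/negP => st'; apply: st.
    rewrite mem_set//= in_itv/= andbT; apply: lt_le_trans s0n _.
    by move: st'; rewrite in_itv => /andP[].
  have [s0t|s0t] := leP s0 tau; last first.
    rewrite -[RHS](_ : \int[leb]_s (0 : R) = 0); last by rewrite Rintegral_cst// mul0r.
    apply: eq_Rintegral => s _; rewrite /patch; case: ifPn => // /set_mem /=.
    rewrite in_itv/= andbT => ss; rewrite gout// in_itv/= negb_and orbC -ltNge.
    by rewrite (lt_trans s0t ss).
  have s0I : s0 \in `[0, tau] by rewrite in_itv /= s0p.
  rewrite -[RHS](@cos_moments_threshold g (cos (s0 * L)))//.
  - apply: eq_Rintegral => s _; rewrite /patch.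
    have [sI|sI] := boolP (s \in `[0, tau]); last by rewrite gout// mul0r if_same.
    rewrite ltr_cos ?sL// ltr_pM2r//.
    have [ss|ss] := ltP s0 s; first by rewrite mem_set ?mulr1//= in_itv/= ss.
    by rewrite memNset ?mulr0//= in_itv/= andbT => /lt_geF; rewrite ss.
  - by rewrite cos_geN1 cos_le1.
  (* Since [g] vanishes off [[0, tau]] and the cosine is injective there, the critical level is met
     at [s0] only. *)
  - exists [set s0]; split => //; first exact: lebesgue_measure_set1.
    move=> s /= /not_implyP[gs /negP]; rewrite negbK => /eqP cs.
    have sI : s \in `[0, tau] by apply: contraNT gs => /gout ->.
    have [ss|ss|//] := ltgtP s s0.
      by have := ltr_cos (sL _ sI) (sL _ s0I); rewrite cs ltxx ltr_pM2r// ss.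
    by have := ltr_cos (sL _ s0I) (sL _ sI); rewrite cs ltxx ltr_pM2r// ss.
have gT : (\int[leb]_s (g s)%:E = 0)%E.
  rewrite -[LHS]fineK; last exact: (integrable_fin_num _ gi).
  rewrite [fine _](_ : _ = 0)//; rewrite -[RHS](g0 0%N).
  by apply: eq_Rintegral => s _; rewrite expr0 mulr1.
have := @integral_pi_system_eq0 _ (measurableTypeR R) R leb (@RGenOInfty.G R)
  (EFin \o g) (RGenOInfty.measurableE R).
have GI : setI_closed (@RGenOInfty.G R).
  move=> _ _ [a ->] [b ->]; exists (Order.max a b).
  by apply/seteqP; split=> s /=; rewrite !in_itv/= !andbT gt_max => /andP.
move=> /(_ GI gi gT) h.
have : ae_eq leb setT (EFin \o g) (cst 0%E) by apply: h => A [s0 ->]; exact: key.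
by apply: ae_imply => s /(_ Logic.I) /= [].
Qed.

End CosineMoments.

(** * Integrable functions orthogonal to all waves *)

Section Totality.
Context (R : realType) (q : nat) (X : homTree q) (o : X).
Context (nu : probability (Omega o) R).
Local Notation C := R[i].
Local Notation L := (ln q%:R : R).
Local Notation leb := (@lebesgue_measure R).
Local Notation tau := (tau q : R).
Local Notation M := (nu \x leb)%E.
Local Notation Om := (Omega o).
Implicit Types (x y : X) (s : R) (n k : nat) (z : Om * R).
Let q1 := homTree_q X.

(** Countability lets the null sets of parameters [s], one for each vertex, be collected into a
    single one. *)
Lemma enum_vertices : exists e : nat -> X, forall x, exists n, e n = x.
Proof.
have cX : countable [set: X].
  have -> : [set: X] = \bigcup_n [set x | (dist x o <= n)%N].
    by apply/seteqP; split => // x _; exists (dist x o) => /=.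
  apply: bigcup_countable => // n _.
  exact/finite_set_countable/finite_ball.
have /pfcard_geP[X0|[f]] := cX.
  by have : [set: X] o by []; rewrite X0.
by exists f => x; have [n _ nx] := @surj _ _ _ _ f x Logic.I; exists n.
Qed.

Lemma measurable_cosL2 k : measurable_fun setT (fun z => cos (z.2 * L) ^+ k).
Proof.
apply: measurable_funX.
exact: (measurableT_comp (measurable_cosL q)).
Qed.

Lemma cos_pow_le1 (u : R) k : `|cos u ^+ k| <= 1.
Proof. by rewrite normrX exprn_ile1// cos_abs_le1. Qed.

Context (Phi : Om * R -> C) (Phii : cintble M Phi).

Lemma cintble_pwave_cos x k :
  cintble M (fun z => Phi z * pwave z.1 z.2 x * (cos (z.2 * L) ^+ k)%:C).
Proof.
apply: (@cintbleM_bounded _ _ _ _ _ _ 1); last first.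
- by move=> z; rewrite normc_real cos_pow_le1.
- by apply: cmeas_real; exact: measurable_cosL2.
- apply: (@cintbleM_bounded _ _ _ _ _ _ (wave_bound R o x)) => //.
    exact: cmeas_pwave.
  by move=> z; exact: normc_pwave_le.
Qed.

Lemma cintble_pwave x : cintble M (fun z => Phi z * pwave z.1 z.2 x).
Proof.
apply: (@cintbleM_bounded _ _ _ _ _ _ (wave_bound R o x)) => //.
  exact: cmeas_pwave.
by move=> z; exact: normc_pwave_le.
Qed.

Hypothesis Phi_pwave : forall x, cint M (fun z => Phi z * pwave z.1 z.2 x) = 0.

Lemma cint_pwave_cos x k :
  cint M (fun z => Phi z * pwave z.1 z.2 x * (cos (z.2 * L) ^+ k)%:C) = 0.
Proof.
elim: k x => [|k ih] x.
  by rewrite -[RHS](Phi_pwave x); apply: eq_cint => z; rewrite expr0 mulr1.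
have [t [ut st tP]] := adj_degree x.
have c0 : 2 * Num.sqrt q%:R != 0 :> R.
  by rewrite mulf_neq0// sqrtr_eq0 -ltNge qR_gt0.
(* One factor cosine is traded for the sum of the waves of the neighbours, to each of which the
   induction hypothesis applies. *)
have E z : Phi z * pwave z.1 z.2 x * (cos (z.2 * L) ^+ k.+1)%:C =
    ((2 * Num.sqrt q%:R)^-1)%:C *
    \sum_(y <- t) (Phi z * pwave z.1 z.2 y * (cos (z.2 * L) ^+ k)%:C).
  rewrite -mulr_suml -mulr_sumr (pwave_neighbours z.1 z.2 ut st tP) exprS.
  have -> : (2 * Num.sqrt q%:R * cos (z.2 * L))%:C =
      (2 * Num.sqrt q%:R)%:C * (cos (z.2 * L))%:C :> C by rewrite -rmorphM.
  have -> : (cos (z.2 * L) * cos (z.2 * L) ^+ k)%:C =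
      (cos (z.2 * L))%:C * (cos (z.2 * L) ^+ k)%:C :> C by rewrite -rmorphM.
  have cc : ((2 * Num.sqrt q%:R)^-1)%:C * (2 * Num.sqrt q%:R)%:C = 1 :> C.
    by rewrite -rmorphM /= mulVf.
  by rewrite -[LHS]mul1r -cc; ring.
rewrite (eq_cint M E) cintZ; last first.
  by apply: cintble_sum => y; exact: cintble_pwave_cos.
rewrite cint_sum; last by move=> y; exact: cintble_pwave_cos.
by rewrite big1 ?mulr0.
Qed.

Local Notation slice x s := (cint nu (fun w => Phi (w, s) * pwave w s x)).

Lemma slice_integrable_ae : \forall s \ae leb, cintble nu (fun w => Phi (w, s)).
Proof.
have [f1 f2] := Phii.
have := ae_and (integrable_slice_ae f1) (integrable_slice_ae f2).
by apply: ae_imply => s [].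
Qed.

Lemma cintble_slice s x : cintble nu (fun w => Phi (w, s)) ->
  cintble nu (fun w => Phi (w, s) * pwave w s x).
Proof.
move=> fs; apply: (@cintbleM_bounded _ _ _ _ _ _ (wave_bound R o x)) => //.
  exact: cmeas_pwave_slice.
by move=> w; exact: normc_pwave_le.
Qed.

(** The cosine comes out of a slice integral only if the slice is integrable, hence only for almost
    every [s]; this is why the integrands are compared almost everywhere. *)
Lemma cint_slice_cos x k :
  cint leb (fun s => slice x s * (cos (s * L) ^+ k)%:C) = 0.
Proof.
rewrite -[RHS](cint_pwave_cos x k) cint_fubini; last exact: cintble_pwave_cos.
have [m1 m2] := cint_slice_integrable (cintble_pwave_cos x k).
have [n1 n2] := cint_slice_integrable (cintble_pwave x).
have mc : measurable_fun setT (fun s : R => cos (s * L) ^+ k).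
  by apply: measurable_funX; exact: measurable_cosL.
have cm : cmeas (fun s => slice x s * (cos (s * L) ^+ k)%:C).
  apply: cmeasM; last exact: cmeas_real.
  split; apply/measurable_EFinP; [exact: (measurable_int leb n1)|exact: (measurable_int leb n2)].
have ae : \forall s \ae leb, slice x s * (cos (s * L) ^+ k)%:C =
    cint nu (fun w => Phi (w, s) * pwave w s x * (cos (s * L) ^+ k)%:C).
  apply: ae_imply slice_integrable_ae => s fs.
  rewrite mulrC -cintZ; last exact: cintble_slice.
  by apply: eq_cint => w; rewrite mulrC.
by apply: complex_ext; rewrite /= /Rintegral; congr fine; apply: ae_eq_integral => //;
  [apply/measurable_EFinP; case: cm|exact: (measurable_int leb m1)|
   apply: ae_imply ae => s es _; exact: (congr1 (fun t => (cRe t)%:E) es)|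
   apply/measurable_EFinP; case: cm|exact: (measurable_int leb m2)|
   apply: ae_imply ae => s es _; exact: (congr1 (fun t => (cIm t)%:E) es)].
Qed.

Hypothesis Phi_out : forall z, z.2 \notin `[0, tau] -> Phi z = 0.

Lemma slice_eq0 x : \forall s \ae leb, slice x s = 0.
Proof.
have [n1 n2] := cint_slice_integrable (cintble_pwave x).
have out s : s \notin `[0, tau] -> slice x s = 0.
  move=> st; rewrite (_ : (fun w => _) = (fun w => (0 : R)%:C)).
    by rewrite cint_real Rintegral_cst// mul0r.
  by apply/funext => w; rewrite Phi_out// mul0r.
have r0 : \forall s \ae leb, cRe (slice x s) = 0.
  apply: (cos_moments_eq0 q1) => // [s /out ->//|k].
  have := congr1 cRe (cint_slice_cos x k); rewrite cRe_cint => e; rewrite -[RHS]e.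
  by apply: eq_Rintegral => s _; rewrite cReM mulr0 subr0.
have i0 : \forall s \ae leb, cIm (slice x s) = 0.
  apply: (cos_moments_eq0 q1) => // [s /out ->//|k].
  have := congr1 cIm (cint_slice_cos x k); rewrite cIm_cint => e; rewrite -[RHS]e.
  by apply: eq_Rintegral => s _; rewrite cImM mulr0 add0r.
by apply: ae_imply (ae_and r0 i0) => s [a b]; exact: complex_ext.
Qed.

Lemma slice_cylinder_eq0 s x : cintble nu (fun w => Phi (w, s)) ->
  (forall x, slice x s = 0) ->
  cint nu (fun w => Phi (w, s) * (\1_(cylinder o x : set Om) w)%:C) = 0.
Proof.
move=> fs sx; have [->|xo] := eqVneq x o.
  rewrite -[RHS](sx o); apply: eq_cint => w.
  rewrite pwave_root indicE mem_set ?rmorph1//.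
  exact: cylinder_root.
have [p [xp po]] := closer_neighbour xo.
set c := wave q s (dist x o)%:R * (1 - wave q s (-2)).
(* [wave_step] can be solved for the indicator because [wave q s (-2)] has modulus [1 / q], so it is
   never 1. *)
have c0 : c != 0.
  apply/negP => /eqP /(congr1 (@ComplexField.Normc.normc R)).
  rewrite ComplexField.Normc.normcM normc_wave ComplexField.Normc.normc0 => /eqP.
  rewrite mulf_eq0 gt_eqF ?powR_gt0 ?qR_gt0//= => /eqP/ComplexField.Normc.eq0_normc.
  move=> /eqP; rewrite subr_eq0 => /eqP /(congr1 (@ComplexField.Normc.normc R)).
  rewrite ComplexField.Normc.normc1 normc_wave.
  have -> : -2 / 2 = -1 :> R by field.
  rewrite powR_inv1 ?ler0n// => /esym/eqP; rewrite invr_eq1 => /eqP q1'.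
  by have := qR_gt1 R q1; rewrite q1' ltxx.
have E w : Phi (w, s) * (\1_(cylinder o x : set Om) w)%:C =
    c^-1 * (Phi (w, s) * pwave w s x - wave q s (-1) * (Phi (w, s) * pwave w s p)).
  rewrite !pwave_wave (wave_step w s xp po) -/c.
  have cc : c^-1 * c = 1 by rewrite mulVf.
  by rewrite -[LHS]mul1r -cc; ring.
have ix := cintble_slice x fs; have ip := cintble_slice p fs.
rewrite (eq_cint _ E) cintZ ?cintB ?cintZ// ?sx ?mulr0 ?subr0 ?mulr0//.
- exact: cintbleZ.
- by apply: cintbleB => //; exact: cintbleZ.
Qed.

Lemma slice_ae_eq0 s : cintble nu (fun w => Phi (w, s)) ->
  (forall x, slice x s = 0) -> \forall w \ae nu, Phi (w, s) = 0.
Proof.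
move=> fs sx.
(* The empty set is adjoined as the intersection of disjoint cylinders; it does not change the
   generated sigma-algebra. The whole boundary is the cylinder of [o]. *)
pose G : set (set Om) := range (cylinder o) `|` [set set0].
have GI : setI_closed G.
  move=> A B [[x _ <-]|->]; last by move=> _; rewrite set0I; right.
  move=> [[y _ <-]|->]; last by rewrite setI0; right.
  by case: (cylinder_setI o x y) => [->|[->|->]];
    [right|left; exists x|left; exists y].
have mG : @measurable _ Om = <<s G >>.
  rewrite eqEsubset; split; apply: smallest_sub.
  - exact: smallest_sigma_algebra.
  - by move=> A [x _ <-]; apply: sub_gen_smallest; left; exists x.
  - exact: smallest_sigma_algebra.
  - move=> A [[x _ <-]|->]; first by apply: sub_gen_smallest; exists x.
    exact: measurable0.
have K (g : Om -> R) : nu.-integrable setT (EFin \o g) ->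
    (forall x, \int[nu]_w (g w * \1_(cylinder o x : set Om) w) = 0) ->
    \forall w \ae nu, g w = 0.
  move=> gi g0.
  have gx x : (\int[nu]_(w in (cylinder o x : set Om)) (EFin \o g) w = 0)%E.
    have gix : nu.-integrable (cylinder o x : set Om) (EFin \o g).
      by apply: integrableS gi => //; exact: measurable_cylinder.
    rewrite -[LHS]fineK; last first.
      by apply: (integrable_fin_num _ gix); exact: measurable_cylinder.
    rewrite [fine _](_ : _ = 0)//; rewrite -[RHS](g0 x).
    rewrite -/(Rintegral _ _ _) Rintegral_mkcond; apply: eq_Rintegral => w _.
    by rewrite /patch indicE; case: ifP => _; rewrite ?mulr1 ?mulr0.
  have := @integral_pi_system_eq0 _ _ R nu G (EFin \o g) mG GI gi.
  have Eo : (cylinder o o : set Om) = setT.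
    by apply/seteqP; split => // w _; exact: cylinder_root.
  have := gx o; rewrite Eo => gT /(_ gT) h.
  have : ae_eq nu setT (EFin \o g) (cst 0%E).
    by apply: h => A [[x _ <-]|->]; [exact: gx|rewrite integral_set0].
  by apply: ae_imply => w /(_ Logic.I) /= [].
have [f1 f2] := fs.
have r0 : \forall w \ae nu, cRe (Phi (w, s)) = 0.
  apply: K => // x; have := congr1 cRe (slice_cylinder_eq0 x fs sx); rewrite cRe_cint => e; rewrite -[RHS]e.
  by apply: eq_Rintegral => w _; rewrite cReM mulr0 subr0.
have i0 : \forall w \ae nu, cIm (Phi (w, s)) = 0.
  apply: K => // x; have := congr1 cIm (slice_cylinder_eq0 x fs sx); rewrite cIm_cint => e; rewrite -[RHS]e.
  by apply: eq_Rintegral => w _; rewrite cImM mulr0 add0r.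
by apply: ae_imply (ae_and r0 i0) => w [a b]; exact: complex_ext.
Qed.

Lemma waves_total : \forall z \ae M, Phi z = 0.
Proof.
have [e eP] := enum_vertices.
have sl : \forall s \ae leb, \forall w \ae nu, Phi (w, s) = 0.
  have all : \forall s \ae leb, forall n, slice (e n) s = 0.
    by apply: ae_foralln => n; exact: slice_eq0.
  apply: ae_imply (ae_and slice_integrable_ae all) => s [fs h].
  by apply: slice_ae_eq0 => // x; have [n <-] := eP x.
(* By Tonelli the integral of [|g|] is 0, which turns null slices into a null set of the product. *)
have K (g : Om * R -> R) : measurable_fun setT g ->
    (\forall s \ae leb, \forall w \ae nu, g (w, s) = 0) ->
    \forall z \ae M, g z = 0.
  move=> mg g0; have mE : measurable_fun setT (EFin \o g) by exact/measurable_EFinP.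
  have : ae_eq M setT (EFin \o g) (cst 0%E).
    apply/ae_eq_integral_abs => //.
    have ma : measurable_fun setT (abse \o (EFin \o g)) by exact: measurableT_comp.
    have a0 z : (0 <= (abse \o (EFin \o g)) z)%E by exact: abse_ge0.
    etransitivity; first exact: (@fubini_tonelli2 _ _ _ _ R nu leb _ ma a0).
    rewrite (ae_eq_integral (cst 0%E)) ?integral0//.
    - exact: measurable_fun_fubini_tonelli_G.
    - apply: ae_imply g0 => s gs _.
      rewrite /fubini_G (ae_eq_integral (cst 0%E)) ?integral0//.
      + apply: measurableT_comp => //; exact: measurable_fun_pair1.
      + by apply: ae_imply gs => w /= -> _; rewrite normr0.
  by apply: ae_imply => z /(_ Logic.I) /= [].
have mPhi := cintble_cmeas Phii.
have r0 : \forall z \ae M, cRe (Phi z) = 0.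
  apply: K; first by case: mPhi.
  by apply: ae_imply sl => s; apply: ae_imply => w ->.
have i0 : \forall z \ae M, cIm (Phi z) = 0.
  apply: K; first by case: mPhi.
  by apply: ae_imply sl => s; apply: ae_imply => w ->.
by apply: ae_imply (ae_and r0 i0) => z [a b]; exact: complex_ext.
Qed.

End Totality.

(** * Square-summable expansions in waves *)

Section FastLimit.
Context d (T : measurableType d) (R : realType).
Context (mu : {measure set T -> \bar R}).
Local Notation int_ h := (mu.-integrable setT (EFin \o h)).

Lemma cvg_of_abs_increments (u : R^nat) (B : R) :
  (forall n, \sum_(0 <= i < n) `|u i.+1 - u i| <= B) -> cvgn u.
Proof.
move=> uB; pose t := telescope u.
have ct : cvgn (series t).
  apply: normed_cvg; apply: nondecreasing_is_cvgn.
    apply/nondecreasing_seqP => n.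
    by rewrite -[leRHS]/(\sum_(0 <= k < n.+1) `|t k|) big_nat_recr//= lerDl.
  by exists B => _ [n _ <-]; exact: uB.
have -> : u = (fun n => u 0%N + series t n).
  by apply/funext => n; exact: eq_sum_telescope.
by apply: is_cvgD => //; exact: is_cvg_cst.
Qed.

Lemma sum_abs_increments (u : R^nat) n :
  `|u n| <= `|u 0%N| + \sum_(0 <= i < n) `|u i.+1 - u i|.
Proof.
elim: n => [|n ih]; first by rewrite big_geq// addr0.
rewrite big_nat_recr//= addrA; have := ler_normD (u n) (u n.+1 - u n).
by rewrite [u n + _]addrC subrK => /le_trans; apply; rewrite lerD2r.
Qed.

Lemma cvg_EFin_real (u : R^nat) (l : R) :
  u @ \oo --> l -> (fun n => (u n)%:E) @ \oo --> l%:E.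
Proof. by move=> ul; apply: cvg_EFin => //; exact: nearW. Qed.

Lemma sum_half_le (K : R) n : 0 <= K ->
  \sum_(0 <= i < n) K * 2^-1 ^+ i <= K * 2.
Proof.
move=> K0; rewrite -mulr_sumr ler_wpM2l//.
have -> : \sum_(0 <= i < n) 2^-1 ^+ i = 2 * (1 - 2^-1 ^+ n) :> R.
  elim: n => [|n ih]; first by rewrite big_geq// expr0 subrr mulr0.
  by rewrite big_nat_recr//= ih exprS; field.
by rewrite mulrBr mulr1 gerBl mulr_ge0// exprn_ge0.
Qed.

(** The Riesz-Fischer argument: the sum of the absolute increments is integrable, hence finite
    almost everywhere, and together with [|f 0|] it dominates the sequence. *)
Lemma L1_fast_limit (f : nat -> T -> R) (K : R) :
  (forall n, int_ (f n)) ->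
  (forall n, \int[mu]_t `|f n.+1 t - f n t| <= K * 2^-1 ^+ n) ->
  exists h : T -> R, [/\ int_ h,
    (forall t l, f ^~ t @ \oo --> l -> h t = l),
    (\forall t \ae mu, f ^~ t @ \oo --> h t) &
    (fun n => \int[mu]_t `|f n t - h t|) @ \oo --> (0 : R)].
Proof.
move=> fi fK.
have mf n : measurable_fun setT (f n) by apply/measurable_EFinP; exact: (measurable_int mu (fi n)).
pose dd n t : \bar R := `|f n.+1 t - f n t|%:E.
have md n : measurable_fun setT (dd n).
  by apply/measurable_EFinP; apply: measurableT_comp => //; exact: measurable_funB.
have d0 n t : (0 <= dd n t)%E by rewrite lee_fin.
pose g t := (\sum_(0 <= n <oo) dd n t)%E.
have g0 t : (0 <= g t)%E by apply: nneseries_ge0 => n _ _; exact: d0.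
have mg : measurable_fun setT g.
  by apply: ge0_emeasurable_sum => [k x _ _|k _]; [exact: d0|exact: md].
have di n : int_ (fun t => `|f n.+1 t - f n t|).
  apply: integrable_norm.
  have := integrableB measurableT (fi n.+1) (fi n).
  by apply: eq_integrable => // t _ /=; rewrite EFinB.
have gi : mu.-integrable setT g.
  apply/integrableP; split => //.
  under eq_integral do rewrite gee0_abs//.
  rewrite integral_nneseries//.
  have le_n n : (\int[mu]_t dd n t <= (K * 2^-1 ^+ n)%:E)%E.
    by rewrite -(fineK (integrable_fin_num measurableT (di n))) lee_fin; exact: fK.
  have K0 n : 0 <= K * 2^-1 ^+ n.
    by apply: le_trans (fK n); exact: Rintegral_ge0.
  apply: (@le_lt_trans _ _ (\sum_(0 <= n <oo) (K * 2^-1 ^+ n)%:E)%E).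
    apply: lee_nneseries => [n *|n *]; last exact: le_n.
    by apply: integral_ge0 => t _; exact: d0.
  apply: (@le_lt_trans _ _ (K * 2)%:E); last exact: ltry.
  apply: lime_le; first by apply: is_cvg_nneseries => n _ _; rewrite lee_fin.
  apply: nearW => n; rewrite sumEFin lee_fin sum_half_le//.
  by have := K0 0%N; rewrite expr0 mulr1.
have gfin := integrable_ae measurableT gi.
(* The upper limit gives a measurable function that agrees with the limit at every point where it
   exists; so the limit of the weighted sums will vanish everywhere off [[0, tau]]. *)
pose h t := fine (limn_esup (fun n => (f n t)%:E)).
have hlim t l : f ^~ t @ \oo --> l -> h t = l.
  move=> fl; have fl' : (fun n => (f n t)%:E) @ \oo --> l%:E by exact: cvg_EFin_real.
  rewrite /h is_cvg_limn_esupE; last by apply/cvg_ex; exists l%:E.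
  by rewrite (cvg_lim _ fl').
have fh : \forall t \ae mu, f ^~ t @ \oo --> h t.
  apply: ae_imply gfin => t /(_ Logic.I) gt.
  have : cvgn (f ^~ t).
    apply: (@cvg_of_abs_increments _ (fine (g t))) => n.
    rewrite -lee_fin fineK// -sumEFin.
    by apply: nneseries_lim_ge => i _ _; exact: d0.
  by move=> /cvg_ex[l fl]; rewrite (hlim _ _ fl).
have mh : measurable_fun setT h.
  apply: (measurableT_comp (@fine_measurable R setT measurableT)).
  by apply: measurable_fun_limn_esup => n; exact/measurable_EFinP.
have f0i : mu.-integrable setT (fun t => (`|f 0%N t|)%:E) by exact: (integrable_norm (fi 0%N)).
have := @dominated_convergence _ _ R mu setT measurableT (fun n t => (f n t)%:E)
  (fun t => (h t)%:E) (fun t => `|f 0%N t|%:E + g t)%E.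
case.
- by move=> n; exact/measurable_EFinP.
- exact/measurable_EFinP.
- by apply: ae_imply fh => t ft _; exact: cvg_EFin_real.
- exact: integrableD.
- apply: aeW => t n _; rewrite abse_EFin.
  apply: (@le_trans _ _ (`|f 0%N t| + \sum_(0 <= i < n) `|f i.+1 t - f i t|)%:E).
    by rewrite lee_fin sum_abs_increments.
  rewrite EFinD leeD2l// -sumEFin.
  by apply: nneseries_lim_ge => i _ _; exact: d0.
move=> hi L1 _; exists h; split => //.
have := L1; move=> /fine_cvgP[_].
by [].
Qed.

End FastLimit.

(** * Parseval's identity for finite sums of waves *)

Section L2Expansion.
Context (R : realType) (q : nat) (X : homTree q) (o : X).
Context (nu : probability (Omega o) R) (hnu : is_boundary_measure nu).
Local Notation C := R[i].
Local Notation leb := (@lebesgue_measure R).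
Local Notation tau := (tau q : R).
Local Notation M := (nu \x leb)%E.
Local Notation Om := (Omega o).
Local Notation wt z := (@weight R q z.2).
Implicit Types (x y : X) (s : R) (n k : nat) (z : Om * R) (A B F : {fset X}).
Let q1 := homTree_q X.

Definition normsq (f : Om * R -> C) : \bar R :=
  (\int[M]_z (normc (f z) ^+ 2 * wt z)%:E)%E.

Definition wsum (a : X -> C) A z : C := \sum_(x <- A) a x * mwave z.1 z.2 x.

Lemma cmeas_lincomb (b : X -> C) (t : seq X) :
  cmeas (fun z => \sum_(x <- t) b x * mwave z.1 z.2 x).
Proof.
by apply: cmeas_sum => x; apply: cmeasM; [exact: cmeas_cst|exact: cmeas_mwave].
Qed.

Lemma cintble_mp (c : C) x y :
  cintble M (fun z => c * (pwave z.1 z.2 y * mwave z.1 z.2 x * (wt z)%:C)).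
Proof. by apply: cintbleZ; exact: cintble_pm. Qed.

Lemma lincomb_sqE (b : X -> C) (t : seq X) z :
  (normc (\sum_(x <- t) b x * mwave z.1 z.2 x) ^+ 2 * wt z)%:C =
  \sum_(x <- t) \sum_(y <- t)
    (b x * conjc (b y)) * (pwave z.1 z.2 y * mwave z.1 z.2 x * (wt z)%:C).
Proof.
rewrite rmorphM /= -conjc_mul_normc rmorph_sum /= big_distrlr /= mulr_suml.
apply: eq_bigr => x _; rewrite mulr_suml; apply: eq_bigr => y _.
rewrite -!/(conjc _) conjcM mwave_conj; ring.
Qed.

Lemma normsq_lincomb (b : X -> C) (t : seq X) : uniq t ->
  normsq (fun z => \sum_(x <- t) b x * mwave z.1 z.2 x) =
  (\sum_(x <- t) normc (b x) ^+ 2)%:E.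
Proof.
move=> ut; set S := fun z => _.
have I x : cintble M (fun z => \sum_(y <- t)
    (b x * conjc (b y)) * (pwave z.1 z.2 y * mwave z.1 z.2 x * (wt z)%:C)).
  by apply: cintble_sum => y; exact: cintble_mp.
have Si : cintble M (fun z => (normc (S z) ^+ 2 * wt z)%:C).
  rewrite (_ : (fun z => _) = (fun z => \sum_(x <- t) \sum_(y <- t)
    (b x * conjc (b y)) * (pwave z.1 z.2 y * mwave z.1 z.2 x * (wt z)%:C))).
    exact: cintble_sum.
  by apply/funext => z; exact: lincomb_sqE.
have E : cint M (fun z => (normc (S z) ^+ 2 * wt z)%:C) =
    (\sum_(x <- t) normc (b x) ^+ 2)%:C.
  rewrite (eq_cint M (lincomb_sqE b t)) cint_sum// rmorph_sum /=.
  apply: eq_big_seq => x xt; rewrite cint_sum; last by move=> y; exact: cintble_mp.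
  rewrite (bigD1_seq x)//= big1_seq ?addr0.
    rewrite cintZ; last exact: cintble_pm.
    by rewrite waves_orthonormal// eqxx mulr1 conjc_mul_normc.
  move=> y /andP[yx _]; rewrite cintZ; last exact: cintble_pm.
  by rewrite waves_orthonormal// (negbTE yx) mulr0.
have [Sr _] := Si.
rewrite /normsq -(fineK (integrable_fin_num measurableT Sr)); congr EFin.
by have := congr1 cRe E; rewrite cRe_cint.
Qed.

Lemma wsum_widen (a : X -> C) A B z : (A `<=` B)%fset ->
  wsum a A z = \sum_(x <- B) (a x * (x \in A)%:R) * mwave z.1 z.2 x.
Proof.
move=> AB; rewrite -(big_fset_incl _ AB).
  by apply: eq_big_seq => x xA; rewrite xA mulr1.
by move=> x _ /negbTE ->; rewrite mulr0 mul0r.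
Qed.

(** The difference has coefficients [a x] times 0, 1 or -1, all zero on [F]; Parseval bounds it by
    the tail outside [F]. *)
Lemma normsq_diff_le (a : X -> C) (eps : R) F A B :
  (forall D : {fset X}, (forall x, x \in D -> x \notin F) ->
    \sum_(x <- D) normc (a x) ^+ 2 <= eps) ->
  (F `<=` A)%fset -> (F `<=` B)%fset ->
  (normsq (fun z => wsum a A z - wsum a B z)%R <= eps%:E)%E.
Proof.
move=> tail FA FB; set U := (A `|` B)%fset.
have E z : wsum a A z - wsum a B z =
    \sum_(x <- U) (a x * ((x \in A)%:R - (x \in B)%:R)) * mwave z.1 z.2 x.
  rewrite (@wsum_widen a A U) ?fsubsetUl// (@wsum_widen a B U) ?fsubsetUr//.
  rewrite -sumrB; apply: eq_bigr => x _; ring.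
rewrite (_ : (fun z => _) = (fun z => \sum_(x <- U)
    (a x * ((x \in A)%:R - (x \in B)%:R)) * mwave z.1 z.2 x)); last first.
  by apply/funext => z.
rewrite normsq_lincomb ?fset_uniq// lee_fin.
apply: le_trans (tail (U `\` F)%fset _); last by move=> x; rewrite in_fsetD => /andP[].
rewrite -(@big_fset_incl _ _ _ _ (U `\` F)%fset U)/=; last 2 first.
- exact: fsubsetDl.
- move=> x xU; rewrite in_fsetD xU andbT negbK => xF.
  by rewrite (fsubsetP FA _ xF) (fsubsetP FB _ xF) subrr mulr0 ComplexField.Normc.normc0 expr0n.
apply: ler_sum => x _; rewrite ComplexField.Normc.normcM exprMn.
rewrite -[leRHS]mulr1 ler_wpM2l ?sqr_ge0//.
case: (x \in A); case: (x \in B); rewrite ?subrr ?subr0 ?sub0r ?ComplexField.Normc.normc0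
  ?normcN ?ComplexField.Normc.normc1 ?expr0n ?expr1n ?ler01//.
Qed.

End L2Expansion.

(** * The limit of the partial sums of waves *)

Section L2Limit.
Context (R : realType) (q : nat) (X : homTree q) (o : X).
Context (nu : probability (Omega o) R) (hnu : is_boundary_measure nu).
Local Notation C := R[i].
Local Notation leb := (@lebesgue_measure R).
Local Notation tau := (tau q : R).
Local Notation M := (nu \x leb)%E.
Local Notation Om := (Omega o).
Local Notation wt z := (@weight R q z.2).
Implicit Types (x y : X) (s : R) (n k : nat) (z : Om * R) (A B F : {fset X}).
Let q1 := homTree_q X.

Context (a : X -> C).
Hypothesis a_tail : forall eps : R, 0 < eps -> exists F, forall D : {fset X},
  (forall x, x \in D -> x \notin F) -> \sum_(x <- D) normc (a x) ^+ 2 <= eps.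

Local Notation S A := (@wsum R q X o a A).

Lemma fast_exhaustion : exists A_ : nat -> {fset X},
  [/\ forall m n, (m <= n)%N -> (A_ m `<=` A_ n)%fset,
      forall k A B, (A_ k `<=` A)%fset -> (A_ k `<=` B)%fset ->
        (normsq nu (fun z => S A z - S B z)%R <= (4^-1 ^+ k)%:E)%E &
      forall x, exists N, forall n, (N <= n)%N -> x \in A_ n].
Proof.
have e4 k : 0 < 4^-1 ^+ k :> R by rewrite exprn_gt0.
pose F k := sval (cid (a_tail (e4 k))).
have FP k := svalP (cid (a_tail (e4 k))).
(* The sets [F k] only control tails and may miss vertices; the balls ensure that every vertex is
   eventually included. *)
pose b k : {fset X} := fset_set [set x | (dist x o <= k)%N].
pose A_ := fix A_ n := match n with
  | 0%N => (F 0%N `|` b 0%N)%fset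
  | n.+1 => (A_ n `|` (F n.+1 `|` b n.+1))%fset end.
have A_S n : (A_ n `<=` A_ n.+1)%fset by rewrite /= fsubsetUl.
have A_mono m n : (m <= n)%N -> (A_ m `<=` A_ n)%fset.
  move=> mn; rewrite -(subnKC mn); elim: (n - m)%N => [|j ih].
    by rewrite addn0 fsubset_refl.
  by rewrite addnS; apply: fsubset_trans ih (A_S _).
have FA k : (F k `<=` A_ k)%fset.
  case: k => [|k]; first by rewrite /= fsubsetUl.
  by rewrite /= fsubsetU// fsubsetUl orbT.
have bA k : (b k `<=` A_ k)%fset.
  case: k => [|k]; first by rewrite /= fsubsetUr.
  by rewrite /= fsubsetU// fsubsetUr orbT.
exists A_; split => //.
- move=> k A B kA kB; apply: (normsq_diff_le hnu (FP k)).
    exact: fsubset_trans (FA k) kA.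
  exact: fsubset_trans (FA k) kB.
- move=> x; exists (dist x o) => n xn; apply: (fsubsetP (A_mono _ _ xn)).
  apply: (fsubsetP (bA _)); rewrite in_fset_set; last exact: finite_ball.
  by apply: mem_set => /=; exact: leqnn.
Qed.

Lemma normc_wsum_bounded A : exists2 B : R, 0 <= B &
  forall z, normc (S A z) <= B.
Proof.
exists (\sum_(x <- A) normc (a x) * wave_bound R o x).
  by apply: sumr_ge0 => x _; rewrite mulr_ge0 ?normc_ge0 ?powR_ge0.
move=> z; rewrite /wsum; elim/big_rec2: _ => [|x B y _ yB].
  by rewrite ComplexField.Normc.normc0.
apply: le_trans (normc_triangle _ _) _; rewrite lerD//.
rewrite ComplexField.Normc.normcM ler_wpM2l ?normc_ge0//.
exact: normc_mwave_le.
Qed.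

Lemma cmeas_wsum A : cmeas (S A).
Proof. exact: cmeas_lincomb. Qed.

Lemma integrable_bounded_weight (g : Om * R -> R) (B : R) :
  measurable_fun setT g -> (forall z, `|g z| <= B) ->
  M.-integrable setT (EFin \o (fun z => g z * wt z)).
Proof.
move=> mg gB; have [+ _] := @cintble_bounded_weight R q X o nu
  (fun z => (g z)%:C) B (cmeas_real mg) (fun z => eq_ind_r (fun t => t <= B) (gB z) (normc_real _)).
by apply: eq_integrable => // z _ /=; rewrite mulr0 subr0.
Qed.

Let V : R := \int[M]_z (wt z).

Lemma integral_diff_le k A B :
  (normsq nu (fun z => S A z - S B z)%R <= (4^-1 ^+ k)%:E)%E ->
  M.-integrable setT (EFin \o (fun z => normc (S A z - S B z) * wt z)) /\
  \int[M]_z (normc (S A z - S B z) * wt z) <= (1 + V) * 2^-1 ^+ k.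
Proof.
move=> h; have [BA BA0 SA] := normc_wsum_bounded A.
have [BB BB0 SB] := normc_wsum_bounded B.
have dB z : normc (S A z - S B z) <= BA + BB.
  by rewrite (le_trans (normc_triangle _ _))// normcN lerD.
have md : cmeas (fun z => S A z - S B z) by apply: cmeasB; exact: cmeas_wsum.
have i1 : M.-integrable setT (EFin \o (fun z => normc (S A z - S B z) * wt z)).
  apply: (@integrable_bounded_weight _ (BA + BB)); first exact: measurable_normc.
  by move=> z; rewrite ger0_norm ?normc_ge0.
have i2 : M.-integrable setT (EFin \o (fun z => normc (S A z - S B z) ^+ 2 * wt z)).
  apply: (@integrable_bounded_weight _ ((BA + BB) ^+ 2)).
    exact: measurable_normc_sqr.
  move=> z; rewrite ger0_norm ?sqr_ge0// ler_pXn2r ?nnegrE ?normc_ge0//.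
  by rewrite addr_ge0.
have h2 : \int[M]_z (normc (S A z - S B z) ^+ 2 * wt z) <= 4^-1 ^+ k.
  rewrite -lee_fin; apply: le_trans h; rewrite /normsq.
  by rewrite (fineK (integrable_fin_num measurableT i2)).
split=> //.
have iw := @integrable_weight R q X o nu.
(* This value balances the two terms: [4 ^ -k * 2 ^ k] and [V * 2 ^ -k] are both of order
   [2 ^ -k]. *)
pose r : R := 2 ^+ k.
have r0 : 0 < r by rewrite exprn_gt0.
have ir : M.-integrable setT (EFin \o (fun z =>
    normc (S A z - S B z) ^+ 2 * wt z * r + wt z * r^-1)).
  by apply: integrable_add; exact: integrable_mulr.
(* AM-GM: [t <= t ^ 2 * r + 1 / r] *)
apply: (@le_trans _ _ (\int[M]_z (normc (S A z - S B z) ^+ 2 * wt z * r + wt z * r^-1))).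
  apply: le_Rintegral => // z _.
  move: (wt z) (weight_ge0 X z.2) (normc _) => w w0 t.
  have -> : t ^+ 2 * w * r + w * r^-1 = (t ^+ 2 * r + r^-1) * w by ring.
  rewrite ler_wpM2r// -subr_ge0.
  have -> : t ^+ 2 * r + r^-1 - t = r * ((t - (2 * r)^-1) ^+ 2 + 3 / 4 * r^-1 ^+ 2).
    by field; rewrite gt_eqF.
  by rewrite mulr_ge0 ?(ltW r0)// addr_ge0 ?sqr_ge0// mulr_ge0 ?sqr_ge0// divr_ge0.
rewrite RintegralD//; [|exact: integrable_mulr|exact: integrable_mulr].
rewrite !RintegralZr// -/V mulrDl mul1r /r -exprVn lerD2r.
apply: le_trans (ler_wpM2r (ltW r0) h2) _.
by rewrite /r -exprMn; have -> : 4^-1 * 2 = 2^-1 :> R by field.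
Qed.

Lemma wsum_limit (A_ : nat -> {fset X}) :
  (forall m n, (m <= n)%N -> (A_ m `<=` A_ n)%fset) ->
  (forall k A B, (A_ k `<=` A)%fset -> (A_ k `<=` B)%fset ->
        (normsq nu (fun z => S A z - S B z)%R <= (4^-1 ^+ k)%:E)%E) ->
  exists H : Om * R -> C, [/\ cintble M H,
    forall z, z.2 \notin `[0, tau] -> H z = 0,
    \forall z \ae M,
      (fun n => cRe (S (A_ n) z) * wt z) @ \oo --> cRe (H z) /\
      (fun n => cIm (S (A_ n) z) * wt z) @ \oo --> cIm (H z) &
    forall x, (fun n => normc (cint M (fun z =>
      (S (A_ n) z * (wt z)%:C - H z) * pwave z.1 z.2 x))) @ \oo --> (0 : R)].
Proof.
move=> mono small.
have mw : measurable_fun setT (fun z : Om * R => wt z) by exact: measurable_weight2.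
have K n : (normsq nu (fun z => S (A_ n.+1) z - S (A_ n) z)%R <= (4^-1 ^+ n)%:E)%E.
  by apply: small => //; exact: mono.
have [B BP] : exists B : nat -> R, forall n z, normc (S (A_ n) z) <= B n.
  exists (fun n => sval (cid2 (normc_wsum_bounded (A_ n)))) => n.
  by case: cid2.
(* To be used with [cRe] and [cIm] in the role of [c]. *)
have L1 (c : C -> R) : (forall u, `|c u| <= normc u) ->
    (forall u v, c (u - v) = c u - c v) ->
    (forall A, measurable_fun setT (fun z => c (S A z))) ->
    exists h : Om * R -> R, [/\ M.-integrable setT (EFin \o h),
    (forall z l, (fun n => c (S (A_ n) z) * wt z) @ \oo --> l -> h z = l),
    (\forall z \ae M, (fun n => c (S (A_ n) z) * wt z) @ \oo --> h z) &
    (fun n => \int[M]_z `|c (S (A_ n) z) * wt z - h z|) @ \oo --> (0 : R)].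
  move=> cn cB mc.
  apply: (@L1_fast_limit _ _ R M (fun n z => c (S (A_ n) z) * wt z) (1 + V)).
    move=> n; apply: (@integrable_bounded_weight _ (B n)) => // z.
    exact: le_trans (cn _) (BP n z).
  move=> n; have [i1 le1] := integral_diff_le (K n).
  apply: le_trans le1; apply: le_Rintegral => //.
    apply: (integrable_le _ _ i1).
      apply: measurableT_comp => //; apply: measurable_funB; apply: measurable_funM;
        [exact: mc|exact: mw|exact: mc|exact: mw].
    move=> z; rewrite /= -mulrBl -cB ger0_norm ?normr_ge0// normrM (ger0_norm (weight_ge0 X _)).
    by rewrite ler_wpM2r ?weight_ge0.
  move=> z _; rewrite /= -mulrBl -cB normrM (ger0_norm (weight_ge0 X _)).
  by rewrite ler_wpM2r ?weight_ge0.
have [hr [hri hrl hrae hr0]] := L1 cRe (@cRe_le_normc R) (@cReB R) (fun A => (cmeas_wsum A).1).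
have [hi [hii hil hiae hi0]] := L1 cIm (@cIm_le_normc R) (@cImB R) (fun A => (cmeas_wsum A).2).
exists (fun z => hr z +i* hi z); split => //.
- move=> z zt; apply: complex_ext => /=.
    by apply: hrl; rewrite weight_out//; under eq_fun do rewrite mulr0; exact: cvg_cst.
  by apply: hil; rewrite weight_out//; under eq_fun do rewrite mulr0; exact: cvg_cst.
- exact: ae_and hrae hiae.
move=> x.
have Hi : cintble M (fun z => hr z +i* hi z) by [].
have Sw n : cintble M (fun z => S (A_ n) z * (wt z)%:C).
  by apply: (@cintble_bounded_weight R q X o nu _ (B n) (cmeas_wsum _) (BP n)).
have Di n : cintble M (fun z => S (A_ n) z * (wt z)%:C - (hr z +i* hi z)).
  exact: cintbleB.
pose v n z := `|cRe (S (A_ n) z) * wt z - hr z| + `|cIm (S (A_ n) z) * wt z - hi z|.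
have iv1 n : M.-integrable setT (EFin \o (fun z => `|cRe (S (A_ n) z) * wt z - hr z|)).
  have [d1 _] := Di n; have := integrable_norm d1.
  by apply: eq_integrable => // z _ /=; rewrite cReB cReM /= mulr0 subr0.
have iv2 n : M.-integrable setT (EFin \o (fun z => `|cIm (S (A_ n) z) * wt z - hi z|)).
  have [_ d2] := Di n; have := integrable_norm d2.
  by apply: eq_integrable => // z _ /=; rewrite cImB cImM /= mulr0 add0r.
have vi n : M.-integrable setT (EFin \o (fun z => v n z * wave_bound R o x)).
  by apply: integrable_mulr; exact: integrable_add.
have bound n : normc (cint M (fun z => (S (A_ n) z * (wt z)%:C - (hr z +i* hi z)) * pwave z.1 z.2 x))
   <= 2 * ((\int[M]_z `|cRe (S (A_ n) z) * wt z - hr z| + \int[M]_z `|cIm (S (A_ n) z) * wt z - hi z|) * wave_bound R o x).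
  rewrite -RintegralD// -RintegralZr//; last exact: integrable_add.
  apply: normc_cint_le; [|exact: (vi n)|].
    apply: (cintbleM_bounded (Di n) (cmeas_pwave _ _ _)) => z; exact: normc_pwave_le.
  move=> z; rewrite ComplexField.Normc.normcM ler_pM ?normc_ge0//; last exact: normc_pwave_le.
  apply: le_trans (normc_le_ReIm _) _.
  by rewrite cReB cImB cReM cImM /= !mulr0 subr0 add0r.
have z0 : (fun n => 2 * ((\int[M]_z `|cRe (S (A_ n) z) * wt z - hr z| + \int[M]_z `|cIm (S (A_ n) z) * wt z - hi z|) * wave_bound R o x)) @ \oo --> (2 * ((0 + 0) * wave_bound R o x) : R).
  by apply: cvgM; [exact: cvg_cst|apply: cvgM; [exact: cvgD|exact: cvg_cst]].
rewrite addr0 mul0r mulr0 in z0.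
apply: (squeeze_cvgr _ (cvg_cst 0) z0).
by apply: nearW => n; rewrite normc_ge0 bound.
Qed.

End L2Limit.

(** * Expansion of an integrable function with square-summable coefficients *)

Section WaveExpansion.
Context (R : realType) (q : nat) (X : homTree q) (o : X).
Context (nu : probability (Omega o) R) (hnu : is_boundary_measure nu).
Local Notation C := R[i].
Local Notation leb := (@lebesgue_measure R).
Local Notation tau := (tau q : R).
Local Notation M := (nu \x leb)%E.
Local Notation Om := (Omega o).
Local Notation wt z := (@weight R q z.2).
Implicit Types (x y : X) (s : R) (n k : nat) (z : Om * R) (A B F : {fset X}).
Let q1 := homTree_q X.

Context (a : X -> C).
Hypothesis a_tail : forall eps : R, 0 < eps -> exists F, forall D : {fset X},
  (forall x, x \in D -> x \notin F) -> \sum_(x <- D) normc (a x) ^+ 2 <= eps.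
Context (G : Om * R -> C) (mG : cmeas G).
Hypothesis G_integrable : cintble M (fun z => G z * (wt z)%:C).
Hypothesis G_coef : forall x,
  cint M (fun z => G z * (wt z)%:C * pwave z.1 z.2 x) = a x.

Local Notation S A := (@wsum R q X o a A).

Lemma wsum_pwaveE A x z : S A z * (wt z)%:C * pwave z.1 z.2 x =
  \sum_(y <- A) a y * (pwave z.1 z.2 x * mwave z.1 z.2 y * (wt z)%:C).
Proof.
by rewrite /wsum !mulr_suml; apply: eq_bigr => y _; ring.
Qed.

Lemma wsum_coef A x : x \in A ->
  cint M (fun z => S A z * (wt z)%:C * pwave z.1 z.2 x) = a x.
Proof.
move=> xA; rewrite (eq_cint M (wsum_pwaveE A x)) cint_sum; last first.
  by move=> y; exact: cintble_mp.
rewrite (bigD1_seq x) ?fset_uniq//= big1_seq ?addr0.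
  by rewrite cintZ ?waves_orthonormal ?eqxx ?mulr1//; exact: cintble_pm.
move=> y /andP[yx _]; rewrite cintZ; last exact: cintble_pm.
by rewrite waves_orthonormal// eq_sym (negbTE yx) mulr0.
Qed.

Lemma wave_expansion : exists A_ : nat -> {fset X},
  [/\ forall x, exists N, forall n, (N <= n)%N -> x \in A_ n,
      \forall z \ae M, wt z != 0 ->
        (fun n => cRe (S (A_ n) z)) @ \oo --> cRe (G z) /\
        (fun n => cIm (S (A_ n) z)) @ \oo --> cIm (G z) &
      forall k A, (A_ k `<=` A)%fset ->
        (normsq nu (fun z => G z - S A z)%R <= (4^-1 ^+ k)%:E)%E].
Proof.
have [A_ [mono small exh]] := fast_exhaustion hnu a_tail.
have [H [Hi Hout Hae Hcoef]] := wsum_limit mono small.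
have Sw n : cintble M (fun z => S (A_ n) z * (wt z)%:C).
  have [B _ BP] := normc_wsum_bounded o a (A_ n).
  exact: (@cintble_bounded_weight R q X o nu _ B (cmeas_wsum _ _ _) BP).
have pw f x : cintble M f -> cintble M (fun z => f z * pwave z.1 z.2 x).
  by move=> fi; exact: cintble_pwave.
(* The coefficient of the partial sums at [x] equals [a x] as soon as their index set contains [x],
   and coefficients are continuous for the L^1 limit. *)
have HC x : cint M (fun z => H z * pwave z.1 z.2 x) = a x.
  have [N NP] := exh x.
  have E n : (N <= n)%N -> cint M (fun z => (S (A_ n) z * (wt z)%:C - H z) * pwave z.1 z.2 x) =
      a x - cint M (fun z => H z * pwave z.1 z.2 x).
    move=> /NP xA; rewrite -(wsum_coef xA) -cintB; [|exact: pw|exact: pw].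
    by apply: eq_cint => z; rewrite mulrBl.
  have c : (fun n => normc (cint M (fun z => (S (A_ n) z * (wt z)%:C - H z) * pwave z.1 z.2 x)))
      @ \oo --> normc (a x - cint M (fun z => H z * pwave z.1 z.2 x)).
    by apply: cvg_near_cst; exists N => // n Nn; rewrite (E n Nn).
  have e0 : normc (a x - cint M (fun z => H z * pwave z.1 z.2 x)) = 0.
    by rewrite -(cvg_lim (@norm_hausdorff _ _) c) (cvg_lim (@norm_hausdorff _ _) (Hcoef x)).
  by have /eqP := ComplexField.Normc.eq0_normc e0; rewrite subr_eq0 => /eqP.
have HG : \forall z \ae M, G z * (wt z)%:C - H z = 0.
  apply: (@waves_total _ _ _ _ _ (fun z => G z * (wt z)%:C - H z)).
  - exact: cintbleB.
  - move=> x; have E z : (G z * (wt z)%:C - H z) * pwave z.1 z.2 x =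
        G z * (wt z)%:C * pwave z.1 z.2 x - H z * pwave z.1 z.2 x by rewrite mulrBl.
    by rewrite (eq_cint M E) cintB ?G_coef ?HC ?subrr//; exact: pw.
  - by move=> z zt; rewrite (weight_out zt) Hout// mulr0 subrr.
have lim : \forall z \ae M, wt z != 0 ->
        (fun n => cRe (S (A_ n) z)) @ \oo --> cRe (G z) /\
        (fun n => cIm (S (A_ n) z)) @ \oo --> cIm (G z).
  apply: ae_imply (ae_and Hae HG) => z [[hr hi]] /eqP; rewrite subr_eq0 => /eqP e w0.
  have cancel (u : nat -> R) l : (fun n => u n * wt z) @ \oo --> l * wt z ->
      u @ \oo --> l.
    move=> c; have -> : u = (fun n => u n * wt z * (wt z)^-1).
      by apply/funext => n; rewrite mulfK.
    by rewrite -[l](mulfK w0); apply: cvgM c (cvg_cst _).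
  split; apply: cancel.
    by move: hr; rewrite -e cReM /= mulr0 subr0.
  by move: hi; rewrite -e cImM /= mulr0 add0r.
exists A_; split => // k A kA.
(* The shift by [k] makes every index set contain [A_ k], so [small] bounds all these integrals and
   Fatou's lemma passes the bound to [G]. *)
pose g n z := (normc (S (A_ (n + k)%N) z - S A z) ^+ 2 * wt z)%:E.
have mS B : cmeas (S B) by exact: cmeas_wsum.
have mw : measurable_fun setT (fun z : Om * R => wt z) by exact: measurable_weight2.
have mg n : measurable_fun setT (g n).
  apply/measurable_EFinP; apply: measurable_funM; last exact: mw.
  by apply: measurable_normc_sqr; exact: cmeasB.
have g0 n z : setT z -> (0 <= g n z)%E.
  by move=> _; rewrite lee_fin mulr_ge0 ?sqr_ge0// (weight_ge0 X).
(* Where the weight vanishes, convergence of the partial sums is unknown, but both sides are 0. *)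
have lE : \forall z \ae M,
    limn_einf (g ^~ z) = (normc (G z - S A z) ^+ 2 * wt z)%:E.
  apply: ae_imply lim => z hz.
  have c : g ^~ z @ \oo --> (normc (G z - S A z) ^+ 2 * wt z)%:E.
    apply: cvg_EFin_real; have [w0|w0] := eqVneq (wt z) 0.
      by rewrite w0 mulr0; under eq_fun do rewrite mulr0; exact: cvg_cst.
    have [hr hi] := hz w0; apply: cvgM; last exact: cvg_cst.
    rewrite normc_sqr cReB cImB; under eq_fun do rewrite normc_sqr cReB cImB !expr2.
    rewrite !expr2.
    move: hr hi; rewrite -(cvg_shiftn k) => hr; rewrite -(cvg_shiftn k) => hi.
    by apply: cvgD; apply: cvgM; apply: cvgB => //; exact: cvg_cst.
  rewrite is_cvg_limn_einfE; last by apply/cvg_ex; eexists; exact: c.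
  by rewrite (cvg_lim _ c).
have -> : normsq nu (fun z => G z - S A z) = (\int[M]_z limn_einf (g ^~ z))%E.
  apply: ae_eq_integral => //.
  - apply/measurable_EFinP; apply: measurable_funM; last exact: mw.
    by apply: measurable_normc_sqr; exact: (cmeasB mG (mS A)).
  - apply: (measurableT_comp (@oppe_measurable R setT)); apply: measurable_fun_limn_esup => n.
    exact: (measurableT_comp (@oppe_measurable R setT) (mg n)).
  - by apply: ae_imply lE => z e _; exact: esym e.
have ft := @fatou _ _ R M setT measurableT g mg g0.
apply: (le_trans ft).
rewrite limn_einf_lim; apply: lime_le; first exact: is_cvg_einfs.
apply: nearW => n; apply: (@le_trans _ _ (\int[M]_z g n z)%E).
  by apply: ereal_inf_lbound; exists n => //=.
by apply: small kA; apply: mono; exact: leq_addl.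
Qed.

End WaveExpansion.

(** * The symbol of the adjoint *)

Section L2Delta.
Context (R : realType) (T : choiceType).
Local Notation C := R[i].
Local Notation L2 := (L2 R T).

Lemma sqsummable_delta (x : T) : (fun t : T => (t == x)%:R : C) \in @sqsummable R T.
Proof.
apply/asboolP; rewrite /sqsum.
rewrite (_ : (\esum_(t in [set: T]) _)%E =
    (\esum_(t in [set x]) (normc ((t == x)%:R : C) ^+ 2)%:E)%E).
  rewrite esum_set1 ?ltry// lee_fin sqr_ge0//.
rewrite [RHS]esum_mkcond; apply: eq_esum => t _; case: ifPn => // /negP tx.
rewrite (_ : (t == x) = false) ?ComplexField.Normc.normc0 ?expr0n//.
by apply/eqP => tx'; apply: tx; rewrite mem_set.
Qed.

Definition delta (x : T) : L2 := MkL2 (sqsummable_delta x).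

Lemma deltaE x t : delta x t = (t == x)%:R. Proof. by []. Qed.

Lemma delta_support x : [set t | delta x t != 0] = [set x].
Proof.
apply/seteqP; split => t /=; first by case: (eqVneq t x) => //; rewrite eqxx.
by move=> ->; rewrite eqxx oner_neq0.
Qed.

Lemma cvg_partial_sum_single (u : T -> C^o) (x : T) :
  (forall t, t != x -> u t = 0) ->
  summability.partial_sum u @ summability.totally --> u x.
Proof.
move=> u0; apply: cvg_near_cst.
exists [fset x]%fset => // A /= xA.
rewrite /summability.partial_sum -(big_seq_fsetE _ A predT u).
have xA' : x \in A by apply: (fsubsetP xA); rewrite inE.
by rewrite (bigD1_seq x) ?fset_uniq//= big1 ?addr0// => t /andP[_ /u0].
Qed.

Lemma l2inner_deltar (f : L2) x : l2inner f (delta x) = f x.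
Proof.
rewrite /l2inner; apply: (@cvg_lim C^o (@norm_hausdorff _ _)).
have -> : f x = f x * conjc (delta x x) by rewrite deltaE eqxx rmorph1 mulr1.
apply: cvg_partial_sum_single => t tx.
by rewrite deltaE (negbTE tx) rmorph0 mulr0.
Qed.

Lemma l2inner_deltal (f : L2) x : l2inner (delta x) f = conjc (f x).
Proof.
rewrite /l2inner; apply: (@cvg_lim C^o (@norm_hausdorff _ _)).
have -> : conjc (f x) = delta x x * conjc (f x) by rewrite deltaE eqxx mul1r.
apply: cvg_partial_sum_single => t tx.
by rewrite deltaE (negbTE tx) mul0r.
Qed.

(** A finite set that attains the supremum defining [sqsum] up to [eps] leaves at most [eps] for any
    disjoint finite set. *)
Lemma L2_tail (f : L2) (eps : R) : 0 < eps -> exists F : {fset T},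
  forall D : {fset T}, (forall x, x \in D -> x \notin F) ->
    \sum_(x <- D) normc (f x) ^+ 2 <= eps.
Proof.
move=> e0; have fin := sqsum_fin f.
have ub (r : seq T) : uniq r -> \sum_(x <- r) normc (f x) ^+ 2 <= fine (sqsum f).
  move=> ur; rewrite -lee_fin fineK//; apply: esum_ge; exists [set` r].
    by split => //; exact: finite_seq.
  by rewrite -fsbig_seq// sumEFin.
have [v [F0 [finF _] vE] hv] := ub_ereal_sup_adherent e0 fin.
have hF : (sqsum f - eps%:E < v)%E by exact: hv.
rewrite -(fineK fin) -EFinB -vE in hF.
exists (fset_set F0) => D DF.
have hF' : fine (sqsum f) - eps < \sum_(x <- fset_set F0) normc (f x) ^+ 2.
  by rewrite -lte_fin -sumEFin -(fsbig_finite _ _ finF).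
have ur : uniq (fset_set F0 ++ D).
  rewrite cat_uniq !fset_uniq andbT /=; apply/hasPn => x xD.
  exact: DF.
have := ub _ ur; rewrite big_cat /= => h.
by move: hF' h; clear; lra.
Qed.

End L2Delta.

(** * Plancherel integrals as weighted integrals *)

Section PlancherelIntegral.
Context (R : realType) (q : nat) (X : homTree q) (o : X).
Context (nu : probability (Omega o) R).
Local Notation C := R[i].
Local Notation leb := (@lebesgue_measure R).
Local Notation tau := (tau q : R).
Local Notation M := (nu \x leb)%E.
Local Notation Om := (Omega o).
Local Notation wt z := (@weight R q z.2).
Local Notation dom := (@Defs.dom R q X o).
Implicit Types (x y : X) (s : R) (z : Om * R) (F : Om -> R -> C).

Lemma domE z : (z \in dom) = (z.2 \in `[0, tau]).
Proof.
by apply/idP/idP => [/set_mem[]//|zt]; rewrite mem_set//; split.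
Qed.

Lemma measurable_dom : measurable dom.
Proof. exact: measurableX. Qed.

Lemma weighted_patch (f : Om * R -> R) z :
  ((fun p => f p * plancherel_density q p.2) \_ dom) z = f z * wt z.
Proof.
rewrite /patch domE; case: ifPn => zt; first by rewrite weight_in.
by rewrite weight_out// mulr0.
Qed.

Lemma pl_integrable_cintble F : pl_integrable nu F <->
  cintble M (fun z => F z.1 z.2 * (wt z)%:C).
Proof.
have K (f : Om * R -> R) : M.-integrable dom
    (fun p => (f p * plancherel_density q p.2)%:E) <->
    M.-integrable setT (EFin \o (fun z => f z * wt z)).
  have := @integrable_mkcond _ _ R M dom
    (fun p => (f p * plancherel_density q p.2)%:E) measurable_dom.
  rewrite (_ : _ \_ dom = EFin \o (fun z => f z * wt z))//.
  by apply/funext => z /=; rewrite -weighted_patch /patch; case: ifP.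
have E1 : (fun z => cRe (F z.1 z.2 * (wt z)%:C)) = (fun z => cRe (F z.1 z.2) * wt z).
  by apply/funext => z; rewrite cReM /= mulr0 subr0.
have E2 : (fun z => cIm (F z.1 z.2 * (wt z)%:C)) = (fun z => cIm (F z.1 z.2) * wt z).
  by apply/funext => z; rewrite cImM /= mulr0 add0r.
rewrite /pl_integrable /cintble E1 E2.
by rewrite (K (fun p => cRe (F p.1 p.2))) (K (fun p => cIm (F p.1 p.2))).
Qed.

Lemma pl_integral_cint F :
  pl_integral nu F = cint M (fun z => F z.1 z.2 * (wt z)%:C).
Proof.
apply: complex_ext; rewrite ?cRe_cint ?cIm_cint /=.
  rewrite Rintegral_mkcond; apply: eq_Rintegral => z _.
  by rewrite (weighted_patch (fun p => cRe (F p.1 p.2))) cReM /= mulr0 subr0.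
rewrite Rintegral_mkcond; apply: eq_Rintegral => z _.
by rewrite (weighted_patch (fun p => cIm (F p.1 p.2))) cImM /= mulr0 add0r.
Qed.

Lemma FHtransform_delta x (w : Om) s : FHtransform (@delta R X x) w s = pwave w s x.
Proof.
rewrite /FHtransform -(fsbig_widen [set x])//.
  by rewrite fsbig_set1 deltaE eqxx mul1r.
move=> y [_ yx]; rewrite /=; case: (eqVneq y x) => [e|_]; last by rewrite mul0r.
by case: yx.
Qed.

Lemma pdo_delta (sigma : X -> Om -> R -> C) (T : {linear L2 R X -> L2 R X}) :
  is_pdo nu sigma T -> forall x y,
  cintble M (fun z => mwave z.1 z.2 y * sigma y z.1 z.2 * pwave z.1 z.2 x * (wt z)%:C) /\
  T (@delta R X x) y =
    cint M (fun z => mwave z.1 z.2 y * sigma y z.1 z.2 * pwave z.1 z.2 x * (wt z)%:C).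
Proof.
move=> pT x y.
have fin : finite_set [set t | @delta R X x t != 0].
  by rewrite delta_support; exact: finite_set1.
have [ip ->] := pT _ fin y.
have E : pdo_integrand sigma (@delta R X x) y =
    (fun w s => mwave w s y * sigma y w s * pwave w s x).
  by apply/funext => w; apply/funext => s; rewrite /pdo_integrand FHtransform_delta.
move: ip; rewrite E => /pl_integrable_cintble ip; split; first exact: ip.
by rewrite pl_integral_cint.
Qed.

End PlancherelIntegral.

(** * Recovering the symbol from the matrix of the adjoint *)

Section SymbolOfAdjoint.
Context (R : realType) (q : nat) (X : homTree q) (o : X).
Context (nu : probability (Omega o) R) (hnu : is_boundary_measure nu).
Local Notation C := R[i].
Local Notation leb := (@lebesgue_measure R).
Local Notation tau := (tau q : R).
Local Notation M := (nu \x leb)%E.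
Local Notation Om := (Omega o).
Local Notation wt z := (@weight R q z.2).
Local Notation dom := (@Defs.dom R q X o).
Implicit Types (x y : X) (s : R) (z : Om * R).
Let q1 := homTree_q X.

Context (sigma : X -> Om -> R -> C) (T : {linear L2 R X -> L2 R X}).
Context (sigma' : X -> Om -> R -> C) (T' : {linear L2 R X -> L2 R X}).
Hypothesis pT : is_pdo nu sigma T.
Hypothesis TT' : adjoint_of T T'.
Hypothesis msigma' : measurable_symbol sigma'.
Hypothesis pT' : is_pdo nu sigma' T'.

Lemma adjoint_delta x y : T' (delta R x) y = conjc (T (delta R y) x).
Proof.
have := TT' (delta R y) (delta R x).
by rewrite l2inner_deltar l2inner_deltal => ->; rewrite conjcK.
Qed.

Lemma pl_integral_adjoint x y :
  pl_integral nu (fun w s => conjc (sigma x w s) * pwave w s x * mwave w s y) =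
  T' (delta R x) y.
Proof.
have [ip E] := pdo_delta pT y x.
rewrite adjoint_delta E -cint_conj// pl_integral_cint; apply: eq_cint => z.
rewrite (conjcM (mwave z.1 z.2 x * sigma x z.1 z.2 * pwave z.1 z.2 y)).
rewrite (conjcM (mwave z.1 z.2 x * sigma x z.1 z.2)) (conjcM (mwave z.1 z.2 x)).
by rewrite conjc_real mwave_conj pwave_conj; ring.
Qed.

Context (y : X).

(** This is G. The symbol is measurable on [dom] only, so its real and imaginary parts are extended
    by 0 to obtain a function measurable on the whole product. *)
Definition symbol_wave z : C :=
  mwave z.1 z.2 y * (((fun p => cRe (sigma' y p.1 p.2)) \_ dom) z +i*
    ((fun p => cIm (sigma' y p.1 p.2)) \_ dom) z).

Lemma symbol_wave_in z : z.2 \in `[0, tau] ->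
  symbol_wave z = mwave z.1 z.2 y * sigma' y z.1 z.2.
Proof.
move=> zt; rewrite /symbol_wave /patch domE zt.
by congr (_ * _); exact: complex_ext.
Qed.

Lemma symbol_wave_weight z : symbol_wave z * (wt z)%:C =
  mwave z.1 z.2 y * sigma' y z.1 z.2 * (wt z)%:C.
Proof.
have [zt|zt] := boolP (z.2 \in `[0, tau]); first by rewrite symbol_wave_in.
by rewrite weight_out// !mulr0.
Qed.

Lemma cmeas_symbol_wave : cmeas symbol_wave.
Proof.
have [m1 m2] := msigma' y; apply: cmeasM; first exact: cmeas_mwave.
have md := @measurable_dom R q X o.
by split; apply/(measurable_restrictT _ md).
Qed.

Lemma symbol_wave_coef x :
  cint M (fun z => symbol_wave z * (wt z)%:C * pwave z.1 z.2 x) = T' (delta R x) y.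
Proof.
have [_ ->] := pdo_delta pT' x y; apply: eq_cint => z.
by rewrite symbol_wave_weight; ring.
Qed.

(** The wave of the root is 1, so this is the absolute convergence of the integral for the point
    mass at [o]. *)
Lemma cintble_symbol_wave : cintble M (fun z => symbol_wave z * (wt z)%:C).
Proof.
have [ip _] := pdo_delta pT' o y; rewrite (_ : (fun z => _) = (fun z =>
  mwave z.1 z.2 y * sigma' y z.1 z.2 * pwave z.1 z.2 o * (wt z)%:C))//.
by apply/funext => z; rewrite symbol_wave_weight pwave_root mulr1.
Qed.

Lemma adjoint_tail (eps : R) : 0 < eps -> exists F : {fset X}, forall D : {fset X},
  (forall x, x \in D -> x \notin F) ->
  \sum_(x <- D) normc (T' (delta R x) y) ^+ 2 <= eps.
Proof.
move=> e0; have [F FP] := L2_tail (T (delta R y)) e0; exists F => D /FP.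
apply: le_trans; rewrite le_eqVlt; apply/orP; left; apply/eqP.
apply: eq_bigr => x _; rewrite adjoint_delta.
by case: (T _ x) => u v /=; rewrite sqrrN.
Qed.

Local Notation a := (fun x => T' (delta R x) y).
Local Notation pref z := (wave q (- z.2) (- @height R q X o z.1 y)).
Local Notation S A := (@wsum R q X o a A).

Lemma pref_mwave z : pref z * mwave z.1 z.2 y = 1.
Proof. by rewrite mwave_wave waveVM. Qed.

Lemma normc_pref_le z : normc (pref z) <= wave_bound R o y.
Proof.
rewrite normc_wave; apply: ler_powR; first by rewrite ltW// qR_gt1.
rewrite ler_wpM2r// (le_trans (ler_norm _))// normrN.
exact: height_bounded.
Qed.

Lemma partial_sum_term z (A : {fset X}) :
  summability.partial_sum (fun x => pref z * (mwave z.1 z.2 x * T' (delta R x) y)) A =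
  pref z * S A z.
Proof.
rewrite /summability.partial_sum -(big_seq_fsetE _ A predT
  (fun x => pref z * (mwave z.1 z.2 x * T' (delta R x) y))) /= /wsum mulr_sumr.
by apply: eq_bigr => x _; congr (_ * _); rewrite mulrC.
Qed.

Lemma cmeas_pref : cmeas (fun z => pref z).
Proof.
apply: cmeas_wave.
  by apply: measurableT_comp => //; exact: measurable_snd.
apply: measurableT_comp => //.
exact: (measurableT_comp (@measurable_height R q X o y)).
Qed.

(** Heights at the fixed vertex [y] are bounded, so division by the wave of [y] costs only a
    constant factor in L^2. *)
Lemma symbol_L2_le (A : {fset X}) (e : R) :
  (normsq nu (fun z => symbol_wave z - S A z)%R <= e%:E)%E ->
  (\int[M]_(z in dom) (normc (sigma' y z.1 z.2 - pref z * S A z) ^+ 2 *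
     plancherel_density q z.2)%:E <= (wave_bound R o y ^+ 2 * e)%:E)%E.
Proof.
move=> h; have B0 : 0 <= wave_bound R o y by exact: powR_ge0.
pose g z := normc (pref z) ^+ 2 * (normc (symbol_wave z - S A z) ^+ 2 * wt z).
have mD : cmeas (fun z => symbol_wave z - S A z).
  by apply: cmeasB; [exact: cmeas_symbol_wave|exact: cmeas_wsum].
have mw : measurable_fun setT (fun z : Om * R => wt z) by exact: measurable_weight2.
have md : measurable_fun setT (fun z => normc (symbol_wave z - S A z) ^+ 2 * wt z).
  by apply: measurable_funM mw; exact: measurable_normc_sqr.
have mg : measurable_fun setT g.
  by apply: measurable_funM md; exact: measurable_normc_sqr cmeas_pref.
have d0 z : 0 <= normc (symbol_wave z - S A z) ^+ 2 * wt z.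
  by rewrite mulr_ge0 ?sqr_ge0// (weight_ge0 X).
have -> : (\int[M]_(z in dom) (normc (sigma' y z.1 z.2 - pref z * S A z) ^+ 2 *
     plancherel_density q z.2)%:E = \int[M]_z (g z)%:E)%E.
  rewrite integral_mkcond; apply: eq_integral => z _.
  rewrite /patch domE /g; case: ifPn => zt; last by rewrite weight_out// !mulr0.
  rewrite weight_in// symbol_wave_in// mulrA -exprMn -ComplexField.Normc.normcM.
  by rewrite mulrBr [pref z * (mwave _ _ _ * _)]mulrA pref_mwave mul1r.
apply: (@le_trans _ _ (\int[M]_z ((wave_bound R o y ^+ 2)%:E *
    (normc (symbol_wave z - S A z) ^+ 2 * wt z)%:E))%E).
  apply: ge0_le_integral => //.
  - by move=> z _; rewrite lee_fin mulr_ge0 ?sqr_ge0.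
  - exact/measurable_EFinP.
  - by apply/measurable_EFinP; apply: measurable_funM.
  - move=> z _; rewrite -EFinM lee_fin ler_wpM2r//.
    by rewrite ler_pXn2r ?nnegrE ?normc_ge0// normc_pref_le.
rewrite ge0_integralZl//; last 3 first.
- exact/measurable_EFinP.
- by move=> z _; rewrite lee_fin.
- by rewrite lee_fin sqr_ge0.
by rewrite [leRHS]EFinM lee_wpmul2l// lee_fin sqr_ge0.
Qed.

Lemma symbol_expansion : exists A_ : nat -> {fset X},
  [/\ forall x, exists N, forall n, (N <= n)%N -> x \in A_ n,
      \forall z \ae M, wt z != 0 ->
        (fun n => cRe (S (A_ n) z)) @ \oo --> cRe (symbol_wave z) /\
        (fun n => cIm (S (A_ n) z)) @ \oo --> cIm (symbol_wave z) &
      forall k A, (A_ k `<=` A)%fset ->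
        (normsq nu (fun z => symbol_wave z - S A z)%R <= (4^-1 ^+ k)%:E)%E].
Proof.
exact: (wave_expansion hnu adjoint_tail cmeas_symbol_wave cintble_symbol_wave symbol_wave_coef).
Qed.

Lemma symbol_L2_has_sum :
  L2_has_sum nu (fun x w s => wave q (- s) (- @height R q X o w y) *
    (mwave w s x * T' (delta R x) y)) (sigma' y).
Proof.
have [A_ [_ _ small]] := symbol_expansion.
pose N (A : {fset X}) : \bar R := (\int[M]_(z in dom)
  (normc (sigma' y z.1 z.2 - pref z * S A z) ^+ 2 * plancherel_density q z.2)%:E)%E.
have N0 A : (0 <= N A)%E.
  apply: integral_ge0 => z _; rewrite lee_fin mulr_ge0 ?sqr_ge0//.
  exact: (plancherel_density_ge0 X).
suff cN : N @ summability.totally --> 0%E.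
  rewrite /L2_has_sum (_ : (fun A => _) = N)//; apply/funext => A.
  by apply: eq_integral => z _; rewrite partial_sum_term.
have K e : 0 < e -> exists k, forall A, (A_ k `<=` A)%fset -> (N A <= e%:E)%E.
  move=> e0; set B := wave_bound R o y ^+ 2.
  have : (fun k => B * 4^-1 ^+ k) @ \oo --> (B * 0 : R).
    apply: cvgM; first exact: cvg_cst.
    by apply: cvg_expr; rewrite ger0_norm ?invf_lt1//; lra.
  rewrite mulr0 => /cvgr0_norm_le/(_ e e0)[k _ /(_ k (leqnn k))] /= ke.
  exists k => A /small/symbol_L2_le/le_trans; apply.
  by rewrite lee_fin (le_trans (ler_norm _)).
(* The estimates hold for every finite set containing [A_ k], not just along the sequence; this is
   what convergence along all finite sets asks for. *)
have near_tot (P : set {fset X}) k : (forall A, (A_ k `<=` A)%fset -> P A) ->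
    \forall A \near summability.totally, P A.
  by move=> h; exists (A_ k).
apply: cvg_EFin.
  have [k kP] := K 1 ltr01; apply: (near_tot _ k) => A /kP NA.
  by rewrite ge0_fin_numE// (le_lt_trans NA)// ltry.
apply/cvgr0Pnorm_le => e e0; have [k kP] := K e e0; apply: (near_tot _ k) => A /kP NA /=.
have fN : N A \is a fin_num by rewrite ge0_fin_numE// (le_lt_trans NA)// ltry.
rewrite ger0_norm ?fine_ge0//.
by rewrite -lee_fin fineK.
Qed.

(** The sine in the density vanishes only at the two end points of [[0, tau]]. Needed because limits
    of weighted sums say nothing where the weight is 0. *)
Lemma weight_neq0_ae : \forall z \ae M, z.2 \in `[0, tau] -> wt z != 0.
Proof.
have L0 : 0 < ln q%:R :> R by exact: lnq_gt0.
have mE : measurable ([set 0; tau] : set R) by apply: measurableU; exact: measurable_set1.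
exists (setT `*` [set 0; tau]); split; first exact: measurableX.
  apply: (eq_ind_r (fun t : \bar R => t = 0%E) _ (product_measure1E nu leb measurableT mE)).
  suff l0 : leb [set 0%R; tau] = 0%E.
    exact: (etrans (congr1 (fun t => nu setT * t)%E l0) (mule0 _)).
  apply: countable_lebesgue_measure0; apply: finite_set_countable.
  by rewrite finite_setU; split; exact: finite_set1.
move=> z /= /not_implyP[zt /negP]; rewrite negbK weight_in// plancherel_densityE// => w0.
split=> //=; have [z0|z0] := eqVneq z.2 0; first by left.
have [z1|z1] := eqVneq z.2 tau; first by right.
move: zt; rewrite in_itv /= => /andP[z2 z3].
have t0 : 0 < z.2 by rewrite lt_neqAle eq_sym z0.
have t1 : z.2 * ln q%:R < pi by rewrite -(tauL R q1) ltr_pM2r// lt_neqAle z1.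
have s0 : 0 < sin (z.2 * ln q%:R) by rewrite sin_gt0_pi// mulr_gt0.
exfalso; move/eqP: w0; apply/eqP; rewrite gt_eqF// mulr_gt0//.
  rewrite mulr_gt0 ?divr_gt0 ?mulr_gt0 ?pi_gt0 ?addr_gt0 ?invr_gt0 ?qR_gt0//.
by rewrite divr_gt0 ?bsqr_gt0// exprn_gt0.
Qed.

Lemma symbol_pointwise : \forall z \ae M, z.2 \in `[0, tau] -> forall s : C^o,
  summability.partial_sum (fun x => mwave z.1 z.2 x * T' (delta R x) y : C^o)
    @ summability.totally --> s ->
  sigma' y z.1 z.2 = pref z * s.
Proof.
have [A_ [exh lim _]] := symbol_expansion.
apply: ae_imply (ae_and lim weight_neq0_ae) => z [zlim w0] zt s cs.
have [hr hi] := zlim (w0 zt).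
(* Every finite set is eventually contained in [A_ n], so a sum over all finite sets, if it exists,
   is also the limit along this sequence. *)
have At : A_ @ \oo --> summability.totally.
  move=> P [F _ FP]; pose N x := sval (cid (exh x)).
  exists (\max_(x <- F) N x)%N => // n /= nN; apply: FP => /=.
  apply/fsubsetP => x xF; apply: (svalP (cid (exh x))).
  by apply: leq_trans nN; exact: leq_bigmax_seq.
have c : (fun n => S (A_ n) z : C^o) @ \oo --> s.
  apply: cvg_trans (cvg_comp _ _ At cs); apply: near_eq_cvg; apply: nearW => n.
  rewrite /= /summability.partial_sum -(big_seq_fsetE _ (A_ n) predT
    (fun x => mwave z.1 z.2 x * T' (delta R x) y)) /= /wsum.
  by apply: eq_bigr => x _; rewrite mulrC.
have part (p : C -> R) (u : C) : (forall v, `|p v| <= normc v) ->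
    (forall v w, p (v - w) = p v - p w) ->
    (fun n => p (S (A_ n) z)) @ \oo --> p u -> p s = p u.
  move=> pn pB cp; rewrite -(cvg_lim (@norm_hausdorff _ _) cp); apply/esym.
  apply: cvg_lim => //; apply/cvgrPdist_lt => e e0.
  have e0C : 0 < e%:C :> C by rewrite ltcR.
  move/cvgrPdist_lt : c => /(_ _ e0C); apply: filterS => n.
  rewrite -pB => h; apply: le_lt_trans (pn _) _.
  by rewrite -ltcR; exact: h.
have -> : s = symbol_wave z.
  apply: complex_ext.
    by apply: part hr => [v|u v]; [exact: cRe_le_normc|exact: cReB].
  by apply: part hi => [v|u v]; [exact: cIm_le_normc|exact: cImB].
by rewrite symbol_wave_in// mulrA pref_mwave mul1r.
Qed.

End SymbolOfAdjoint.

(** An operator determines its symbol only up to null sets, and the series over the vertices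
    converges in mean square. Hence the two readings of the formula: as an L^2 sum, and at almost
    every point at which the series is summable. *)
Theorem theorem5p5 (R : realType) (q : nat) (hq : (2 <= q)%N)
    (X : homTree q) (o : X)
    (nu : probability (Omega o) R) (hnu : is_boundary_measure nu)
    (sigma : X -> Omega o -> R -> R[i]) (T : {linear L2 R X -> L2 R X})
    (sigma' : X -> Omega o -> R -> R[i]) (T' : {linear L2 R X -> L2 R X}) :
  measurable_symbol sigma -> is_pdo nu sigma T -> nuclear T ->
  adjoint_of T T' ->
  measurable_symbol sigma' -> is_pdo nu sigma' T' ->
  forall y : X,
    let term (x : X) (w1 : Omega o) (s1 : R) : R[i] :=
      mwave w1 s1 x *
      pl_integral nu (fun w s => conjc (sigma x w s) * pwave w s x * mwave w s y) in
    let prefactor (w1 : Omega o) (s1 : R) : R[i] :=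
      qpow q (- ((2^-1 -i* s1) * (height w1 y)%:C)) in
    L2_has_sum nu (fun x w1 s1 => prefactor w1 s1 * term x w1 s1) (sigma' y)
    /\
    {ae (nu \x @lebesgue_measure R)%E, forall p, p.2 \in `[0, tau q] ->
      forall S : R[i]^o,
        summability.partial_sum (fun x => term x p.1 p.2 : R[i]^o)
          @ summability.totally --> S ->
        sigma' y p.1 p.2 = prefactor p.1 p.2 * S}.
Proof.
move=> _ pT _ TT' ms' pT' y term prefactor.
have termE x w s : term x w s = mwave w s x * T' (delta R x) y.
  by rewrite /term (pl_integral_adjoint pT TT').
have prefactorE w s : prefactor w s = wave q (- s) (- height w y).
  by rewrite /prefactor qpowVE.
split.
  rewrite (_ : (fun x w s => prefactor w s * term x w s) = (fun x w s =>
    wave q (- s) (- height w y) * (mwave w s x * T' (delta R x) y))).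
    exact: (symbol_L2_has_sum hnu TT' ms' pT' y).
  apply/funext => x; apply/funext => w; apply/funext => s.
  by rewrite termE prefactorE.
apply: ae_imply (symbol_pointwise hnu TT' ms' pT' y) => z zP zt S.
rewrite (_ : (fun x => term x z.1 z.2 : R[i]^o) =
    (fun x => mwave z.1 z.2 x * T' (delta R x) y : R[i]^o)); last first.
  by apply/funext => x; exact: termE.
by rewrite prefactorE; exact: zP.
Qed.
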